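(* Let $0<\beta<1$, $0<\alpha<\alpha+\beta<n$, and let $b$ be a locally integrable function on $\mathbb{Q}_p^n$. Then the following assertions are equivalent: (B.1) $b\in\Lambda_\beta(\mathbb{Q}_p^n)$. (B.2) The commutator $\mathcal{M}_{\alpha,b}^p$ is bounded from $L^{r(\cdot)}(\mathbb{Q}_p^n)$ to $L^{q(\cdot)}(\mathbb{Q}_p^n)$ for all $r(\cdot),q(\cdot)\in\mathscr{C}^{\log}(\mathbb{Q}_p^n)$ with $r(\cdot)\in\mathscr{P}(\mathbb{Q}_p^n)$, $r_+<\frac{n}{\alpha+\beta}$ and $1/q(\cdot)=1/r(\cdot)-(\alpha+\beta)/n$. (B.3) The commutator $\mathcal{M}_{\alpha,b}^p$ is bounded from $L^{r(\cdot)}(\mathbb{Q}_p^n)$ to $L^{q(\cdot)}(\mathbb{Q}_p^n)$ for some $r(\cdot),q(\cdot)\in\mathscr{C}^{\log}(\mathbb{Q}_p^n)$ with $r(\cdot)\in\mathscr{P}(\mathbb{Q}_p^n)$, $r_+<\frac{n}{\alpha+\beta}$ and $1/q(\cdot)=1/r(\cdot)-(\alpha+\beta)/n$. (B.4) There exist some $r(\cdot),q(\cdot)\in\mathscr{C}^{\log}(\mathbb{Q}_p^n)$ with $r(\cdot)\in\mathscr{P}(\mathbb{Q}_p^n)$, $r_+<\frac{n}{\alpha+\beta}$ and $1/q(\cdot)=1/r(\cdot)-(\alpha+\beta)/n$ such that $$\sup_{\gamma\in\mathbb{Z},\,x\in\mathbb{Q}_p^n}\frac{1}{|B_\gamma(x)|_h^{\beta/n}}\,\frac{\big\|\big(b-b_{B_\gamma(x)}\big)\chi_{B_\gamma(x)}\big\|_{L^{q(\cdot)}(\mathbb{Q}_p^n)}}{\|\chi_{B_\gamma(x)}\|_{L^{q(\cdot)}(\mathbb{Q}_p^n)}}<\infty.$$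 (B.5) For all $r(\cdot),q(\cdot)\in\mathscr{C}^{\log}(\mathbb{Q}_p^n)$ with $r(\cdot)\in\mathscr{P}(\mathbb{Q}_p^n)$, $r_+<\frac{n}{\alpha+\beta}$ and $1/q(\cdot)=1/r(\cdot)-(\alpha+\beta)/n$, the displayed supremum in (B.4) is finite.
   Context: Let $p$ be a prime, $n\ge1$, $\mathbb{Q}_p$ the field of $p$-adic numbers with $p$-adic absolute value $|\cdot|_p$, and $\mathbb{Q}_p^n$ equipped with $|x|_p=\max_{1\le j\le n}|x_j|_p$. For $\gamma\in\mathbb{Z}$ and $a\in\mathbb{Q}_p^n$, $B_\gamma(a)=\{x\in\mathbb{Q}_p^n:|x-a|_p\le p^\gamma\}$. Haar measure on $\mathbb{Q}_p^n$ is normalized by $|B_0(0)|_h=1$, so $|B_\gamma(a)|_h=p^{n\gamma}$; $|E|_h$ is the Haar measure of $E$, $dx$ denotes integration against it, and $\chi_E$ is the characteristic function of $E$. For a locally integrable $b$, $b_{B_\gamma(x)}=|B_\gamma(x)|_h^{-1}\int_{B_\gamma(x)}b(y)\,dy$. Functions are real-valued, and as usual functions equal almost everywhere are identified in function spaces. Maximal commutator: for $0\le\alpha<n$, $\mathcal{M}_{\alpha,b}^p(f)(x)=\sup_{\gamma\in\mathbb{Z}}|B_\gamma(x)|_h^{-1+\alpha/n}\int_{B_\gamma(x)}|b(x)-b(y)|\,|f(y)|\,dy$. An operator $T$ is bounded from a normed function space $X$ to $Y$ if there is a constant $C$ with $\|Tf\|_Y\le C\|f\|_X$ for all $f\in X$.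 Lipschitz space ($0<\beta<1$): $\Lambda_\beta(\mathbb{Q}_p^n)$ is the set of measurable $f$ with $\|f\|_{\Lambda_\beta(\mathbb{Q}_p^n)}=\sup_{x\ne y}\frac{|f(x)-f(y)|}{|x-y|_p^\beta}<\infty$. Variable exponents: for measurable $q(\cdot)$ on $\mathbb{Q}_p^n$ put $q_-=\operatorname{ess\,inf}_{x\in\mathbb{Q}_p^n}q(x)$, $q_+=\operatorname{ess\,sup}_{x\in\mathbb{Q}_p^n}q(x)$, and $q_\pm(B)$ for the corresponding quantities over a ball $B$. $\mathscr{P}(\mathbb{Q}_p^n)$ is the set of measurable $q(\cdot):\mathbb{Q}_p^n\to(1,\infty)$ with $1<q_-\le q(x)\le q_+<\infty$. $L^{q(\cdot)}(\mathbb{Q}_p^n)$ is the space of measurable $f$ with $\int_{\mathbb{Q}_p^n}(|f(x)|/\eta)^{q(x)}dx<\infty$ for some $\eta>0$, with norm $\|f\|_{L^{q(\cdot)}(\mathbb{Q}_p^n)}=\inf\{\eta>0:\int_{\mathbb{Q}_p^n}(|f(x)|/\eta)^{q(x)}dx\le1\}$. $\mathscr{C}^{\log}(\mathbb{Q}_p^n)$ is the set of $q(\cdot)\in\mathscr{P}(\mathbb{Q}_p^n)$ for which there is a constant $C>0$ such that (i) $\gamma\,(q_-(B_\gamma(x))-q_+(B_\gamma(x)))\le C$ for all $\gamma\in\mathbb{Z}$, $x\in\mathbb{Q}_p^n$, and (ii) $|q(x)-q(y)|\le\frac{C}{\log_p(p+\min\{|x|_p,|y|_p\})}$ for all $x,y\in\mathbb{Q}_p^n$.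 *)

(* Defs.v *)
From HB Require Import structures.
From mathcomp Require Import all_boot all_order all_algebra.
From mathcomp Require Import all_classical all_reals all_analysis.
From mathcomp Require Import measurable_realfun.
From mathcomp Require Import ring lra.

Set Implicit Arguments.
Unset Strict Implicit.
Unset Printing Implicit Defensive.

Import Order.TTheory GRing.Theory Num.Theory.
Import numFieldNormedType.Exports.

Local Open Scope classical_set_scope.
Local Open Scope ring_scope.

Definition padic_valq (p : nat) (x : rat) : int :=
  (logn p `|numq x|)%:Z - (logn p `|denq x|)%:Z.

Definition padic_absq (p : nat) (x : rat) : rat :=
  if x == 0 then 0 else p%:R ^ (- padic_valq p x).

Section PadicAbsRat.
Variables (p : nat) (p_pr : prime p).
Implicit Types x y z : rat.
Local Notation "|[ x ]|" := (padic_absq p x) (format "|[ x ]|").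

Let pq_gt0 : 0 < p%:R :> rat. Proof. by rewrite ltr0n prime_gt0. Qed.
Let pq_neq0 : p%:R != 0 :> rat. Proof. by rewrite gt_eqF. Qed.
Let pq_gt1 : 1 < p%:R :> rat. Proof. by rewrite ltr1n prime_gt1. Qed.

Lemma padic_absq0 : |[0]| = 0. Proof. by rewrite /padic_absq eqxx. Qed.

Lemma padic_absq_gt0 x : (0 < |[x]|) = (x != 0).
Proof. by rewrite /padic_absq; case: eqP => // _; rewrite exprz_gt0. Qed.

Lemma padic_absq_ge0 x : 0 <= |[x]|.
Proof.
have [->|x0] := eqVneq x 0; first by rewrite padic_absq0.
by rewrite ltW ?padic_absq_gt0.
Qed.

Lemma padic_absq_eq0 x : (|[x]| == 0) = (x == 0).
Proof.
apply/idP/idP => [|/eqP->]; last by rewrite padic_absq0.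
by apply: contraTT; rewrite -padic_absq_gt0 => /gt_eqF ->.
Qed.

Lemma padic_valq_frac (a b : int) : a != 0 -> b != 0 ->
  padic_valq p (a%:Q / b%:Q) = (logn p `|a|)%:Z - (logn p `|b|)%:Z.
Proof.
move=> a0 b0; set x := _ / _.
have x0 : x != 0 by rewrite mulf_neq0 ?invr_eq0 ?intr_eq0.
have E : numq x * b = a * denq x.
  apply/eqP; rewrite -(@eqr_int rat) !rmorphM /= -[X in _ == _ * X]/(denq x)%:Q.
  by rewrite -eqr_div ?intr_eq0// divq_num_den.
have nx0 : numq x != 0 by rewrite numq_eq0.
have : (logn p `|numq x| + logn p `|b| = logn p `|a| + logn p `|denq x|)%N.
  by rewrite -!lognM ?absz_gt0// -!abszM E.
move=> /(congr1 Posz); rewrite !PoszD /padic_valq => E2.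
apply/eqP; rewrite subr_eq addrAC eq_sym subr_eq -E2; exact/eqP.
Qed.

Lemma padic_absqM x y : |[x * y]| = |[x]| * |[y]|.
Proof.
have [->|x0] := eqVneq x 0; first by rewrite !(mul0r, padic_absq0).
have [->|y0] := eqVneq y 0; first by rewrite !(mulr0, padic_absq0).
rewrite /padic_absq mulf_eq0 (negPf x0) (negPf y0) /= -expfzDr//.
congr (_ ^ _); rewrite -opprD; congr (- _).
have -> : x * y = (numq x * numq y)%:Q / (denq x * denq y)%:Q.
  by rewrite -{1}[x]divq_num_den -{1}[y]divq_num_den mulf_div !rmorphM.
rewrite padic_valq_frac ?mulf_neq0 ?numq_eq0//.
rewrite /padic_valq !abszM !lognM ?absz_gt0 ?numq_eq0//.
by rewrite !PoszD opprD addrACA.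
Qed.

Lemma padic_absq1 : |[1]| = 1.
Proof. by rewrite /padic_absq /padic_valq oner_eq0 /= logn1 subrr oppr0 expr0z. Qed.

Lemma padic_absqV x : |[x^-1]| = |[x]|^-1.
Proof.
have [->|x0] := eqVneq x 0; first by rewrite !(invr0, padic_absq0).
apply: (mulfI (_ : |[x]| != 0)); first by rewrite padic_absq_eq0.
by rewrite -padic_absqM !divff ?padic_absq_eq0// padic_absq1.
Qed.

Lemma padic_absqN x : |[- x]| = |[x]|.
Proof. by rewrite /padic_absq oppr_eq0 /padic_valq numqN denqN abszN. Qed.

Lemma padic_absqB x y : |[x - y]| = |[y - x]|.
Proof. by rewrite -padic_absqN opprB. Qed.

Lemma padic_absq_int (a : int) : |[a%:~R]| <= 1.
Proof.
have [->|a0] := eqVneq a 0; first by rewrite padic_absq0.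
rewrite /padic_absq intr_eq0 (negPf a0) /padic_valq numq_int denq_int logn1 subr0.
by rewrite -exprnN invf_le1 ?exprn_gt0// exprn_ege1// ltW.
Qed.

Lemma padic_absq_le1D z : |[z]| <= 1 -> |[1 + z]| <= 1.
Proof.
have [->|z0] := eqVneq z 0; first by rewrite addr0 padic_absq1.
move=> z1.
have pd : ~~ (p %| `|denq z|)%N.
  apply/negP => pd.
  have pn : ~~ (p %| `|numq z|)%N.
    apply/negP => pn.
    have : (p %| gcdn `|numq z| `|denq z|)%N by rewrite dvdn_gcd pn pd.
    move: (coprime_num_den z); rewrite /coprime => /eqP->.
    by rewrite dvdn1 => /eqP p1; move: p_pr; rewrite p1.
  move: z1; rewrite /padic_absq (negPf z0) /padic_valq.
  rewrite (lognE _ `|numq z|) (negPf pn) !andbF sub0r opprK.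
  apply/negP; rewrite -ltNge -[1](expr0z (p%:R : rat)).
  rewrite -exprnP exprn_egt1// -lt0n.
  by rewrite logn_gt0 mem_primes p_pr pd absz_gt0 denq_eq0.
have -> : 1 + z = (denq z + numq z)%:~R / (denq z)%:~R.
  by rewrite rmorphD /= mulrDl divff ?intr_eq0 ?denq_eq0// divq_num_den.
rewrite padic_absqM padic_absqV {2}/padic_absq intr_eq0 denq_eq0 /padic_valq.
rewrite numq_int denq_int logn1 subr0 (lognE _ `|denq z|) (negPf pd) !andbF.
by rewrite oppr0 expr0z invr1 mulr1 padic_absq_int.
Qed.

Lemma padic_absqD x y : |[x + y]| <= Num.max |[x]| |[y]|.
Proof.
wlog xy : x y / |[y]| <= |[x]|.
  move=> W; have [yx|/ltW xy] := leP |[x]| |[y]|; first last.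
    by rewrite (le_trans (W _ _ xy))// max_l.
  by rewrite addrC (le_trans (W _ _ yx))// max_l.
have [x0|x0] := eqVneq x 0.
  by rewrite x0 add0r le_max lexx orbT.
have -> : x + y = x * (1 + y / x) by rewrite mulrDr mulr1 mulrCA divff// mulr1.
rewrite padic_absqM max_l// ler_piMr ?padic_absq_ge0// padic_absq_le1D//.
by rewrite padic_absqM padic_absqV ler_pdivrMr ?mul1r// padic_absq_gt0.
Qed.

Lemma padic_absq_lt x y e : |[x]| < e -> |[y]| < e -> |[x + y]| < e.
Proof. by move=> xe ye; rewrite (le_lt_trans (padic_absqD _ _))// gt_max xe ye. Qed.

Lemma padic_absq_eq x y : |[x - y]| < |[y]| -> |[x]| = |[y]|.
Proof.
move=> xy; apply/le_anti/andP; split.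
  rewrite -[x](subrK y) (le_trans (padic_absqD _ _))// ge_max lexx andbT.
  exact: ltW.
rewrite leNgt; apply/negP => yx.
have := padic_absq_lt yx (_ : |[y - x]| < |[y]|).
by rewrite padic_absqB xy addrC subrK ltxx => /(_ isT).
Qed.

End PadicAbsRat.

Section PadicNumbers.
Variables (p : nat) (p_pr : prime p).
Local Notation "|[ x ]|" := (padic_absq p x) (format "|[ x ]|").
Implicit Types u v : nat -> rat.

Definition is_padic_cauchy u : Prop :=
  forall e : rat, 0 < e ->
    exists N, forall m n, (N <= m)%N -> (N <= n)%N -> |[u m - u n]| < e.

Definition is_padic_null u : Prop :=
  forall e : rat, 0 < e -> exists N, forall n, (N <= n)%N -> |[u n]| < e.

(* The primality proof is an unused argument, needed for the algebraic
   instances below to be inferred. *)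
Definition padic_cauchy (pr : prime p) : pred (nat -> rat) :=
  fun u => `[< is_padic_cauchy u >].

Lemma padic_cauchy_bounded u : is_padic_cauchy u ->
  exists M : rat, 0 < M /\ exists N, forall n, (N <= n)%N -> |[u n]| <= M.
Proof.
move=> /(_ 1 ltr01)[N uN]; exists (Num.max 1 |[u N]|).
split; first by rewrite lt_max ltr01.
exists N => n Nn; rewrite -[u n](subrK (u N)).
rewrite (le_trans (padic_absqD p_pr _ _))// ge_max !le_max lexx orbT andbT.
by rewrite (ltW (uN _ _ _ _)).
Qed.

Lemma is_padic_cauchyM u v :
  is_padic_cauchy u -> is_padic_cauchy v -> is_padic_cauchy (u * v).
Proof.
move=> cu cv e e0.
have [M [M0 [N uM]]] := padic_cauchy_bounded cu.
have [K [K0 [L vK]]] := padic_cauchy_bounded cv.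
have [N1 uN1] := cu _ (divr_gt0 e0 K0).
have [N2 vN2] := cv _ (divr_gt0 e0 M0).
exists (maxn (maxn N L) (maxn N1 N2)) => m n.
rewrite !geq_max => /andP[/andP[mN mL] /andP[mN1 mN2]].
move=> /andP[/andP[nN nL] /andP[nN1 nN2]].
have -> : (u * v) m - (u * v) n = u m * (v m - v n) + (u m - u n) * v n.
  by rewrite mulrBr mulrBl addrA subrK.
apply: padic_absq_lt => //; rewrite padic_absqM//.
  rewrite (le_lt_trans (ler_wpM2r (padic_absq_ge0 p_pr _) (uM _ mN)))//.
  by rewrite mulrC -ltr_pdivlMr// vN2.
rewrite (le_lt_trans (ler_wpM2l (padic_absq_ge0 p_pr _) (vK _ nL)))//.
by rewrite -ltr_pdivlMr// uN1.
Qed.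

Lemma padic_cauchy_subring : GRing.subring_closed (padic_cauchy p_pr).
Proof.
split.
- apply/asboolP => e e0; exists 0%N => m n _ _.
  by rewrite subrr padic_absq0.
- move=> u v /asboolP cu /asboolP cv; apply/asboolP => e e0.
  have [N uN] := cu _ e0; have [L vL] := cv _ e0.
  exists (maxn N L) => m n; rewrite !geq_max => /andP[mN mL] /andP[nN nL].
  have -> : (u - v) m - (u - v) n = (u m - u n) + (v n - v m).
    by rewrite !fctE; ring.
  by apply: padic_absq_lt => //; [exact: uN|exact: vL].
- move=> u v /asboolP cu /asboolP cv; apply/asboolP.
  exact: is_padic_cauchyM.
Qed.

HB.instance Definition _ := GRing.isSubringClosed.Build (nat -> rat)
  (padic_cauchy p_pr) padic_cauchy_subring.

Record padic_cauchy_seq := PadicCauchySeq {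
  padic_seq :> nat -> rat ; padic_seqP : padic_seq \in padic_cauchy p_pr }.

HB.instance Definition _ := [isSub for padic_seq].
HB.instance Definition _ := [Choice of padic_cauchy_seq by <:].
HB.instance Definition _ :=
  [SubChoice_isSubComNzRing of padic_cauchy_seq by <:].

Lemma padic_seq0 : padic_seq 0 = 0. Proof. exact: (rmorph0 val). Qed.
Lemma padic_seq1 : padic_seq 1 = 1. Proof. exact: (rmorph1 val). Qed.
Lemma padic_seqD (u v : padic_cauchy_seq) :
  padic_seq (u + v) = padic_seq u + padic_seq v.
Proof. by case: u; case: v. Qed.
Lemma padic_seqN (u : padic_cauchy_seq) : padic_seq (- u) = - padic_seq u.
Proof. by case: u. Qed.
Lemma padic_seqM (u v : padic_cauchy_seq) :
  padic_seq (u * v) = padic_seq u * padic_seq v.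
Proof. by case: u; case: v. Qed.

Definition padic_null : pred padic_cauchy_seq :=
  fun u : padic_cauchy_seq => `[< is_padic_null u >].

Lemma padic_null_ideal : idealr_closed padic_null.
Proof.
split.
- apply/asboolP => e e0; exists 0%N => n _.
  by rewrite padic_seq0 padic_absq0.
- apply/asboolPn => /(_ 1 ltr01)[N] /(_ _ (leqnn N)).
  by rewrite padic_seq1 padic_absq1 ltxx.
- move=> a u v /asboolP nu /asboolP nv; apply/asboolP => e e0.
  have /asboolP ca := padic_seqP a.
  have [M [M0 [N aM]]] := padic_cauchy_bounded ca.
  have [K uK] := nu _ (divr_gt0 e0 M0); have [L vL] := nv _ e0.
  exists (maxn N (maxn K L)) => n; rewrite !geq_max => /and3P[nN nK nL].
  rewrite padic_seqD padic_seqM; apply: padic_absq_lt => //; last exact: vL.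
  rewrite padic_absqM//.
  rewrite (le_lt_trans (ler_wpM2r (padic_absq_ge0 p_pr _) (aM _ nN)))//.
  by rewrite mulrC -ltr_pdivlMr// uK.
Qed.

HB.instance Definition _ :=
  isIdealr.Build padic_cauchy_seq padic_null padic_null_ideal.

Definition padic_null_idealr : idealr padic_cauchy_seq := padic_null.

(* The completion of rat for padic_absq: Cauchy sequences modulo null
   sequences. *)
Definition Qp : Type := {ideal_quot padic_null_idealr}.

HB.instance Definition _ := GRing.ComNzRing.on Qp.

Lemma padic_abs_eventually u : is_padic_cauchy u -> ~ is_padic_null u ->
  exists c : rat, 0 < c /\ exists N, forall n, (N <= n)%N -> |[u n]| = c.
Proof.
move=> cu /existsNP[e /not_implyP[e0 /forallNP nu]].
have [N uN] := cu _ e0.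
have /existsNP[m /not_implyP[Nm /negP]] := nu N; rewrite -leNgt => em.
exists |[u m]|; split; first exact: lt_le_trans em.
exists N => n Nn; apply: padic_absq_eq => //.
by rewrite (lt_le_trans _ em)// uN.
Qed.

Lemma is_padic_cauchyV u : is_padic_cauchy u -> ~ is_padic_null u ->
  is_padic_cauchy (fun n => (u n)^-1).
Proof.
move=> cu nu e e0; have [c [c0 [N uc]]] := padic_abs_eventually cu nu.
have [K uK] := cu _ (mulr_gt0 e0 (mulr_gt0 c0 c0)).
exists (maxn N K) => m n; rewrite !geq_max => /andP[mN mK] /andP[nN nK].
have um0 : u m != 0 by rewrite -(padic_absq_gt0 p_pr) uc.
have un0 : u n != 0 by rewrite -(padic_absq_gt0 p_pr) uc.
have -> : (u m)^-1 - (u n)^-1 = (u n - u m) / (u m * u n).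
  by field; rewrite um0 un0.
rewrite padic_absqM// padic_absqV// padic_absqM// !uc//.
by rewrite ltr_pdivrMr ?mulr_gt0// uK.
Qed.

Lemma Qp_ex_inv (x : Qp) : x != 0 -> exists y : Qp, y * x = 1.
Proof.
rewrite -[x]reprK; set u := repr x => x0.
have cu : is_padic_cauchy u by exact/asboolP/padic_seqP.
have nu : ~ is_padic_null u.
  move=> nu; move/negP: x0; apply.
  by rewrite piE Quotient.equivE subr0; exact/asboolP.
have cv := is_padic_cauchyV cu nu.
pose v := PadicCauchySeq (asboolT cv : _ \in padic_cauchy p_pr).
exists (\pi_(Qp)%qT v); apply/eqP.
rewrite piE Quotient.equivE; apply/asboolP => e e0.
have [c [c0 [N uc]]] := padic_abs_eventually cu nu.
exists N => n Nn; rewrite padic_seqD padic_seqM padic_seqN padic_seq1 !fctE /=.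
have un0 : u n != 0 by rewrite -(padic_absq_gt0 p_pr) uc.
by rewrite mulVf// subrr padic_absq0.
Qed.

Definition Qp_inv (x : Qp) : Qp :=
  if x == 0 then 0 else xget 0 [set y | y * x = 1].

Lemma Qp_mulVx (x : Qp) : x != 0 -> Qp_inv x * x = 1.
Proof.
move=> x0; rewrite /Qp_inv (negPf x0).
by have [y yx] := Qp_ex_inv x0; case: xgetP => [_ _ //|/(_ y)].
Qed.

Lemma Qp_inv0 : Qp_inv 0 = 0. Proof. by rewrite /Qp_inv eqxx. Qed.

HB.instance Definition _ := GRing.ComNzRing_isField.Build Qp Qp_mulVx Qp_inv0.
HB.instance Definition _ := isPointed.Build Qp 0.

End PadicNumbers.

Section PadicAbs.
Variables (R : realType) (p : nat) (p_pr : prime p).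
Local Notation "|[ x ]|" := (padic_absq p x) (format "|[ x ]|").
Local Notation Qp := (Qp p_pr).
Implicit Types (x y : Qp) (u v : padic_cauchy_seq p_pr).

(* |x|_p is the limit of |u_n|_p for any Cauchy sequence u of rationals
   representing x, see padic_abs_cvg below. *)
Definition padic_abs x : R := limn (fun n => ratr |[repr x n]| : R).

Let cvg0P (w : nat -> rat) :
  ((fun n => ratr |[w n]| : R) @ \oo --> (0 : R)) <-> is_padic_null p w.
Proof.
split=> [/cvgr0Pnorm_lt w0 e e0|w0].
  have e0' : 0 < ratr e :> R by rewrite ltr0q.
  have [N _ Nw] := w0 _ e0'.
  exists N => n Nn; have := Nw n Nn => /=.
  by rewrite ger0_norm ?ler0q ?padic_absq_ge0// ltr_rat.
apply/cvgr0Pnorm_lt => e e0.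
have [q] := @rat_in_itvoo R 0 e e0.
rewrite in_itv /= => /andP[q0 qe].
have q0' : 0 < q by rewrite -(ltr0q R).
have [N Nw] := w0 _ q0'.
exists N => // n /= Nn.
rewrite ger0_norm ?ler0q ?padic_absq_ge0// (lt_trans _ qe)// ltr_rat.
exact: Nw.
Qed.

Lemma padic_abs_cvg u : (fun n => ratr |[u n]| : R) @ \oo -->
  padic_abs (\pi_(Qp)%qT u).
Proof.
have cu : is_padic_cauchy p u by exact/asboolP/padic_seqP.
set x := (\pi_(Qp)%qT u); pose v := repr x.
have uv : is_padic_null p (padic_seq (u - v)).
  suff : u - v \in padic_null_idealr p_pr by move/asboolP.
  by rewrite Quotient.idealrBE reprK.
rewrite /padic_abs -/v.
have [nu|nu] := pselect (is_padic_null p u).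
  have nv : is_padic_null p v.
    move=> e e0; have [N uN] := nu _ e0; have [K uvK] := uv _ e0.
    exists (maxn N K) => n; rewrite geq_max => /andP[nN nK].
    rewrite -[v n](subKr (u n)) padic_absq_lt ?uN// padic_absqN.
    by have := uvK _ nK; rewrite padic_seqD padic_seqN.
  have /cvg_lim -> // := (cvg0P v).2 nv; exact/cvg0P.
have [c [c0 [N uc]]] := padic_abs_eventually p_pr cu nu.
have [K uvK] := uv _ c0.
have ev (w : nat -> rat) : (forall n, (maxn N K <= n)%N -> |[w n]| = c) ->
    (fun n => ratr |[w n]| : R) @ \oo --> (ratr c : R).
  move=> wc; apply: cvg_near_cst; exists (maxn N K) => // n /= /wc ->//.
have uc' n : (maxn N K <= n)%N -> |[u n]| = c.
  by rewrite geq_max => /andP[/uc].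
have vc n : (maxn N K <= n)%N -> |[v n]| = c.
  move=> NKn; rewrite -(uc' _ NKn); apply: padic_absq_eq => //.
  rewrite padic_absqB uc'//.
  have := uvK n; rewrite padic_seqD padic_seqN; apply.
  by move: NKn; rewrite geq_max => /andP[].
by have /cvg_lim -> // := ev _ vc; exact: ev.
Qed.

Arguments padic_abs_cvg : clear implicits.

Lemma padic_abs_ge0 x : 0 <= padic_abs x.
Proof.
rewrite -[x]reprK; apply: (cvgr_to_ge (padic_abs_cvg _)).
by apply: nearW => n; rewrite ler0q padic_absq_ge0.
Qed.

Lemma padic_abs_eq0 x : (padic_abs x == 0) = (x == 0).
Proof.
rewrite -[x]reprK; set u := repr x.
have cu := padic_abs_cvg u; apply/eqP/eqP => [u0|].
  apply/eqP; rewrite piE Quotient.equivE subr0; apply/asboolP.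
  by apply/cvg0P; rewrite -u0.
move=> /eqP; rewrite piE Quotient.equivE subr0 => /asboolP/cvg0P u0.
exact: (cvg_unique _ cu u0).
Qed.

Lemma padic_absM x y : padic_abs (x * y) = padic_abs x * padic_abs y.
Proof.
rewrite -[x]reprK -[y]reprK; set u := repr x; set v := repr y.
have <- : (\pi_(Qp)%qT (u * v)) = \pi_(Qp)%qT u * \pi_(Qp)%qT v.
  by rewrite -rmorphM.
have h := cvgM (padic_abs_cvg u) (padic_abs_cvg v).
have cuv := padic_abs_cvg (u * v).
have E : (fun n => ratr |[padic_seq (u * v) n]| : R) =
    (fun n => ratr |[u n]| : R) \* (fun n => ratr |[v n]| : R).
  by apply: funext => n; rewrite padic_seqM fctE padic_absqM// rmorphM.
by rewrite E in cuv; exact: (cvg_unique _ cuv (h _)).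
Qed.

Lemma padic_absD x y :
  padic_abs (x + y) <= Num.max (padic_abs x) (padic_abs y).
Proof.
rewrite -[x]reprK -[y]reprK; set u := repr x; set v := repr y.
have <- : (\pi_(Qp)%qT (u + v)) = \pi_(Qp)%qT u + \pi_(Qp)%qT v.
  by rewrite -rmorphD.
rewrite leNgt; apply/negP => /midf_lt[]; set m := _ / 2.
rewrite gt_max => /andP[um vm]; apply/negP; rewrite -leNgt.
apply: (cvgr_to_le (padic_abs_cvg (u + v))).
near=> n; rewrite padic_seqD fctE ltW//.
have := padic_absqD p_pr (u n) (v n); rewrite -(ler_rat R) => /le_lt_trans; apply.
have un : ratr |[u n]| < m by near: n; exact: cvgr_lt (padic_abs_cvg u) _ um.
have vn : ratr |[v n]| < m by near: n; exact: cvgr_lt (padic_abs_cvg v) _ vm.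
by case: (leP |[u n]|).
Unshelve. all: by end_near. Qed.

Let padic_cst_subproof (q : rat) : (fun=> q : rat) \in padic_cauchy p_pr.
Proof.
apply: asboolT => e e0; exists 0%N => m n _ _.
by rewrite subrr padic_absq0.
Qed.

Let padic_cst (q : rat) : Qp :=
  \pi_(Qp)%qT (PadicCauchySeq (padic_cst_subproof q)).

Let padic_cstB : zmod_morphism padic_cst.
Proof.
by move=> a b; rewrite /padic_cst -rmorphB; congr (\pi_(Qp)%qT _); exact: val_inj.
Qed.

Let padic_cstM : monoid_morphism padic_cst.
Proof.
split.
  by rewrite /padic_cst -(rmorph1 \pi_(Qp)%qT); congr (\pi_(Qp)%qT _);
     exact: val_inj.
by move=> a b; rewrite /padic_cst -rmorphM; congr (\pi_(Qp)%qT _); exact: val_inj.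
Qed.

Let padic_cstE q : padic_cst q = ratr q.
Proof.
pose f1 := GRing.isZmodMorphism.Build _ _ padic_cst padic_cstB.
pose f2 := GRing.isMonoidMorphism.Build _ _ padic_cst padic_cstM.
pose f : {rmorphism rat -> Qp} := HB.pack padic_cst f1 f2.
by have := fmorph_eq_rat f q.
Qed.

Lemma padic_ratr_zmod_morphism : zmod_morphism (ratr : rat -> Qp).
Proof. by move=> a b; rewrite -!padic_cstE padic_cstB. Qed.

Lemma padic_ratr_monoid_morphism : monoid_morphism (ratr : rat -> Qp).
Proof.
by have [f1 fM] := padic_cstM; split=> [|a b]; rewrite -!padic_cstE.
Qed.

Lemma padic_abs_rat q : padic_abs (ratr q) = ratr |[q]|.
Proof.
rewrite -padic_cstE.
have cq := padic_abs_cvg (PadicCauchySeq (padic_cst_subproof q)).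
have h : (fun=> ratr |[q]| : R) @ \oo --> (ratr |[q]| : R) by exact: cvg_cst.
exact: (cvg_unique _ cq h).
Qed.

Lemma padic_rat_dense x (e : R) : 0 < e ->
  exists q : rat, padic_abs (x - ratr q) < e.
Proof.
move=> e0; have [r] := @rat_in_itvoo R 0 e e0.
rewrite in_itv /= => /andP[r0 re].
rewrite -[x]reprK; set u := repr x.
have cu : is_padic_cauchy p u by exact/asboolP/padic_seqP.
have r0' : 0 < r by rewrite -(ltr0q R).
have [N uN] := cu _ r0'.
exists (u N); rewrite -padic_cstE /padic_cst -rmorphB.
apply: le_lt_trans re; apply: (cvgr_to_le (padic_abs_cvg _)).
near=> n; rewrite padic_seqD padic_seqN fctE ler_rat ltW// uN//.
by near: n; exact: nbhs_infty_ge.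
Unshelve. all: by end_near. Qed.

Lemma padic_complete (X : nat -> Qp) :
  (forall e : R, 0 < e -> exists N, forall m n, (N <= m)%N -> (N <= n)%N ->
     padic_abs (X m - X n) < e) ->
  exists x, forall e : R, 0 < e -> exists N, forall n, (N <= n)%N ->
     padic_abs (X n - x) < e.
Proof.
move=> cX.
have abs_lt x y (e : R) : padic_abs x < e -> padic_abs y < e ->
    padic_abs (x + y) < e.
  by move=> xe ye; rewrite (le_lt_trans (padic_absD _ _))// gt_max xe.
have absB x y : padic_abs (x - y) = padic_abs (y - x).
  have N1 : ratr (- (1 : rat)) = -1 :> Qp.
    rewrite -[- (1 : rat)]sub0r padic_ratr_zmod_morphism.
    rewrite padic_ratr_monoid_morphism.1 -(subrr (0 : rat)).
    by rewrite padic_ratr_zmod_morphism subrr sub0r.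
  rewrite -opprB -mulN1r -N1.
  by rewrite padic_absM padic_abs_rat padic_absqN padic_absq1 rmorph1 mul1r.
have inv_small (e : R) : 0 < e -> exists N, forall n, (N <= n)%N ->
    n.+1%:R^-1 < e.
  move=> e0; exists (Num.truncn e^-1) => n Nn.
  rewrite invf_plt ?posrE//; apply: lt_le_trans (truncnS_gt _) _.
  by rewrite ler_nat ltnS.
have /choice[q Xq] (n : nat) : exists q : rat,
    padic_abs (X n - ratr q) < n.+1%:R^-1 by exact: padic_rat_dense.
have cq : is_padic_cauchy p q.
  move=> e e0; have e0' : 0 < ratr e :> R by rewrite ltr0q.
  have [N XN] := cX _ e0'; have [K Ke] := inv_small _ e0'.
  exists (maxn N K) => m n; rewrite !geq_max => /andP[mN mK] /andP[nN nK].
  rewrite -(ltr_rat R) -padic_abs_rat padic_ratr_zmod_morphism.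
  rewrite (_ : _ - _ = (ratr (q m) - X m) + ((X m - X n) + (X n - ratr (q n))));
    last by rewrite !addrA !subrK.
  apply: (abs_lt); first by rewrite absB; exact: lt_trans (Xq m) (Ke m mK).
  apply: (abs_lt); first exact: XN.
  exact: lt_trans (Xq n) (Ke n nK).
exists (\pi_(Qp)%qT (PadicCauchySeq (asboolT cq : _ \in padic_cauchy p_pr))).
set u := PadicCauchySeq _; move=> e e0.
have [r] := @rat_in_itvoo R 0 e e0.
rewrite in_itv /= => /andP[r0 re]; rewrite ltr0q in r0.
have [N qN] := cq _ r0; have [K Ke] := inv_small _ e0.
exists (maxn N K) => n; rewrite geq_max => /andP[nN nK].
rewrite -[X n](subrK (ratr (q n))) -addrA; apply: (abs_lt).
  exact: lt_trans (Xq n) (Ke n nK).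
rewrite -padic_cstE /padic_cst -rmorphB.
apply: le_lt_trans re; apply: (cvgr_to_le (padic_abs_cvg _)).
near=> m; rewrite padic_seqD padic_seqN fctE ler_rat ltW// qN//.
by near: m; exact: nbhs_infty_ge.
Unshelve. all: by end_near. Qed.

End PadicAbs.

Arguments padic_abs_cvg {R p p_pr} u.

Section PadicSpace.
Variables (R : realType) (p : nat) (p_pr : prime p) (n : nat).
Local Notation V := 'rV[Qp p_pr]_n.

Definition padic_norm (x : V) : R := \big[Num.max/0]_(j < n) padic_abs R (x 0 j).

Definition padic_ball (g : int) (a : V) : set V :=
  [set x | padic_norm (x - a) <= p%:R ^ g].

Definition padic_open (U : set V) : Prop :=
  forall x, U x -> exists g : int, padic_ball g x `<=` U.

(* Sets of zero Haar measure, described by coverings with balls B_g(a) of total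
   volume \sum p^(n g) as small as desired. *)
Definition padic_null_set (N : set V) : Prop :=
  forall e : R, 0 < e -> exists (g : nat -> int) (a : nat -> V),
    N `<=` \bigcup_i padic_ball (g i) (a i) /\
    (\sum_(0 <= i <oo) ((p%:R : R) ^ (n%:Z * g i))%:E < e%:E)%E.

(* The space Q_p^n with the sigma-algebra of its Haar-measurable sets, which is
   the completion of the Borel sigma-algebra. *)
Definition padic_space : Type :=
  g_sigma_algebraType
    ([set U | padic_open U] `|` [set N | padic_null_set N]).

HB.instance Definition _ := Measurable.on padic_space.

End PadicSpace.

Section VariableExponent.
Variables (R : realType) (p : nat) (p_pr : prime p) (n : nat).
Local Notation X := (padic_space R p_pr n).
Local Notation V := 'rV[Qp p_pr]_n.
Local Notation norm := (@padic_norm R p p_pr n).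
Local Notation B := (@padic_ball R p p_pr n).

(* These two conditions determine the Haar measure uniquely. *)
Definition is_haar_measure (mu : {measure set X -> \bar R}) : Prop :=
  (forall (a : V) (A : set X), measurable A ->
     mu [set (x : V) + a | x in A] = mu A) /\
  mu (B 0 0) = 1%E.

Variable mu : {measure set X -> \bar R}.
Implicit Types (b f q r : X -> R) (F : X -> \bar R).

Definition padic_locally_integrable b : Prop :=
  forall (g : int) (a : V), mu.-integrable (B g a) (EFin \o b).

Definition haar_volume (g : int) (a : V) : R := fine (mu (B g a)).

Definition ball_mean b (g : int) (a : V) : R :=
  (haar_volume g a)^-1 * \int[mu]_(y in B g a) b y.

Definition max_commutator (alpha : R) b f (x : X) : \bar R :=
  ereal_sup (range (fun g : int =>
    (haar_volume g x `^ (-1 + alpha / n%:R))%:E *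
    \int[mu]_(y in B g x) (`|b x - b y| * `|f y|)%:E)%E).

Definition lipschitz_space (beta : R) f : Prop :=
  measurable_fun setT f /\
  (ereal_sup [set (`|f z.1 - f z.2| / norm ((z.1 : V) - z.2) `^ beta)%:E
             | z in [set z : X * X | z.1 <> z.2]] < +oo)%E.

Definition ess_sup_on (D : set X) q : \bar R :=
  ereal_inf [set y | {ae mu, forall x, D x -> ((q x)%:E <= y)%E}].

Definition ess_inf_on (D : set X) q : \bar R :=
  ereal_sup [set y | {ae mu, forall x, D x -> (y <= (q x)%:E)%E}].

Definition exponent_class q : Prop :=
  [/\ measurable_fun setT q,
      forall x, 1 < q x,
      (1 < ess_inf_on setT q)%E,
      forall x, (ess_inf_on setT q <= (q x)%:E <= ess_sup_on setT q)%E &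
      (ess_sup_on setT q < +oo)%E].

Definition log_exponent_class q : Prop :=
  exponent_class q /\
  exists C : R, [/\ 0 < C,
    forall (g : int) (x : X),
      (g%:~R%:E * (ess_inf_on (B g x) q - ess_sup_on (B g x) q) <= C%:E)%E &
    forall x y : X,
      `|q x - q y| <=
        C / (ln (p%:R + Num.min (norm x) (norm y)) / ln p%:R)].

(* Functions are extended real-valued because a maximal function may take the
   value +oo. *)
Definition modular q F (eta : R) : \bar R :=
  (\int[mu]_x ((`|F x| * (eta^-1)%:E) `^ (q x)))%E.

Definition in_Lvar q F : Prop :=
  measurable_fun setT F /\ exists eta : R, 0 < eta /\ (modular q F eta < +oo)%E.

Definition Lvar_norm q F : \bar R :=
  ereal_inf [set eta%:E | eta in [set eta : R | 0 < eta /\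
                                              (modular q F eta <= 1)%E]].

Definition bounded_Lvar r q (T : (X -> R) -> (X -> \bar R)) : Prop :=
  exists C : R, forall f, in_Lvar r (EFin \o f) ->
    in_Lvar q (T f) /\
    (Lvar_norm q (T f) <= C%:E * Lvar_norm r (EFin \o f))%E.

Definition admissible_exponents (s : R) r q : Prop :=
  [/\ log_exponent_class r, log_exponent_class q, exponent_class r,
      (ess_sup_on setT r < (n%:R / s)%:E)%E &
      forall x, 1 / q x = 1 / r x - s / n%:R].

Definition oscillation_sup (beta : R) b q : \bar R :=
  ereal_sup [set
    ((haar_volume z.1 z.2 `^ (beta / n%:R))^-1%:E *
     (Lvar_norm q (fun y => ((b y - ball_mean b z.1 z.2) *
                             \1_(B z.1 z.2) y)%:E) /
      Lvar_norm q (fun y => (\1_(B z.1 z.2) y)%:E)))%E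
    | z in [set: int * X]].

End VariableExponent.

(* Main.v *)
Require Import Defs.
From HB Require Import structures.
From mathcomp Require Import all_boot all_order all_algebra.
From mathcomp Require Import all_classical all_reals all_analysis.
From mathcomp Require Import measurable_realfun.
From mathcomp Require Import ring lra zify.

(** Every assertion says in its own way that b oscillates by at most a multiple of
    p^(g beta) on balls of radius p^g, up to a null set.  Write t for
    (alpha + beta) / n and conj_exp t u for the exponent w with 1/w = 1/u - t, so
    that q = conj_exp t r pointwise.

    Lipschitz functions to the commutator.  If b is Lipschitz of order beta, then
    on a ball of radius p^g its oscillation is at most a constant times
    p^(g beta), which is the volume to the power beta / n.  Hence the commutator
    of order alpha is dominated almost everywhere by the fractional maximal
    operator fmax t (max_commutator_le_fmax), and the work lies in the boundedness
    of fmax t from L^r to L^q (fmax_modular).  The log-Hoelder condition enters as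
    log_hoelder_data: on small balls an exponent may be frozen at its essential
    infimum, far from the origin at its value at infinity, with an error that
    changes powers of the volume by bounded factors only.  A function f of modular
    at most 1 is split at height 1.  For the large part f1, the function
    F = f1^(r/m), where m is a lower bound of r, lies in L^m, and Hedberg's trick
    with the frozen exponents bounds (vol^t avg f1)^q by a multiple of
    (maxf F)^m.  The small part is integrable to the exponent at infinity up to
    an integrable weight, and is treated in the same way with that exponent.
    Both bounds are integrated by the Hardy-Littlewood maximal theorem for
    constant exponents (maxf_bounded), which here follows from a weak type bound
    without any covering lemma: two p-adic balls are nested or disjoint.

    The commutator to oscillation.  On a ball B the commutator of the
    characteristic function of B is at least |b - b_B| times a power of the volume
    (max_commutator_indic).  The norm of this characteristic function is
    comparable to the volume to the power 1/u with u the frozen exponent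
    (chi_norm_bounds), and the frozen exponents of r and q are again conjugate, so
    the volumes combine to the power beta / n (bounded_commutator_oscillation).

    Oscillation to Lipschitz functions.  On the part of a ball where q is close
    to the frozen exponent, at least half of it, a bound on the norm of b - b_B
    bounds its integral (osc_L1).  Consecutive means along concentric balls
    therefore differ by a multiple of p^(g beta), they converge as the radius
    tends to 0, and the limit is Lipschitz and equal to b almost everywhere
    (lipschitz_representative).  Conversely a Lipschitz function satisfies the
    oscillation bound for every exponent (lipschitz_oscillation), which moves the
    condition from one pair of exponents to all pairs; constant exponents provide
    a pair in the other direction (admissible_exponents_exist). *)

Set Implicit Arguments.
Unset Strict Implicit.
Unset Printing Implicit Defensive.

Import Order.TTheory GRing.Theory Num.Theory.
Import numFieldNormedType.Exports.

Local Open Scope classical_set_scope.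
Local Open Scope ring_scope.

(** * Digits of p-adic numbers *)

Section Digits.
Variables (p : nat) (p_pr : prime p).
Local Notation "|[ x ]|" := (padic_absq p x) (format "|[ x ]|").

Lemma padic_absq_prime : |[p%:R]| = p%:R^-1 :> rat.
Proof.
have p0 : (p%:R : rat) != 0 by rewrite pnatr_eq0 -lt0n prime_gt0.
rewrite /padic_absq (negPf p0) /padic_valq pmulrn numq_int denq_int logn1 subr0.
by rewrite absz_nat logn_prime// eqxx.
Qed.

Lemma padic_absq_exprz (k : int) : |[p%:R ^ k]| = p%:R ^ (- k).
Proof.
have X (m : nat) : |[p%:R ^+ m]| = p%:R ^- m.
  elim: m => [|m IH]; first by rewrite !expr0 invr1 padic_absq1.
  by rewrite !exprS padic_absqM// IH padic_absq_prime invfM.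
case: k => m; first by rewrite -exprnP X exprnN.
by rewrite NegzE -exprnN padic_absqV// X invrK opprK -exprnP.
Qed.

(** A Bezout relation u a + v b = 1 forces one of |a|, |b| to be 1, because
    u and v are integers. *)
Lemma padic_absq_coprime (a b : int) : coprimez a b -> |[a%:~R]| < 1 ->
  |[b%:~R]| = 1.
Proof.
move=> /coprimezP[[u v] /= uv] a1.
apply/eqP; rewrite eq_le padic_absq_int//= leNgt; apply/negP => b1.
have : |[1]| < 1.
  have uvq : u%:~R * a%:~R + v%:~R * b%:~R = 1 :> rat.
    by rewrite -!rmorphM -rmorphD /= uv.
  rewrite -[X in |[X]|]uvq; apply: padic_absq_lt => //; rewrite padic_absqM//.
    by rewrite (le_lt_trans _ a1)// ler_piMl ?padic_absq_ge0// padic_absq_int.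
  by rewrite (le_lt_trans _ b1)// ler_piMl ?padic_absq_ge0// padic_absq_int.
by rewrite padic_absq1 ltxx.
Qed.

Lemma padic_absq_primeM (m : int) : |[(m * p%:Z)%:~R]| <= p%:R^-1.
Proof.
rewrite rmorphM /= padic_absqM// [X in _ * X]padic_absq_prime.
by rewrite ler_piMl ?padic_absq_int// invr_ge0.
Qed.

Lemma padic_absq_prime_lt1 : |[p%:R]| < 1.
Proof. by rewrite padic_absq_prime invf_lt1 ?ltr0n ?ltr1n ?prime_gt0 ?prime_gt1. Qed.

(** The residue of a p-integral fraction: invert the denominator modulo p. *)
Lemma padic_digitq (q : rat) : |[q]| <= 1 ->
  exists d : 'I_p, |[q - d%:R]| <= p%:R^-1.
Proof.
move=> q1; set a := numq q; set b := denq q.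
have b0 : b%:~R != 0 :> rat by rewrite intr_eq0 denq_eq0.
have qE : q = a%:~R / b%:~R by rewrite divq_num_den.
have b1 : |[b%:~R]| = 1.
  have cab : coprimez a b by rewrite /coprimez /gcdz; exact: coprime_num_den.
  have := padic_absq_int p_pr b; rewrite le_eqVlt => /orP[/eqP//|blt].
  have : |[a%:~R]| < 1.
    have -> : a%:~R = q * b%:~R by rewrite qE divfK.
    by rewrite padic_absqM// (le_lt_trans _ blt)// ler_piMl ?padic_absq_ge0.
  by move=> /(padic_absq_coprime cab).
have /coprimezP[[e m] /= em] : coprimez b p%:Z.
  rewrite coprimez_sym coprimezE absz_nat prime_coprime//.
  apply/negP => /dvdnP[k bk]; move: b1.
  have -> : b%:~R = (k%:Z * p%:Z)%:~R :> rat.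
    by rewrite -[b]gez0_abs ?denq_ge0// bk PoszM.
  move=> k1; have := padic_absq_primeM k; rewrite k1.
  by rewrite leNgt invf_lt1 ?ltr0n ?ltr1n ?prime_gt0 ?prime_gt1.
set d' := a * e; have p0 : p%:Z != 0 by rewrite -lt0n prime_gt0.
have dE := divz_eq d' p; set d := (d' %% p)%Z in dE.
have d0 : 0 <= d by rewrite modz_ge0.
have dp : (`|d| < p)%N.
  by rewrite -ltz_nat gez0_abs// ltz_pmod// ltz_nat prime_gt0.
exists (Ordinal dp) => /=.
have -> : (`|d|%:R : rat) = d%:~R by rewrite pmulrn gez0_abs.
have -> : q - d%:~R = (a * m * p)%:~R / b%:~R + ((d' %/ p)%Z * p)%:~R.
  rewrite [X in _ = _ + X](_ : _ = d'%:~R - d%:~R); last first.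
    by rewrite {2}dE [in RHS]rmorphD /= addrK.
  rewrite addrA; congr (_ - _); rewrite qE /d'.
  apply: (mulIf b0); rewrite mulrDl !divfK// -rmorphM -rmorphD /=.
  by congr (_%:~R); rewrite -{1}[a]mulr1 -em; ring.
apply: (le_trans (padic_absqD p_pr _ _)); rewrite ge_max padic_absq_primeM andbT.
by rewrite padic_absqM// padic_absqV// b1 invr1 mulr1 padic_absq_primeM.
Qed.

Lemma padic_digit_inj (d d' : 'I_p) : |[d%:R - d'%:R]| <= p%:R^-1 -> d = d'.
Proof.
move=> dd; apply/eqP/negPn/negP => /negP dd'.
have /padic_absq_coprime : coprimez p (d%:Z - d'%:Z).
  rewrite coprimezE absz_nat prime_coprime//; apply/negP => /dvdn_leq.
  have : (`|d%:Z - d'%:Z| != 0)%N.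
    by apply/negP => /eqP h; apply: dd'; apply/eqP/val_inj => /=; lia.
  have := ltn_ord d; have := ltn_ord d'.
  by lia.
rewrite -[p%:~R]/p%:R => /(_ padic_absq_prime_lt1); rewrite rmorphB /= => d1.
by move: dd; rewrite d1 leNgt invf_lt1 ?ltr0n ?ltr1n ?prime_gt0 ?prime_gt1.
Qed.

End Digits.

(** * The geometry of balls *)

Section PadicAbsTheory.
Variables (R : realType) (p : nat) (p_pr : prime p).
Local Notation Qp := (Qp p_pr).
Local Notation abs := (@padic_abs R p p_pr).
Implicit Types x y : Qp.

Lemma padic_abs0 : abs 0 = 0.
Proof. by apply/eqP; rewrite padic_abs_eq0. Qed.

Lemma padic_abs1 : abs 1 = 1.
Proof.
apply: (@mulIf _ (abs 1)); first by rewrite padic_abs_eq0 oner_neq0.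
by rewrite -padic_absM !mul1r.
Qed.

Lemma padic_absN x : abs (- x) = abs x.
Proof.
rewrite -mulN1r padic_absM -[RHS]mul1r; congr (_ * _).
have : abs (-1) ^+ 2 = 1 by rewrite expr2 -padic_absM mulrNN mulr1 padic_abs1.
move=> /eqP; rewrite sqrf_eq1 => /orP[/eqP//|/eqP h].
by have := padic_abs_ge0 R (-1 : Qp); rewrite h; lra.
Qed.

Lemma padic_ratrB (a b : rat) : ratr (a - b) = ratr a - ratr b :> Qp.
Proof. exact: padic_ratr_zmod_morphism. Qed.

Lemma padic_ratrM (a b : rat) : ratr (a * b) = ratr a * ratr b :> Qp.
Proof. exact: (padic_ratr_monoid_morphism p_pr).2. Qed.

Lemma padic_abs_prime_exprz (k : int) : abs (ratr (p%:R ^ k)) = p%:R ^ (- k).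
Proof.
rewrite padic_abs_rat padic_absq_exprz//.
by rewrite fmorphXz rmorph_nat.
Qed.

Lemma padic_abs_near x y : abs (x - y) < abs x -> abs x = abs y.
Proof.
move=> xy; apply/le_anti/andP; split; last first.
  rewrite -[y](subKr x) (le_trans (padic_absD _ _ _))// padic_absN ge_max lexx /=.
  exact: ltW.
rewrite leNgt; apply/negP => yx.
have := padic_absD R (x - y) y; rewrite subrK leNgt gt_max xy yx//.
Qed.

(** Rational numbers are dense and |q|_p is a power of p for rational q. *)
Lemma padic_abs_exprz x : x != 0 -> exists k : int, abs x = p%:R ^ k.
Proof.
move=> x0; have ax : 0 < abs x by rewrite lt_def padic_abs_eq0 x0 padic_abs_ge0.
have [q xq] := padic_rat_dense x ax.
have xqE := padic_abs_near xq; exists (- padic_valq p q).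
rewrite xqE padic_abs_rat /padic_absq; case: eqP => [q0|_].
  by move: x0; rewrite -(padic_abs_eq0 R) xqE q0 padic_abs_rat padic_absq0 rmorph0 eqxx.
by rewrite fmorphXz rmorph_nat.
Qed.

Lemma padic_digit x : abs x <= 1 -> exists d : 'I_p, abs (x - ratr d%:R) <= p%:R^-1.
Proof.
move=> x1; have pV0 : 0 < p%:R^-1 :> R by rewrite invr_gt0 ltr0n prime_gt0.
have pV1 : p%:R^-1 <= 1 :> R by rewrite invf_le1 ?ltr0n ?ler1n ?prime_gt0.
have [q xq] := padic_rat_dense x pV0.
have q1 : padic_absq p q <= 1.
  rewrite -(ler_rat R) -(padic_abs_rat R p_pr) rmorph1 -[ratr q](subKr x).
  rewrite (le_trans (padic_absD _ _ _))// padic_absN ge_max x1 /=.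
  by rewrite (le_trans (ltW xq)).
have [d qd] := padic_digitq p_pr q1; exists d.
rewrite -[x](subrK (ratr q)) -addrA (le_trans (padic_absD _ _ _))//.
rewrite ge_max (ltW xq) /= -padic_ratrB padic_abs_rat.
by move: qd; rewrite -(ler_rat R) fmorphV rmorph_nat.
Qed.

End PadicAbsTheory.

Section Norm.
Variables (R : realType) (p : nat) (p_pr : prime p) (n : nat).
Local Notation V := 'rV[Qp p_pr]_n.
Local Notation norm := (@padic_norm R p p_pr n).
Implicit Types x y a : V.

Lemma prime_gt0R : 0 < p%:R :> R. Proof. by rewrite ltr0n prime_gt0. Qed.
Lemma prime_gt1R : 1 < p%:R :> R. Proof. by rewrite ltr1n prime_gt1. Qed.
Local Notation p_gt0 := prime_gt0R.
Local Notation p_gt1 := prime_gt1R.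

Lemma exprz_prime_gt0 (g : int) : 0 < (p%:R : R) ^ g.
Proof. exact: exprz_gt0 p_gt0. Qed.

Lemma ler_exprz_prime (g h : int) : ((p%:R : R) ^ g <= p%:R ^ h) = (g <= h).
Proof. by rewrite ler_eXz2l// p_gt1. Qed.

Lemma ltr_exprz_prime (g h : int) : ((p%:R : R) ^ g < p%:R ^ h) = (g < h).
Proof. by rewrite ltr_eXz2l// p_gt1. Qed.

Lemma padic_norm_leP x (t : R) : 0 <= t ->
  reflect (forall j, padic_abs R (x 0 j) <= t) (norm x <= t).
Proof.
move=> t0; apply: (iffP (bigmax_leP _ _ _ _)) => [[_ h] j|h]; first exact: h.
by split.
Qed.

Lemma padic_norm_ge0 x : 0 <= norm x.
Proof.
rewrite /padic_norm; elim/big_ind: _ => // [a b a0 b0|j _].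
  by rewrite le_max a0.
by rewrite padic_abs_ge0.
Qed.

Lemma padic_norm0 : norm 0 = 0.
Proof.
apply/le_anti; rewrite padic_norm_ge0 andbT; apply/padic_norm_leP => // j.
by rewrite mxE padic_abs0.
Qed.

Lemma padic_normN x : norm (- x) = norm x.
Proof. by apply: eq_bigr => j _; rewrite mxE padic_absN. Qed.

Lemma padic_normB x y : norm (x - y) = norm (y - x).
Proof. by rewrite -padic_normN opprB. Qed.

Lemma padic_normD x y : norm (x + y) <= Num.max (norm x) (norm y).
Proof.
apply/padic_norm_leP => [|j]; first by rewrite le_max padic_norm_ge0.
rewrite mxE (le_trans (padic_absD _ _ _))// ge_max !le_max.
by rewrite !(le_bigmax _ (fun j => padic_abs R (_ 0 j)) j) orbT.
Qed.

Lemma padic_norm_exprz x : x != 0 -> exists k : int, norm x = p%:R ^ k.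
Proof.
move=> x0; have [j xj] : exists j, x 0 j != 0.
  apply/existsP; apply: contraNT x0; rewrite negb_exists => /forallP h.
  apply/eqP/matrixP => i j; rewrite mxE ord1; apply/eqP; exact/negPn/h.
have [i _ xi] := @eq_bigmax _ _ _ 0 j xpredT
  (fun j => padic_abs R (x 0 j)) isT (fun j _ => padic_abs_ge0 _ _).
rewrite /padic_norm xi; apply: padic_abs_exprz; apply: contraNneq xj => xi0.
rewrite -(padic_abs_eq0 R) eq_le padic_abs_ge0 andbT.
move: (le_bigmax 0 (fun j => padic_abs R (x 0 j)) j).
by rewrite xi xi0 padic_abs0.
Qed.

Lemma padic_norm_eq0 x : norm x = 0 -> x = 0.
Proof.
move=> nx; apply/eqP/negPn/negP => /padic_norm_exprz[k]; rewrite nx => k0.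
by have := exprz_prime_gt0 k; rewrite -k0 ltxx.
Qed.

End Norm.

(** The norm and the balls are sealed, since conversion between p-adic
    expressions would otherwise unfold the completion of the rationals. *)
HB.lock Definition pnorm (R : realType) (p : nat) (p_pr : prime p) (n : nat)
  (x : padic_space R p_pr n) : R := padic_norm R (x : 'rV[Qp p_pr]_n).

HB.lock Definition pball (R : realType) (p : nat) (p_pr : prime p) (n : nat)
    (g : int) (a : padic_space R p_pr n) : set (padic_space R p_pr n) :=
  padic_ball R g (a : 'rV[Qp p_pr]_n).

HB.lock Definition rat_center (p : nat) (p_pr : prime p) (n : nat) (i : nat) :
  'rV[Qp p_pr]_n := map_mx ratr (odflt 0 (unpickle i : option 'rV[rat]_n)).

Section Balls.
Variables (R : realType) (p : nat) (p_pr : prime p) (n : nat).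
Local Notation V := 'rV[Qp p_pr]_n.
Local Notation X := (padic_space R p_pr n).
Local Notation norm := (@pnorm R p p_pr n).
Local Notation B := (@pball R p p_pr n).
Implicit Types x y a : X.

Lemma pballE g x : padic_ball R g (x : V) = B g x.
Proof. by rewrite pball.unlock. Qed.

Lemma pnormE x : padic_norm R (x : V) = norm x.
Proof. by rewrite pnorm.unlock. Qed.

Lemma pnorm_ge0 x : 0 <= norm x.
Proof. by rewrite pnorm.unlock; exact: padic_norm_ge0. Qed.

Lemma pball_center g a : B g a a.
Proof.
rewrite pball.unlock /padic_ball /= subrr padic_norm0.
exact/ltW/exprz_prime_gt0.
Qed.

Lemma pballC g a x : B g a x -> B g x a.
Proof. by rewrite pball.unlock /padic_ball /= padic_normB. Qed.

Lemma pball_trans g a x y : B g a x -> B g x y -> B g a y.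
Proof.
rewrite pball.unlock /padic_ball /= => ax xy.
have := padic_normD R ((y : V) - (x : V)) ((x : V) - (a : V)).
rewrite addrA subrK => /le_trans; apply.
by rewrite ge_max; apply/andP; split; [exact: xy|exact: ax].
Qed.

Lemma pball_eq g a x : B g a x -> B g x = B g a.
Proof.
move=> ax; apply/seteqP; split=> y; last exact: pball_trans (pballC ax).
exact: pball_trans ax.
Qed.

Lemma pball_sub g h a : (g <= h)%R -> B g a `<=` B h a.
Proof.
move=> gh x; rewrite pball.unlock /padic_ball /= => /le_trans; apply.
by rewrite ler_exprz_prime.
Qed.

Lemma pball_sub_radius g h a x : (g <= h)%R -> B h a x -> B g x `<=` B h a.
Proof. by move=> gh ax; rewrite -(pball_eq ax); exact: pball_sub. Qed.

Lemma pball_translate g a : B g a = [set (x : V) + (a : V) | x in B g (0 : V)].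
Proof.
rewrite pball.unlock; apply/seteqP; split=> [x ax|_ [x x0 <-]].
  exists ((x : V) - (a : V)); last exact: subrK.
  by rewrite /padic_ball /= subr0.
by move: x0; rewrite /padic_ball /= addrK subr0.
Qed.

Lemma pball0P g x : B g (0 : V) x <-> norm x <= p%:R ^ g.
Proof. by rewrite pball.unlock pnorm.unlock /padic_ball /= subr0. Qed.

Lemma pball_dist g a x : padic_norm R ((x : V) - (a : V)) = p%:R ^ g -> B g a x.
Proof. by rewrite pball.unlock /padic_ball /= => ->. Qed.

Lemma bigcup_ball0 : \bigcup_(k in [set: nat]) B k (0 : V) = [set: X].
Proof.
apply/seteqP; split=> // x _.
have [->|x0] := eqVneq (x : V) 0; first by exists 0%N => //; exact: pball_center.
have [k xk] := padic_norm_exprz R x0; exists `|k|%N => //; apply/pball0P.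
by rewrite -pnormE xk ler_exprz_prime; case: (k) => m //; exact: lexx.
Qed.

(** ** Measurability *)

Lemma padic_open_measurable (U : set X) :
  (forall x, U x -> exists g, B g x `<=` U) -> measurable U.
Proof.
move=> oU; apply: sub_sigma_algebra; left => x /oU[g gU]; exists g.
by rewrite pballE.
Qed.

Lemma measurable_pball g a : measurable (B g a).
Proof. by apply: padic_open_measurable => x ax; exists g; rewrite (pball_eq ax). Qed.

(** Preimages are unions of balls, hence open. *)
Lemma measurable_fun_locally_constant d (T : measurableType d) (f : X -> T) g :
  (forall a x, B g a x -> f x = f a) -> measurable_fun setT f.
Proof.
move=> fc _ A mA; rewrite setTI; apply: padic_open_measurable => x Ax.
by exists g => y /fc /= ->.
Qed.

Lemma padic_rat_vector_dense g x :
  exists c : 'rV[rat]_n, B g (map_mx ratr c : V) x.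
Proof.
have /choice[c cx] (j : 'I_n) : exists q : rat,
    padic_abs R ((x : V) 0 j - ratr q) < p%:R ^ g.
  exact/padic_rat_dense/exprz_prime_gt0.
exists (\row_j c j); rewrite pball.unlock; apply/padic_norm_leP => [|j].
  exact/ltW/exprz_prime_gt0.
by rewrite !mxE; exact/ltW/cx.
Qed.

(** The balls of a given radius are countably many, since each contains a
    rational point. *)
Lemma rat_center_dense g x : exists i, B g (rat_center p_pr n i) x.
Proof.
have [c cx] := padic_rat_vector_dense g x; exists (pickle c).
by rewrite rat_center.unlock pickleK.
Qed.

(** A partition of the space into balls of radius p^g, up to empty cells. *)
Definition ball_cell g : nat -> set X := seqDU (fun i => B g (rat_center p_pr n i)).

Lemma bigcup_ball_cell g : \bigcup_i ball_cell g i = setT.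
Proof.
rewrite -seqDU_bigcup_eq; apply/seteqP; split=> // x _.
by have [i ix] := rat_center_dense g x; exists i.
Qed.

Lemma trivIset_ball_cell g : trivIset setT (ball_cell g).
Proof. exact: trivIset_seqDU. Qed.

Lemma ball_cellE g i x : ball_cell g i x -> ball_cell g i = B g x.
Proof.
rewrite /ball_cell /seqDU => -[ix nx]; rewrite (pball_eq ix).
apply/seteqP; split=> [y [//]|y iy]; split=> //.
rewrite -(bigcup_mkord i (fun k => B g (rat_center p_pr n k))) => -[j /= jn jy].
apply: nx; rewrite -(bigcup_mkord i (fun k => B g (rat_center p_pr n k))).
exists j; first exact: jn.
by apply: pball_trans jy (pball_trans (pballC iy) ix).
Qed.

Lemma measurable_ball_cell g i : measurable (ball_cell g i).
Proof.
apply: measurableD; first exact: measurable_pball.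
by apply: bigsetU_measurable => j _; exact: measurable_pball.
Qed.

End Balls.

Section HaarBalls.
Variables (R : realType) (p : nat) (p_pr : prime p) (n : nat).
Local Notation V := 'rV[Qp p_pr]_n.
Local Notation X := (padic_space R p_pr n).
Local Notation B := (@pball R p p_pr n).
Variable mu : {measure set X -> \bar R}.
Hypothesis mu_haar : is_haar_measure mu.
Implicit Types x y a : X.

(** Representatives of the cosets of B_g in B_(g+1). *)
Definition digit_center (g : int) (d : {ffun 'I_n -> 'I_p}) : V :=
  \row_j (ratr (d j)%:R * ratr (p%:R ^ (- (g + 1)))).

Lemma padic_abs_scaled (g : int) (x : Qp p_pr) (t : R) :
  (padic_abs R (x * ratr (p%:R ^ (- (g + 1)))) <= p%:R ^ (g + 1) * t) =
  (padic_abs R x <= t).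
Proof.
rewrite padic_absM padic_abs_prime_exprz opprK mulrC ler_pM2l//.
exact: exprz_prime_gt0.
Qed.

Lemma exprz_primeS (g : int) : (p%:R : R) ^ g = p%:R ^ (g + 1) * p%:R^-1.
Proof. by rewrite -exprN1 -expfzDr ?addrK// gt_eqF// prime_gt0R. Qed.

Lemma pball_digits (g : int) :
  B (g + 1) (0 : V) = \bigcup_(d in [set: {ffun 'I_n -> 'I_p}]) B g (digit_center g d).
Proof.
apply/seteqP; split=> x.
  move=> /pball0P; rewrite -pnormE => xg.
  have /padic_norm_leP {}xg := xg.
  have /choice[d xd] (j : 'I_n) : exists d : 'I_p,
      padic_abs R ((x : V) 0 j * ratr (p%:R ^ (g + 1)) - ratr d%:R) <= p%:R^-1.
    apply: padic_digit; rewrite padic_absM padic_abs_prime_exprz.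
    have pg : 0 < (p%:R : R) ^ (g + 1) := exprz_prime_gt0 R p_pr _.
    by rewrite -invr_expz ler_pdivrMr// mul1r xg// ltW.
  exists [ffun j => d j] => //; rewrite pball.unlock; apply/padic_norm_leP => [|j].
    exact/ltW/exprz_prime_gt0.
  rewrite !mxE ffunE exprz_primeS.
  have -> : (x : V) 0 j - ratr (d j)%:R * ratr (p%:R ^ (- (g + 1))) =
     ((x : V) 0 j * ratr (p%:R ^ (g + 1)) - ratr (d j)%:R) *
     ratr (p%:R ^ (- (g + 1))).
    have uv : ratr (p%:R ^ (g + 1)) * ratr (p%:R ^ (- (g + 1))) = 1 :> Qp p_pr.
      have pq0 : (p%:R : rat) != 0 by rewrite pnatr_eq0 -lt0n prime_gt0.
      rewrite -padic_ratrM -(expfzDr _ _ pq0) (subrr (g + 1)) expr0z.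
      exact: (padic_ratr_monoid_morphism p_pr).1.
    move: uv; set u := ratr (p%:R ^ (g + 1)); set v := ratr (p%:R ^ _) => uv.
    by rewrite mulrBl -[in RHS]mulrA uv mulr1.
  by rewrite padic_abs_scaled.
move=> [d _] dx; suff : B (g + 1) (0 : V) (digit_center g d).
  have gg : g <= g + 1 by rewrite lerDl.
  by move=> /(pball_sub_radius gg); apply.
apply/pball0P; rewrite -pnormE; apply/padic_norm_leP => [|j].
  exact/ltW/exprz_prime_gt0.
rewrite mxE -[leRHS]mulr1 padic_abs_scaled padic_abs_rat.
by have := padic_absq_int p_pr (d j); rewrite -(ler_rat R) rmorph1.
Qed.

Lemma trivIset_digits (g : int) :
  trivIset setT (fun d : {ffun 'I_n -> 'I_p} => B g (digit_center g d)).
Proof.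
move=> d d' _ _ [x [dx d'x]]; apply/ffunP => j; apply: (padic_digit_inj p_pr).
have := pball_trans d'x (pballC dx); rewrite pball.unlock => /padic_norm_leP.
have pg : 0 <= (p%:R : R) ^ g by exact/ltW/exprz_prime_gt0.
move=> /(_ pg j); rewrite !mxE -mulrBl exprz_primeS padic_abs_scaled -padic_ratrB.
by rewrite padic_abs_rat -(ler_rat R) fmorphV rmorph_nat.
Qed.

Lemma haar_ball_center (g : int) a : mu (B g a) = mu (B g (0 : V)).
Proof.
have [inv _] := mu_haar; rewrite pball_translate inv//.
exact: measurable_pball.
Qed.

(** The ball B_(g+1) is the disjoint union of p^n translates of B_g, one for
    each vector of leading digits. *)
Lemma haar_ballS (g : int) :
  mu (B (g + 1) (0 : V)) = ((p%:R ^+ n)%:E * mu (B g (0%R : V)))%E.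
Proof.
pose N := #|{ffun 'I_n -> 'I_p}|.
pose F (i : 'I_N) := B g (digit_center g (enum_val i)).
have -> : B (g + 1) (0 : V) = \big[setU/set0]_(i < N) F i.
  rewrite -(bigcup_pred xpredT) pball_digits; apply/seteqP; split=> x [d _ dx].
    by exists (enum_rank d) => //; rewrite /F enum_rankK.
  by exists (enum_val d).
rewrite measure_bigsetU_ord; first last.
- move=> i j _ _ ij; apply: enum_val_inj.
  exact: (@trivIset_digits g _ _ I I ij).
- by move=> i; exact: measurable_pball.
rewrite (eq_bigr (fun=> mu (B g (0 : V)))) => [|i _]; last exact: haar_ball_center.
rewrite sumr_const /N card_ord card_ffun !card_ord.
rewrite -natrX; elim: (p ^ n)%N => [|k IH]; first by rewrite mulr0n mul0e.
by rewrite mulrS IH -natr1 EFinD addrC ge0_muleDl ?lee_fin// mul1e.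
Qed.

(** The normalisation at radius 1 and the ratio p^n of consecutive volumes. *)
Lemma haar_ball (g : int) a : mu (B g a) = (p%:R ^ (n%:Z * g))%:E.
Proof.
rewrite haar_ball_center.
have p0 : (p%:R : R) != 0 by rewrite gt_eqF// prime_gt0R.
have step (h : int) : (p%:R : R) ^ (n%:Z * (h + 1)) = p%:R ^+ n * p%:R ^ (n%:Z * h).
  by rewrite mulrDr mulr1 expfzDr// mulrC -exprnP.
elim/int_ind: g => [|m IH|m IH].
- by rewrite mulr0 expr0z; have [_] := mu_haar; rewrite pballE.
- by rewrite intS addrC haar_ballS IH -EFinM step.
- have := haar_ballS (- m.+1%:Z).
  have -> : - m.+1%:Z + 1 = - m%:Z by rewrite intS opprD addrC addrA subrr add0r.
  rewrite IH; have := step (- m.+1%:Z).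
  have -> : - m.+1%:Z + 1 = - m%:Z by rewrite intS opprD addrC addrA subrr add0r.
  move=> ->.
  have pn0 : p%:R ^+ n != 0 :> R by rewrite expf_neq0.
  case: (mu _) => [r| |] //=.
  + by rewrite -EFinM => -[] /(mulfI pn0) ->.
  + by rewrite mulry gtr0_sg ?mul1e// exprn_gt0// prime_gt0R.
  + by rewrite mulrNy gtr0_sg ?mul1e// exprn_gt0// prime_gt0R.
Qed.

(** p^(n g) as a real power: its exponents are real in all estimates. *)
Definition vol (g : int) : R := p%:R `^ (n%:R * g%:~R).

Lemma volE (g : int) a : mu (B g a) = (vol g)%:E.
Proof.
rewrite haar_ball /vol; congr (_%:E).
by rewrite -powR_intmul ?ltW ?prime_gt0R// rmorphM.
Qed.

End HaarBalls.

(** * The maximal function *)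

Section Maximal.
Variables (R : realType) (p : nat) (p_pr : prime p) (n : nat).
Local Notation X := (padic_space R p_pr n).
Local Notation B := (@pball R p p_pr n).
Local Notation vol := (@vol R p n).
Local Notation cell := (@ball_cell R p p_pr n).
Variable mu : {measure set X -> \bar R}.
Hypothesis mu_haar : is_haar_measure mu.
Hypothesis n_gt0 : (0 < n)%N.
Implicit Types (x y a : X) (f : X -> \bar R) (g : int).

Lemma vol_gt0 g : 0 < vol g.
Proof. by rewrite powR_gt0// prime_gt0R. Qed.

Lemma vol_ge0 g : 0 <= vol g. Proof. exact/ltW/vol_gt0. Qed.

Lemma vol_neq0 g : vol g != 0. Proof. exact/lt0r_neq0/vol_gt0. Qed.

Lemma ler_vol g h : (g <= h)%R -> vol g <= vol h.
Proof.
move=> gh; apply: ler_powR; first exact/ltW/prime_gt1R.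
by rewrite ler_wpM2l// ler_int.
Qed.

(** The volumes are unbounded because the dimension is positive. *)
Lemma vol_unbounded (t : R) : exists N : int, t < vol N.
Proof.
exists (Num.truncn t).+1; apply: (lt_trans (truncnS_gt t)).
rewrite /vol; set m := (Num.truncn t).+1.
apply: (@lt_le_trans _ _ (p%:R `^ m%:R)).
  by rewrite powR_mulrn ?ltW ?prime_gt0R// -natrX ltr_nat ltn_expl// prime_gt1.
apply: ler_powR; first exact/ltW/prime_gt1R.
by rewrite -[leLHS]mul1r ler_pM// ler1n.
Qed.

Lemma measurable_fun_int_sup (F : int -> X -> \bar R) :
  (forall g, measurable_fun setT (F g)) ->
  measurable_fun setT (fun x => ereal_sup (range (fun g => F g x))).
Proof.
move=> mF mT; apply: (measurability _ (ErealGenOInfty.measurableE R)) => //.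
move=> _ [_ [t ->] <-]; rewrite setTI.
have -> : (fun x => ereal_sup (range (fun g => F g x))) @^-1` `]t%:E, +oo[ =
    \bigcup_g [set x | (t%:E < F g x)%E].
  apply/seteqP; split=> x /=.
    rewrite in_itv/= andbT => /ereal_sup_gt[_ [g _ <-] tg]; by exists g.
  by move=> [g _ tg]; rewrite in_itv/= andbT; apply/ereal_sup_gtP; exists (F g x).
apply: countable_bigcupT_measurable => // g.
by rewrite -[X in measurable X]setTI; exact: emeasurable_fun_o_infty.
Qed.

Definition avg f g x : \bar R := ((vol g)^-1%:E * \int[mu]_(y in B g x) f y)%E.

Definition maxf f x : \bar R := ereal_sup (range (fun g => avg f g x)).

Lemma avg_eq f g a x : B g a x -> avg f g x = avg f g a.
Proof. by move=> ax; rewrite /avg (pball_eq ax). Qed.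

Lemma measurable_avg f g : measurable_fun setT (avg f g).
Proof. by apply: (@measurable_fun_locally_constant R p p_pr n _ _ _ g) => a x /avg_eq. Qed.

Lemma measurable_maxf f : measurable_fun setT (maxf f).
Proof. by apply: measurable_fun_int_sup => g; exact: measurable_avg. Qed.

Lemma avg_ge0 f g x : (forall y, 0 <= f y)%E -> (0 <= avg f g x)%E.
Proof.
move=> f0; rewrite mule_ge0//; last by apply: integral_ge0.
by rewrite lee_fin invr_ge0 vol_ge0.
Qed.

Lemma avg_le_maxf f g x : (avg f g x <= maxf f x)%E.
Proof. by apply: ereal_sup_ubound; exists g. Qed.

Lemma maxf_ge0 f x : (forall y, 0 <= f y)%E -> (0 <= maxf f x)%E.
Proof. by move=> f0; apply: le_trans (avg_le_maxf f 0 x); exact: avg_ge0. Qed.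

(** Averaging over balls of radius p^g preserves integrals over unions of such
    balls: on each cell of the partition the average is constant. *)
Lemma integral_avg f g (E : set X) : measurable_fun setT f ->
  (forall x, 0 <= f x)%E -> (forall x, E x -> B g x `<=` E) ->
  (\int[mu]_(x in E) avg f g x = \int[mu]_(x in E) f x)%E.
Proof.
move=> mf f0 gE.
have mE : measurable E by apply: padic_open_measurable => x /gE xE; exists g.
have EU : E = \bigcup_i (cell g i `&` E).
  by rewrite -setI_bigcupl bigcup_ball_cell setTI.
have mC i : measurable (cell g i `&` E).
  by apply: measurableI => //; exact: measurable_ball_cell.
have tC : trivIset setT (fun i => cell g i `&` E).
  by apply: trivIset_setIr; exact: trivIset_ball_cell.
rewrite EU !ge0_integral_bigcup//; first last.
- by move=> x _; exact: avg_ge0.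
- by apply: measurable_funTS; exact: measurable_avg.
- exact: measurable_funTS.
apply: eq_eseriesr => i _.
have [->|/set0P[x [ix Ex]]] := eqVneq (cell g i `&` E) set0.
  by rewrite !integral_set0.
have -> : cell g i `&` E = B g x.
  by rewrite (ball_cellE ix); apply: setIidl; exact: gE.
rewrite (eq_integral (fun=> avg f g x)) => [|y]; last first.
  by rewrite inE => /avg_eq.
rewrite integral_cst//; last exact: measurable_pball.
by rewrite volE// /avg muleAC -EFinM mulVf ?vol_neq0// mul1e.
Qed.

(** The weak type (1,1) bound, by a stopping time argument: the superlevel set
    splits according to the largest radius whose average exceeds t, and each
    piece is a union of balls of that radius. *)
Lemma weak_type_maxf f (t : R) : 0 < t -> measurable_fun setT f ->
  (forall x, 0 <= f x)%E ->
  (t%:E * mu [set x | t%:E < maxf f x] <= \int[mu]_x f x)%E.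
Proof.
move=> t0 mf f0; have [->|fint] := eqVneq (\int[mu]_x f x)%E +oo%E.
  exact: leey.
have If : (\int[mu]_x f x)%E = (fine (\int[mu]_x f x))%:E.
  rewrite fineK// ge0_fin_numE ?ltey//; exact: integral_ge0.
set I := fine _ in If.
have I0 : 0 <= I by rewrite -lee_fin -If; exact: integral_ge0.
have [N IN] := vol_unbounded (I / t).
(* Averages over balls of volume at least I / t are at most t, so a largest
   radius exists. *)
have large g x : (N <= g)%R -> (avg f g x <= t%:E)%E.
  move=> Ng; have : (avg f g x <= (vol g)^-1%:E * I%:E)%E.
    rewrite lee_pmul2l// ?lte_fin ?invr_gt0 ?vol_gt0// -If.
    by apply: ge0_subset_integral => //; exact: measurable_pball.
  move=> /le_trans; apply; rewrite -EFinM lee_fin mulrC ler_pdivrMr ?vol_gt0//.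
  rewrite mulrC -ler_pdivrMr//; apply: (le_trans (ltW IN)); exact: ler_vol.
pose E (i : nat) := [set x | (t%:E < avg f (N - i%:Z) x)%E /\
  forall j : nat, (j < i)%N -> (avg f (N - j%:Z) x <= t%:E)%E].
have EB i x y : E i x -> B (N - i%:Z) x y -> E i y.
  move=> [tx jx] xy; split; first by rewrite (avg_eq _ xy).
  move=> j ji; rewrite (@avg_eq f (N - j%:Z) x) ?jx//.
  by apply: pball_sub xy; rewrite lerD2l lerN2 lez_nat ltnW.
have mE i : measurable (E i).
  by apply: padic_open_measurable => x xE; exists (N - i%:Z) => y; exact: EB.
have tE : trivIset setT E.
  apply/trivIsetP => i j _ _ ij; apply/seteqP; split=> // x [[ti hi] [tj hj]].
  move: ij; rewrite neq_ltn => /orP[/hj|/hi]; first by rewrite leNgt ti.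
  by rewrite leNgt tj.
have UE : [set x | (t%:E < maxf f x)%E] = \bigcup_i E i.
  apply/seteqP; split=> x /=; last first.
    by move=> [i _ [ti _]]; exact: lt_le_trans ti (avg_le_maxf _ _ _).
  move=> /ereal_sup_gt[_ [g _ <-] tg].
  have gN : (g < N)%R by rewrite ltNge; apply/negP => /large h; have := h x; rewrite leNgt tg.
  have exi : exists i : nat, `[< (t%:E < avg f (N - i%:Z) x)%E >].
    exists `|N - g|%N; apply/asboolP.
    by rewrite gez0_abs ?subr_ge0 1?ltW// subKr.
  case: (ex_minnP exi) => i /asboolP ti imin; exists i => //; split=> // j ji.
  by rewrite leNgt; apply/negP => /asboolP/imin; rewrite leqNgt ji.
rewrite UE -integral_cst; last exact: bigcupT_measurable.
apply: (@le_trans _ _ (\int[mu]_(x in \bigcup_i E i) f x)%E); last first.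
  by apply: ge0_subset_integral => //; exact: bigcupT_measurable.
rewrite !ge0_integral_bigcup//; [|exact: measurable_funTS|by move=> x _; rewrite lee_fin ltW].
apply: lee_nneseries => [i _ _|i _]; first by apply: integral_ge0 => x _; rewrite lee_fin ltW.
rewrite -(@integral_avg f (N - i%:Z))//; last by move=> x Ex y; exact: EB.
apply: ge0_le_integral => //.
- by move=> x _; rewrite lee_fin ltW.
- by apply: measurable_funTS; exact: measurable_avg.
- by move=> x [/ltW].
Qed.

End Maximal.

Section StrongType.
Variables (R : realType) (p : nat) (p_pr : prime p) (n : nat).
Local Notation X := (padic_space R p_pr n).
Local Notation B := (@pball R p p_pr n).
Local Notation vol := (@vol R p n).
Variable mu : {measure set X -> \bar R}.
Hypothesis mu_haar : is_haar_measure mu.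
Hypothesis n_gt0 : (0 < n)%N.

Lemma dyadic_bracket (u : R) : 0 < u ->
  exists j : int, (2 : R) ^ j < u <= 2 ^ (j + 1).
Proof.
move=> u0; have ln2 : 0 < ln 2 :> R by rewrite ln_gt0// ltr1n.
have pw (j : int) : (2 : R) ^ j = expR (j%:~R * ln 2).
  by rewrite -powR_intmul// /powR pnatr_eq0.
pose L := ln u / ln 2; exists (Num.ceil L - 1).
have uE : u = expR (L * ln 2) by rewrite divfK ?gt_eqF// lnK.
rewrite subrK !pw {1 2}uE ltr_expR ler_expR ltr_pM2r// ler_pM2r//.
by rewrite rmorphB /= ltrBlDr -ltrBlDr -rmorphB /= ceilB1_lt// ceil_ge.
Qed.

(** A geometric sum is dominated by its last term. *)
Lemma geometric_below (x s w : R) m : 1 < x -> 0 < s -> 0 <= w ->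
  \sum_(i < m) (if s * x ^+ i < w then s * x ^+ i else 0) <= x / (x - 1) * w.
Proof.
move=> x1 s0 w0; have x10 : 0 < x - 1 by rewrite subr_gt0.
have x0 : 0 < x by exact: lt_trans x1.
elim: m => [|m IH].
  by rewrite big_ord0 mulr_ge0// divr_ge0// ltW.
case: (ltP (s * x ^+ m) w) => [sw|ws]; last first.
  by rewrite big_ord_recr /= ltNge ws /= addr0.
apply: (@le_trans _ _ (\sum_(i < m.+1) s * x ^+ i)).
  by apply: ler_sum => i _; case: ifP => // _; rewrite mulr_ge0 ?exprn_ge0// ltW.
rewrite -mulr_sumr mulrAC ler_pdivlMr// -mulrA [X in s * X]mulrC -subrX1.
rewrite (@le_trans _ _ (s * x ^+ m.+1))//.
  by rewrite ler_pM2l// lerBlDr lerDl.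
by rewrite exprS mulrCA ler_pM2l// ltW.
Qed.

(** Sums over the integers are series over nat whose i-th term collects the
    indices i and -(i+1). *)
Lemma sum_int_window (F : int -> R) m :
  \sum_(i < m) (F i%:Z + F (- i.+1%:Z)) = \sum_(i < m + m) F (i%:Z - m%:Z).
Proof.
rewrite big_split big_split_ord /= addrC; congr (_ + _).
  rewrite (reindex_inj rev_ord_inj) /=; apply: eq_bigr => i _; congr F.
  by have := ltn_ord i; lia.
by apply: eq_bigr => i _; congr F; lia.
Qed.

Lemma le_nneseries_term (u : (\bar R)^nat) i : (forall i, 0 <= u i)%E ->
  (u i <= \sum_(0 <= i <oo) u i)%E.
Proof.
move=> u0; apply: le_trans (nneseries_lim_ge i.+1 _) => //.
rewrite big_mkord big_ord_recr /= leeDr//; exact: sume_ge0.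
Qed.

Section Exponent.
Variables (rho : R) (rho1 : 1 < rho).

Let rho0 : 0 < rho. Proof. exact: lt_trans rho1. Qed.

Let c (j : int) : R := ((2 : R) ^ (j + 1)) `^ rho.

Let c_ge0 j : 0 <= c j. Proof. exact: powR_ge0. Qed.

(** The layers 2^j < u of a dyadic layer cake; c j bounds u^rho from above as
    long as u <= 2^(j+1). *)
Let layer (u : \bar R) (j : int) : \bar R :=
  if (((2 : R) ^ j)%:E < u)%E then (c j)%:E else 0%E.

Let layer_ge0 u j : (0 <= layer u j)%E.
Proof. by rewrite /layer; case: ifP => // _; rewrite lee_fin. Qed.

Let layer_le (u : \bar R) j :
  (layer u j <= \sum_(0 <= i <oo) (layer u i%:Z + layer u (- i.+1%:Z)%R))%E.
Proof.
case: j => i.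
  apply: (le_trans _ (@le_nneseries_term _ i _)) => [|k]; first by rewrite leeDl.
  by rewrite adde_ge0.
apply: (le_trans _ (@le_nneseries_term _ i _)) => [|k]; first by rewrite NegzE leeDr.
by rewrite adde_ge0.
Qed.

(** For finite u > 0 the highest layer below u alone is at least u^rho; for
    u = +oo the layers are unbounded. *)
Lemma poweR_le_layers (u : \bar R) : (0 <= u)%E ->
  (u `^ rho <= \sum_(0 <= i <oo) (layer u i%:Z + layer u (- i.+1%:Z)%R))%E.
Proof.
case: u => [u| |//] u0.
- rewrite poweR_EFin; move: u0; rewrite lee_fin le_eqVlt => /orP[/eqP <-|u0].
    rewrite powR0 ?gt_eqF//; apply: nneseries_ge0 => i _ _; exact: adde_ge0.
  have [j /andP[ju uj]] := dyadic_bracket u0.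
  apply: (le_trans _ (layer_le _ j)); rewrite /layer lte_fin ju lee_fin.
  by apply: ge0_ler_powR => //; rewrite ?nnegrE ltW// exprz_gt0.
- rewrite /poweR gt_eqF// leye_eq; apply/eqP/eqyP => A A0.
  have [j /andP[_ Aj]] := dyadic_bracket A0.
  have j1 : (2 : R) ^ (j + 1) <= c (`|j|%N).
    have h : (2 : R) ^ (j + 1) <= 2 ^ (`|j|%N%:Z + 1) by rewrite ler_eXz2l ?ltr1n//; lia.
    apply: (le_trans h); apply: le1r_powR; last exact: ltW.
    by rewrite -[leLHS](expr0z (2 : R)) ler_eXz2l ?ltr1n//; lia.
  apply: (le_trans _ (layer_le _ `|j|%N)); rewrite /layer ltry lee_fin.
  exact: le_trans Aj j1.
Qed.

Let C : R := 4 `^ rho * (2 `^ (rho - 1) / (2 `^ (rho - 1) - 1)).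

Let x1 : 1 < (2 : R) `^ (rho - 1).
Proof.
rewrite /powR pnatr_eq0 /= -[ltLHS]expR0 ltr_expR mulr_gt0 ?subr_gt0//.
by rewrite ln_gt0// ltr1n.
Qed.

Let C_ge0 : 0 <= C.
Proof.
rewrite mulr_ge0 ?powR_ge0// divr_ge0 ?powR_ge0//.
by rewrite subr_ge0 (ltW x1).
Qed.

(** The bound on layer j by the weak type inequality at height 2^(j-1), before
    integration. *)
Let piece (v : R) (j : int) : R :=
  if (2 : R) ^ (j - 1) < v then c j / 2 ^ (j - 1) * v else 0.

Let piece_ge0 v j : 0 <= v -> 0 <= piece v j.
Proof.
move=> v0; rewrite /piece; case: ifP => // _.
by rewrite mulr_ge0// divr_ge0// exprz_ge0.
Qed.

Let pieceE j : c j / (2 : R) ^ (j - 1) = 4 `^ rho * (2 `^ (rho - 1)) ^ (j - 1).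
Proof.
have p2 (k : int) (t : R) : ((2 : R) ^ k) `^ t = 2 `^ (k%:~R * t).
  by rewrite -powR_intmul// -powRrM.
rewrite /c p2 -[2 ^ (j - 1)]powR_intmul// -powRN -powRD; last by rewrite pnatr_eq0 implybT.
have -> : (2 : R) `^ (rho - 1) ^ (j - 1) = 2 `^ ((rho - 1) * (j - 1)%:~R).
  by rewrite -powR_intmul ?powR_ge0// -powRrM.
rewrite (_ : 4 = 2 ^ (2 : int) :> R); last by rewrite -exprnP -natrX.
rewrite p2 -powRD; last by rewrite pnatr_eq0 implybT.
by congr (_ `^ _); rewrite !rmorphD /= rmorphN /=; lra.
Qed.

(** The pieces grow like 2^((rho-1) j) until 2^(j-1) reaches v, so that their
    sum is comparable to the last one, of order v^rho. *)
Let sum_piece v m : 0 <= v -> \sum_(i < m) (piece v i%:Z + piece v (- i.+1%:Z)) <= C * v `^ rho.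
Proof.
move=> v0; rewrite sum_int_window.
pose x := (2 : R) `^ (rho - 1); pose s := x ^ (- m%:Z - 1).
have s0 : 0 < s by rewrite exprz_gt0// powR_gt0.
have sx (i : nat) : s * x ^+ i = x ^ (i%:Z - m%:Z - 1).
  rewrite [X in _ * X]exprnP -expfzDr; last by rewrite gt_eqF// powR_gt0.
  by congr (_ ^ _); lia.
apply: (@le_trans _ _ (4 `^ rho * v *
    \sum_(i < m + m) (if s * x ^+ i < v `^ (rho - 1) then s * x ^+ i else 0))).
  rewrite mulr_sumr; apply: ler_sum => i _; rewrite /piece pieceE sx.
  case: (ltP _ v) => [jv|_]; last first.
    rewrite mulr_ge0 ?mulr_ge0 ?powR_ge0//; case: ifP => // _.
    by rewrite exprz_ge0 ?powR_ge0.
  rewrite ifT; first by rewrite mulrAC.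
  rewrite -[X in X < _]powR_intmul ?powR_ge0// -powRrM mulrC powRrM powR_intmul//.
  by apply: gt0_ltr_powR; rewrite ?subr_gt0// ?nnegrE ?exprz_ge0.
apply: (le_trans (ler_wpM2l _ (geometric_below _ x1 s0 (powR_ge0 _ _)))).
  by rewrite mulr_ge0 ?powR_ge0.
rewrite le_eqVlt; apply/orP; left; apply/eqP.
by rewrite /C -(mulr_powRB1 v0 rho0); ring.
Qed.

Section Function.
Variable f : X -> R.
Hypothesis mf : measurable_fun setT f.
Hypothesis f0 : forall x, 0 <= f x.
Local Notation Mf := (maxf mu (EFin \o f)).

Let cut (t : R) : set X := [set x | t < f x].

Let measurable_cut t : measurable (cut t).
Proof.
rewrite -[X in measurable X]setTI; have := mf measurableT (measurable_itv `]t, +oo[).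
by congr measurable; apply/seteqP; split=> x /=; rewrite in_itv/= andbT.
Qed.

(** Only the part of f above t contributes to the averages that exceed 2t. *)
Lemma maxf_cut (t : R) : 0 < t ->
  [set x | (2 * t)%:E < Mf x]%E `<=`
  [set x | (t%:E < maxf mu (fun x => (f x * \1_(cut t) x)%:E) x)%E].
Proof.
move=> t0 x /= /ereal_sup_gt[_ [g _ <-] tg].
apply: lt_le_trans (avg_le_maxf mu _ g x).
have : (avg mu (EFin \o f) g x <=
    avg mu (fun x => (f x * \1_(cut t) x)%:E) g x + t%:E)%E.
  rewrite /avg.
  have -> : t%:E = ((vol g)^-1%:E * \int[mu]_(y in B g x) (cst t%:E y))%E.
    rewrite integral_cst; last exact: measurable_pball.
    have v0 : vol g != 0 by exact: vol_neq0.
    by rewrite volE// -!EFinM mulrCA mulVf// mulr1.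
  rewrite -ge0_muleDr; first last.
  - by apply: integral_ge0 => y _; rewrite lee_fin ltW.
  - by apply: integral_ge0 => y _; rewrite lee_fin mulr_ge0.
  rewrite -ge0_integralD//; first last.
  - by move=> y _; rewrite lee_fin ltW.
  - by apply: measurable_funTS; apply/measurable_EFinP; exact: measurable_funM.
  - by move=> y _; rewrite lee_fin mulr_ge0.
  - exact: measurable_pball.
  apply: lee_wpmul2l; first by rewrite lee_fin invr_ge0 vol_ge0.
  apply: ge0_le_integral.
  - exact: measurable_pball.
  - by move=> y _; rewrite lee_fin.
  - by apply: measurable_funTS; apply/measurable_EFinP.
  - apply: emeasurable_funD => //; apply: measurable_funTS; apply/measurable_EFinP.
    by apply: measurable_funM => //; exact: measurable_indic.
  - move=> y _; rewrite /cst -EFinD lee_fin indicE /cut.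
    have [ty|ty] := ltP t (f y); first by rewrite mem_set// mulr1 lerDl ltW.
    by rewrite memNset /= ?mulr0 ?add0r//; apply/negP; rewrite -leNgt.
move=> /(lt_le_trans tg); rewrite (_ : (2 * t)%:E = (t%:E + t%:E)%E); last first.
  by rewrite -EFinD; congr (_%:E); lra.
by rewrite lteD2rE.
Qed.

Let measurable_Mf : measurable_fun setT Mf.
Proof. exact: measurable_maxf. Qed.

Let measurable_layer j : measurable_fun setT (fun x => layer (Mf x) j).
Proof.
have -> : (fun x => layer (Mf x) j) =
    EFin \o (fun x => c j * \1_[set x | ((2 : R) ^ j)%:E < Mf x]%E x).
  apply/funext => x; rewrite /layer /= indicE; case: ifPn => h.
    by rewrite mem_set ?mulr1.
  by rewrite memNset ?mulr0//=; exact/negP.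
apply/measurable_EFinP; apply: measurable_funM => //; apply: measurable_indic.
by rewrite -[X in measurable X]setTI; exact: emeasurable_fun_o_infty.
Qed.

Let pieceI x j : piece (f x) j = c j / 2 ^ (j - 1) * (f x * \1_(cut (2 ^ (j - 1))) x).
Proof.
rewrite /piece indicE; case: ifPn => h; first by rewrite mem_set ?mulr1.
by rewrite memNset ?mulr0//=; exact/negP.
Qed.

Let measurable_piece j : measurable_fun setT (fun x => (piece (f x) j)%:E).
Proof.
apply/measurable_EFinP; rewrite (eq_fun (pieceI^~ j)).
by apply: measurable_funM => //; apply: measurable_funM => //; exact: measurable_indic.
Qed.

Let layer_le_piece j :
  (\int[mu]_x layer (Mf x) j <= \int[mu]_x (piece (f x) j)%:E)%E.
Proof.
set t := (2 : R) ^ (j - 1); have t0 : 0 < t by rewrite exprz_gt0.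
have tE : (2 : R) ^ j = 2 * t by rewrite /t -{1}(subrK 1 j) expfzDr// expr1z mulrC.
pose A := [set x | ((2 : R) ^ j)%:E < Mf x]%E.
have mA : measurable A.
  by rewrite -[X in measurable X]setTI; exact: emeasurable_fun_o_infty.
pose h x := (f x * \1_(cut t) x)%:E.
have mh : measurable_fun setT h.
  by apply/measurable_EFinP; apply: measurable_funM => //; exact: measurable_indic.
have h0 x : (0 <= h x)%E by rewrite lee_fin mulr_ge0.
have -> : (\int[mu]_x layer (Mf x) j = (c j)%:E * mu A)%E.
  rewrite -[RHS](integral_cst mu mA) integral_mkcond; apply: eq_integral => x _.
  rewrite /layer patchE; case: ifPn => hx; first by rewrite mem_set.
  by rewrite memNset//=; exact/negP.
have -> : (\int[mu]_x (piece (f x) j)%:E = (c j / t)%:E * \int[mu]_x h x)%E.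
  have ct0 : (0 <= (c j / t)%:E)%E by rewrite lee_fin divr_ge0 ?c_ge0// (ltW t0).
  rewrite -(ge0_integralZl mu measurableT mh (fun x _ => h0 x) ct0).
  by apply: eq_integral => x _; rewrite pieceI.
rewrite EFinM -muleA lee_wpmul2l ?lee_fin//.
have := weak_type_maxf mu_haar n_gt0 t0 mh h0.
have mT : measurable [set x | (t%:E < maxf mu h x)%E].
  rewrite -[X in measurable X]setTI; apply: emeasurable_fun_o_infty => //.
  exact: measurable_maxf.
move=> W; rewrite -[leLHS]mul1e -(@mulVf _ t) ?gt_eqF// EFinM -muleA.
apply: lee_wpmul2l; first by rewrite lee_fin invr_ge0 (ltW t0).
apply: le_trans W; apply: lee_wpmul2l; first by rewrite lee_fin (ltW t0).
apply: le_measure; rewrite ?inE//.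
by rewrite /A tE; exact: maxf_cut.
Qed.

(** The maximal theorem. The layer cake turns the weak type bound for the parts
    of f above each dyadic level into a geometric sum. *)
Lemma strong_type_maxf :
  (\int[mu]_x (Mf x `^ rho) <= C%:E * \int[mu]_x (f x `^ rho)%:E)%E.
Proof.
have Mf0 x : (0 <= Mf x)%E by apply: maxf_ge0 => // y; rewrite lee_fin.
have mfr : measurable_fun setT (fun x => (f x `^ rho)%:E).
  by apply/measurable_EFinP; exact: (measurableT_comp (measurable_powR rho)).
apply: (@le_trans _ _ (\int[mu]_x \sum_(0 <= i <oo)
    (layer (Mf x) i%:Z + layer (Mf x) (- i.+1%:Z)%R))%E).
  apply: ge0_le_integral => //.
  - by move=> x _; exact: poweR_ge0.
  - exact: (measurableT_comp (measurable_poweR rho)).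
  - apply: ge0_emeasurable_sum => [i x _ _|i _]; first exact: adde_ge0.
    exact: emeasurable_funD.
  - by move=> x _; exact: poweR_le_layers.
rewrite integral_nneseries//; first last.
- by move=> i x _; exact: adde_ge0.
- by move=> i; exact: emeasurable_funD.
apply: (@le_trans _ _ (\sum_(0 <= i <oo) \int[mu]_x
    ((piece (f x) i%:Z)%:E + (piece (f x) (- i.+1%:Z)%R)%:E))%E).
  apply: lee_nneseries => [i _ _|i _].
    by apply: integral_ge0 => x _; exact: adde_ge0.
  rewrite !ge0_integralD//; first exact: leeD;
    by move=> x _; rewrite lee_fin piece_ge0.
rewrite -integral_nneseries//; first last.
- by move=> i x _; rewrite adde_ge0// lee_fin piece_ge0.
- by move=> i; exact: emeasurable_funD.
rewrite -ge0_integralZl//; [|by move=> x _; rewrite lee_fin powR_ge0].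
apply: ge0_le_integral => //.
- by move=> x _; apply: nneseries_ge0 => i _ _; rewrite adde_ge0// lee_fin piece_ge0.
- apply: ge0_emeasurable_sum => [i x _ _|i _].
    by rewrite adde_ge0// lee_fin piece_ge0.
  exact: emeasurable_funD.
- exact: measurable_funeM.
- move=> x _; apply: lime_le.
    by apply: is_cvg_nneseries => i _ _; rewrite adde_ge0// lee_fin piece_ge0.
  apply: nearW => m; rewrite big_mkord -EFinM.
  under eq_bigr do rewrite -EFinD.
  by rewrite sumEFin lee_fin sum_piece.
Qed.

End Function.

Lemma maxf_bounded : exists2 C : R, 0 <= C &
  forall f : X -> R, measurable_fun setT f -> (forall x, 0 <= f x) ->
    (\int[mu]_x (maxf mu (EFin \o f) x `^ rho) <=
      C%:E * \int[mu]_x (f x `^ rho)%:E)%E.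
Proof. by exists C => // f mf f0; exact: strong_type_maxf. Qed.

End Exponent.
End StrongType.

(** * Variable exponents *)

(** A family whose members i and j differ by at most e i + e j has a limit
    within e i of each member i: the supremum of the lower bounds u i - e i. *)
Lemma common_limit (R : realType) (I : Type) (i0 : I) (u e : I -> R) :
  (forall i j, `|u i - u j| <= e i + e j) ->
  exists l : R, forall i, `|u i - l| <= e i.
Proof.
move=> ue; pose S := range (fun i => u i - e i).
have ubS i : ubound S (u i + e i).
  move=> _ [j _ <-]; have := ue i j; rewrite ler_norml => /andP[h _].
  by lra.
have S0 : S !=set0 by exists (u i0 - e i0), i0.
have hS : has_sup S by split=> //; exists (u i0 + e i0).
exists (sup S) => i; have s1 : u i - e i <= sup S.
  by apply: ub_le_sup; [case: hS|exists i].
have s2 : sup S <= u i + e i by apply: ge_sup => //; exact: ubS.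
by rewrite ler_norml; apply/andP; split; lra.
Qed.

Section Exponents.
Variables (R : realType) (p : nat) (p_pr : prime p) (n : nat).
Local Notation V := 'rV[Qp p_pr]_n.
Local Notation X := (padic_space R p_pr n).
Local Notation norm := (@pnorm R p p_pr n).
Local Notation B := (@pball R p p_pr n).
Variable mu : {measure set X -> \bar R}.
Hypothesis mu_haar : is_haar_measure mu.
Hypothesis n_gt0 : (0 < n)%N.
Implicit Types (q r : X -> R) (x y a : X) (D : set X).

Lemma ess_sup_on_ge D q :
  {ae mu, forall x, D x -> ((q x)%:E <= ess_sup_on mu D q)%E}.
Proof.
(* The value -oo outside D imposes no condition there. *)
pose h x := if x \in D then (q x)%:E else -oo%E.
have -> : ess_sup_on mu D q = ess_sup_inf.ess_sup mu h.
  rewrite ess_sup_inf.ess_supEae; congr ereal_inf; apply/seteqP; split=> y /=;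
    apply: filterS => x; rewrite /h; first by case: ifPn => [/set_mem Dx|]; [apply|rewrite leNye].
  by move=> + Dx; rewrite mem_set.
apply: filterS (ess_sup_inf.ess_sup_ge mu h) => x + Dx.
by rewrite {1}/h mem_set.
Qed.

Lemma ess_inf_on_le D q :
  {ae mu, forall x, D x -> (ess_inf_on mu D q <= (q x)%:E)%E}.
Proof.
pose h x := if x \in D then (q x)%:E else +oo%E.
have -> : ess_inf_on mu D q = ess_sup_inf.ess_inf mu h.
  rewrite ess_sup_inf.ess_infEae; congr ereal_sup; apply/seteqP; split=> y /=;
    apply: filterS => x; rewrite /h; first by case: ifPn => [/set_mem Dx|]; [apply|rewrite leey].
  by move=> + Dx; rewrite mem_set.
apply: filterS (ess_sup_inf.ess_inf_le mu h) => x + Dx.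
by rewrite {2}/h mem_set.
Qed.

(** Balls have positive measure. *)
Lemma ball_ae_nonempty g a (P : X -> Prop) :
  {ae mu, forall x, B g a x -> P x} -> exists2 x, B g a x & P x.
Proof.
move=> [N [mN N0 PN]]; apply: contrapT => /forall2NP h.
have BN : B g a `<=` N by move=> x Bx; apply: PN => /= /(_ Bx); case: (h x).
have : (mu (B g a) <= mu N)%E.
  by apply: le_measure => //; rewrite inE//; exact: measurable_pball.
by rewrite N0 volE// lee_fin leNgt vol_gt0.
Qed.

Lemma ess_on_ball g a q (m M : R) : (forall x, m <= q x <= M) ->
  exists i s : R, [/\ ess_inf_on mu (B g a) q = i%:E,
    ess_sup_on mu (B g a) q = s%:E, m <= i <= M &
    {ae mu, forall x, B g a x -> i <= q x <= s}].
Proof.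
move=> qmM; have [x Bx ix] := ball_ae_nonempty (ess_inf_on_le (B g a) q).
have [y By sy] := ball_ae_nonempty (ess_sup_on_ge (B g a) q).
have mi : (m%:E <= ess_inf_on mu (B g a) q)%E.
  apply: ereal_sup_ubound => /=; apply: aeW => z _.
  by rewrite lee_fin; have /andP[] := qmM z.
have sM : (ess_sup_on mu (B g a) q <= M%:E)%E.
  apply: ereal_inf_lbound => /=; apply: aeW => z _.
  by rewrite lee_fin; have /andP[] := qmM z.
have := ess_inf_on_le (B g a) q; have := ess_sup_on_ge (B g a) q.
case: (ess_inf_on mu _ q) ix mi => [i| |]; rewrite ?leNgt ?ltNye ?ltry//.
case: (ess_sup_on mu _ q) sy sM => [s| |]; rewrite ?leNgt ?ltNye ?ltry//.
move=> _ _; rewrite -!leNgt !lee_fin => ix mi aes aei.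
exists i, s; split=> //.
  by rewrite mi (le_trans ix)//; have /andP[] := qmM x.
apply: filterS2 aes aei => z sz iz Bz.
by move: (sz Bz) (iz Bz); rewrite !lee_fin => -> ->.
Qed.

Lemma exponent_class_bounds q : exponent_class mu q ->
  exists m M : R, [/\ 1 < m, ess_sup_on mu setT q = M%:E &
    forall x, m <= q x <= M].
Proof.
move=> [mq q1 i1 qis sy].
case: (ess_inf_on mu setT q) i1 qis => [i| |]; rewrite ?ltNge ?leNye ?leey//; last first.
  by move=> _ /(_ (0%R : V)); rewrite leye_eq.
case: (ess_sup_on mu setT q) sy => [s| |]; rewrite ?ltNge ?leNye ?leey//; last first.
  by move=> _ _ /(_ (0%R : V)); rewrite leeNy_eq andbF.
by rewrite -!ltNge lte_fin => _ i1 h; exists i, s; split=> // x.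
Qed.

(** ** Exponents frozen on balls *)

(** The two log-Hoelder conditions in the form used below: on a ball of radius
    p^(-k) the exponent stays within K / k of its essential infimum rho, and
    at distance p^k from the origin within K / k of a value at infinity. *)
Record log_hoelder_data q (m M K : R) (rho : nat -> X -> R) (qoo : R) : Prop := {
  lhd_gt1 : 1 < m ;
  lhd_bounds : forall x, m <= q x <= M ;
  lhd_frozen_bounds : forall k x, m <= rho k x <= M ;
  lhd_infty_bounds : m <= qoo <= M ;
  lhd_ge0 : 0 <= K ;
  lhd_frozen_ball : forall (k : nat) a x, B (- k%:Z) a x -> rho k x = rho k a ;
  lhd_small : {ae mu, forall x (k : nat),
    rho k x <= q x /\ k%:R * (q x - rho k x) <= K} ;
  lhd_large : forall x (k : nat), p%:R ^ k%:Z <= norm x ->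
    k%:R * `|q x - qoo| <= K }.

(** The oscillation of q between x and y is at most d(x) + d(y) with
    d(x) = C / log_p(p + |x|), so a common limit exists; clipping it to the
    range of q keeps the bounds. *)
Lemma log_hoelder_infty q (m M C : R) : 0 < C -> (forall x, m <= q x <= M) ->
  (forall x y, `|q x - q y| <=
     C / (ln (p%:R + Num.min (norm x) (norm y)) / ln p%:R)) ->
  exists2 qoo : R, m <= qoo <= M &
    forall x (k : nat), p%:R ^ k%:Z <= norm x -> k%:R * `|q x - qoo| <= C.
Proof.
move=> C0 qmM qC.
have p1 := prime_gt1R R p_pr; have p0 := prime_gt0R R p_pr.
have lnp : 0 < ln p%:R :> R by rewrite ln_gt0.
pose d x := C / (ln (p%:R + norm x) / ln p%:R).
have lg0 (t : R) : 0 <= t -> 0 < ln (p%:R + t) / ln p%:R.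
  by move=> t0; rewrite divr_gt0// ln_gt0// (lt_le_trans p1)// lerDl.
have d0 x : 0 <= d x by rewrite divr_ge0 ?ltW// lg0// pnorm_ge0.
have qd x y : `|q x - q y| <= d x + d y.
  apply: (le_trans (qC x y)); rewrite -/(d _).
  have [xy|/ltW yx] := leP (norm x) (norm y).
    by rewrite -/(d x) lerDl.
  by rewrite -/(d y) lerDr.
have [s sd] := common_limit (0%R : V) qd.
exists (Num.max m (Num.min s M)).
  rewrite le_max lexx /= ge_max ge_min lexx orbT andbT.
  by have /andP[] := qmM (0%R : V); exact: le_trans.
move=> x k kx.
have qdx : `|q x - Num.max m (Num.min s M)| <= d x.
  have := sd x; rewrite ler_norml => /andP[s1 s2].
  have /andP[mq qM] := qmM x; have := d0 x.
  case: (leP s M) => h1; case: (leP m _) => h2;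
    rewrite ler_norml => *; apply/andP; split; lra.
have kd : k%:R <= ln (p%:R + norm x) / ln p%:R.
  rewrite ler_pdivlMr// -ln_powR powR_mulrn ?(ltW p0)// ler_ln ?posrE.
  - by apply: (le_trans kx); rewrite lerDr ltW.
  - by rewrite exprn_gt0.
  - by rewrite ltr_pwDl// pnorm_ge0.
apply: (le_trans (ler_wpM2l _ qdx)) => //.
apply: (le_trans (ler_wpM2r (d0 x) kd)); rewrite /d mulrCA divff ?mulr1//.
by rewrite gt_eqF// lg0// pnorm_ge0.
Qed.

(** The frozen exponent of a small ball is its essential infimum. As the balls
    of a given radius are countably many, the exceptional sets of all of them
    form a null set. *)
Lemma log_hoelder_dataP q : log_exponent_class mu q ->
  exists m M K rho qoo, log_hoelder_data q m M K rho qoo /\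
    ess_sup_on mu setT q = M%:E.
Proof.
move=> [qc [C [C0 Csmall Clarge]]].
have [m [M [m1 sM qmM]]] := exponent_class_bounds qc.
have Clarge' x y : `|q x - q y| <= C / (ln (p%:R + Num.min (norm x) (norm y)) / ln p%:R).
  by rewrite -!pnormE; exact: Clarge.
have [qoo qoomM qooC] := log_hoelder_infty C0 qmM Clarge'.
pose rho (k : nat) x := fine (ess_inf_on mu (B (- k%:Z) x) q).
exists m, M, C, rho, qoo; split=> //; split=> //.
- by move=> k x; rewrite /rho; have [i [s [-> _ ->]]] := ess_on_ball (- k%:Z) x qmM.
- exact: ltW.
- by move=> k a x ax; rewrite /rho (pball_eq ax).
apply/ae_foralln => k; have : {ae mu, forall x (i : nat),
    B (- k%:Z) (rat_center p_pr n i) x -> rho k x <= q x /\ k%:R * (q x - rho k x) <= C}.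
  apply/ae_foralln => i.
  have [l [u [il su lmM lu]]] := ess_on_ball (- k%:Z) (rat_center p_pr n i : X) qmM.
  apply: filterS lu => x lu ix; have /andP[lx xu] := lu ix.
  have -> : rho k x = l by rewrite /rho (pball_eq ix) il.
  split=> //; have := Csmall (- k%:Z) (rat_center p_pr n i); rewrite pballE il su.
  rewrite -EFinB -EFinM lee_fin; apply: le_trans.
  by rewrite rmorphN /= mulNr -mulrN opprB ler_wpM2l// lerB.
apply: filterS => x h; have [i ix] := rat_center_dense (- k%:Z) x.
exact: h ix.
Qed.

(** ** Sobolev conjugate exponents *)

(** The relation 1 / q = 1 / r - t between exponents. *)
Definition conj_exp (t u : R) : R := (u^-1 - t)^-1.

Section Conjugate.
Variables (t m M : R).
Hypotheses (t_ge0 : 0 <= t) (m_gt1 : 1 < m) (mM : m <= M) (Mt : M * t < 1).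

Let pos (u : R) : m <= u -> 0 < u.
Proof. by move=> mu'; rewrite (lt_le_trans _ mu')// (lt_trans ltr01). Qed.

Lemma conj_exp_den (u : R) : m <= u <= M -> 0 < u^-1 - t.
Proof.
move=> /andP[/pos u0 uM]; rewrite subr_gt0 -div1r ltr_pdivlMr//.
by apply: le_lt_trans Mt; rewrite mulrC ler_wpM2r.
Qed.

Lemma conj_exp_le (u v : R) : m <= u <= M -> m <= v <= M -> u <= v ->
  conj_exp t u <= conj_exp t v.
Proof.
move=> hu hv uv; rewrite /conj_exp lef_pV2 ?posrE ?conj_exp_den//.
have /andP[/pos u0 _] := hu; have /andP[/pos v0 _] := hv.
by rewrite lerB// lef_pV2.
Qed.

Lemma le_conj_exp (u : R) : m <= u <= M -> u <= conj_exp t u.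
Proof.
move=> hu; have /andP[/pos u0 _] := hu; rewrite /conj_exp -[leLHS]invrK.
by rewrite lef_pV2 ?posrE ?invr_gt0 ?conj_exp_den// gerBl.
Qed.

(** On [m, M] the derivative (conj_exp t u / u)^2 is at most (conj_exp t M)^2,
    because u > 1. *)
Lemma conj_expB (u v : R) : m <= u <= M -> m <= v <= M -> u <= v ->
  conj_exp t v - conj_exp t u <= conj_exp t M ^+ 2 * (v - u).
Proof.
move=> hu hv uv; have /andP[/pos u0 uM] := hu; have /andP[/pos v0 vM] := hv.
have du := conj_exp_den hu; have dv := conj_exp_den hv.
have hM : m <= M <= M by rewrite mM lexx.
have E : conj_exp t v - conj_exp t u =
    conj_exp t v * conj_exp t u * (u^-1 - v^-1).
  rewrite /conj_exp; set a := u^-1 in du *; set b := v^-1 in dv *.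
  by field; rewrite !gt_eqF.
have uv1 : u^-1 - v^-1 <= v - u.
  have -> : u^-1 - v^-1 = (v - u) / (u * v) by field; rewrite !gt_eqF.
  rewrite ler_pdivrMr ?mulr_gt0// ler_peMr ?subr_ge0//.
  have u1 : 1 <= u by have /andP[/(lt_le_trans m_gt1)/ltW] := hu.
  have v1 : 1 <= v by have /andP[/(lt_le_trans m_gt1)/ltW] := hv.
  by rewrite -[leLHS]mulr1 ler_pM.
have c0 w : m <= w <= M -> 0 <= conj_exp t w.
  by move=> hw; rewrite invr_ge0 ltW// conj_exp_den.
rewrite E expr2 ler_pM ?mulr_ge0 ?c0//.
  by rewrite subr_ge0 lef_pV2.
by rewrite ler_pM ?c0 ?conj_exp_le.
Qed.

End Conjugate.

(** Conjugation is increasing and Lipschitz on [m, M], so both conditions carry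
    over from r to q, with conjugate frozen exponents. *)
Lemma log_hoelder_data_conj r q t m M K rho roo :
  log_hoelder_data r m M K rho roo -> 0 <= t -> M * t < 1 ->
  (forall x, q x = conj_exp t (r x)) ->
  log_hoelder_data q (conj_exp t m) (conj_exp t M) (conj_exp t M ^+ 2 * K)
    (fun k x => conj_exp t (rho k x)) (conj_exp t roo).
Proof.
move=> [m1 rb fb ib K0 fball small large] t0 Mt qE.
have mM : m <= M by have /andP[] := ib; exact: le_trans.
have hm : m <= m <= M by rewrite lexx.
have hM : m <= M <= M by rewrite mM lexx.
have mono := conj_exp_le t0 m1 Mt.
have cb u : m <= u <= M -> conj_exp t m <= conj_exp t u <= conj_exp t M.
  by move=> hu; have /andP[mu' uM] := hu; rewrite !mono.
have Q0 : 0 <= conj_exp t M ^+ 2 := sqr_ge0 _.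
split.
- by apply: (lt_le_trans m1); apply: le_conj_exp hm.
- by move=> x; rewrite qE cb.
- by move=> k x; rewrite cb.
- exact: cb.
- exact: mulr_ge0.
- by move=> k a x /fball ->.
- apply: filterS small => x h k; have [rx kx] := h k.
  rewrite qE; split; first exact: mono.
  apply: (@le_trans _ _ (conj_exp t M ^+ 2 * (k%:R * (r x - rho k x)))).
    by rewrite mulrCA ler_wpM2l// (conj_expB t0 m1 mM Mt).
  exact: ler_wpM2l.
- move=> x k /large kx; rewrite qE.
  apply: (@le_trans _ _ (conj_exp t M ^+ 2 * (k%:R * `|r x - roo|))); last exact: ler_wpM2l.
  rewrite mulrCA ler_wpM2l//.
  have [xo|/ltW xo] := leP (r x) roo.
    rewrite distrC [in leRHS]distrC !ger0_norm ?subr_ge0 ?mono//.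
    exact: (conj_expB t0 m1 mM Mt).
  by rewrite !ger0_norm ?subr_ge0 ?mono//; exact: (conj_expB t0 m1 mM Mt).
Qed.

End Exponents.

(** * Modulars *)

Lemma measurable_powR_var d (T : measurableType d) (R : realType) (f q : T -> R) :
  measurable_fun setT f -> measurable_fun setT q -> (forall x, 0 <= f x) ->
  (forall x, 0 < q x) -> measurable_fun setT (fun x => f x `^ q x).
Proof.
move=> mf mq f0 q0.
have -> : (fun x => f x `^ q x) =
    (fun x => if 0 < f x then expR (q x * ln (f x)) else 0).
  apply/funext => x; rewrite /powR; have [->|fx] := eqVneq (f x) 0.
    by rewrite ltxx gt_eqF.
  by rewrite lt_def fx f0.
apply: measurable_fun_ifT => //; first exact: measurable_fun_ltr.
apply: (measurableT_comp (@measurable_expR R)); apply: measurable_funM => //.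
exact: (measurableT_comp (@measurable_ln R)).
Qed.

Lemma measurable_poweR_var d (T : measurableType d) (R : realType)
    (f : T -> \bar R) (q : T -> R) :
  measurable_fun setT f -> measurable_fun setT q -> (forall x, 0 <= f x)%E ->
  (forall x, 0 < q x) -> measurable_fun setT (fun x => f x `^ q x)%E.
Proof.
move=> mf mq f0 q0.
have -> : (fun x => f x `^ q x)%E =
    (fun x => if (f x < +oo)%E then (fine (f x) `^ q x)%:E else +oo%E).
  apply/funext => x; have := f0 x; case: (f x) => [t t0|_|//].
    by rewrite ltry poweR_EFin.
  by rewrite ltxx poweRyr// gt_eqF.
apply: measurable_fun_ifT => //; first exact: measurable_fun_lte.
apply/measurable_EFinP; apply: measurable_powR_var => //.
  by apply: measurableT_comp => //; exact: fine_measurable.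
by move=> x; exact: fine_ge0.
Qed.

Section Modular.
Variables (R : realType) (p : nat) (p_pr : prime p) (n : nat).
Local Notation X := (padic_space R p_pr n).
Variable mu : {measure set X -> \bar R}.
Implicit Types (q r : X -> R) (x y a : X) (F G : X -> \bar R).

Lemma measurable_modular q F (eta : R) : 0 < eta -> measurable_fun setT F ->
  measurable_fun setT q -> (forall x, 0 < q x) ->
  measurable_fun setT (fun x => (`|F x| * (eta^-1)%:E) `^ q x)%E.
Proof.
move=> eta0 mF mq q0; apply: measurable_poweR_var => //.
  by apply: emeasurable_funM => //; exact: measurableT_comp.
by move=> x; rewrite mule_ge0// lee_fin invr_ge0 ltW.
Qed.

Section OneExponent.
Variable q : X -> R.
Hypotheses (mq : measurable_fun setT q) (q1 : forall x, 1 <= q x).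

Let q0 x : 0 < q x. Proof. exact: lt_le_trans (q1 x). Qed.

Lemma modular_dom F G (c eta : R) : 0 < c -> 0 < eta ->
  measurable_fun setT F -> measurable_fun setT G ->
  {ae mu, forall x, (`|F x| <= c%:E * `|G x|)%E} ->
  (modular mu q F (c * eta) <= modular mu q G eta)%E.
Proof.
move=> c0 eta0 mF mG FG; apply: ae_ge0_le_integral => //.
- by move=> x _; exact: poweR_ge0.
- by apply: measurable_modular; rewrite ?mulr_gt0.
- by move=> x _; exact: poweR_ge0.
- exact: measurable_modular.
apply: filterS FG => x FGx _; apply: gt0_ler_poweR; first exact/ltW.
- by rewrite in_itv/= leey andbT mule_ge0// lee_fin invr_ge0 mulr_ge0// ltW.
- by rewrite in_itv/= leey andbT mule_ge0// lee_fin invr_ge0 ltW.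
rewrite (le_trans (lee_wpmul2r _ FGx))//.
  by rewrite lee_fin invr_ge0 mulr_ge0// ltW.
rewrite muleAC -EFinM invfM mulrA divff ?gt_eqF// mul1r muleC//.
Qed.

(** As q >= 1, dilation by k decreases the integrand at least by the factor k.
    This turns any finite bound on a modular into a bound by 1. *)
Lemma modular_scale F (k eta : R) : 1 <= k -> 0 < eta -> measurable_fun setT F ->
  (modular mu q F (k * eta) <= (k^-1)%:E * modular mu q F eta)%E.
Proof.
move=> k1 eta0 mF; have k0 : 0 < k by exact: lt_le_trans k1.
rewrite /modular -ge0_integralZl//; first last.
- by rewrite lee_fin invr_ge0 ltW.
- by move=> x _; exact: poweR_ge0.
- exact: measurable_modular.
apply: ge0_le_integral => //.
- by move=> x _; exact: poweR_ge0.
- by apply: measurable_modular => //; exact: mulr_gt0.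
- by apply: measurable_funeM; exact: measurable_modular.
move=> x _.
have -> : (`|F x| * ((k * eta)^-1)%:E = k^-1%:E * (`|F x| * eta^-1%:E))%E.
  by rewrite invfM EFinM muleCA.
rewrite [leLHS]poweRM; first last.
- by rewrite mule_ge0// lee_fin invr_ge0 ltW.
- by rewrite lee_fin invr_ge0 ltW.
rewrite lee_wpmul2r ?poweR_ge0// poweR_EFin lee_fin.
by apply: ge1r_powR => //; rewrite invr_gt0 k0 invf_le1.
Qed.

Lemma modular_le F (eta eta' : R) : 0 < eta -> eta <= eta' ->
  measurable_fun setT F -> (modular mu q F eta' <= modular mu q F eta)%E.
Proof.
move=> eta0 ee mF; have e0 : 0 < eta' by exact: lt_le_trans ee.
have -> : eta' = eta' / eta * eta by rewrite divfK// gt_eqF.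
apply: modular_dom => //; first exact: divr_gt0.
apply: aeW => x; rewrite -[leLHS]mul1e lee_wpmul2r// lee_fin.
by rewrite ler_pdivlMr// mul1r.
Qed.

Lemma Lvar_norm_ge0 F : (0 <= Lvar_norm mu q F)%E.
Proof. by apply: le_ereal_inf_tmp => _ [eta [/ltW eta0 _] <-]; rewrite lee_fin. Qed.

Lemma Lvar_norm_le F (eta : R) : 0 < eta -> (modular mu q F eta <= 1)%E ->
  (Lvar_norm mu q F <= eta%:E)%E.
Proof. by move=> eta0 h; apply: ereal_inf_lbound; exists eta. Qed.

Lemma Lvar_norm_lt_modular F (eta : R) : measurable_fun setT F ->
  (Lvar_norm mu q F < eta%:E)%E -> (modular mu q F eta <= 1)%E.
Proof.
move=> mF /ereal_inf_lt[_ [eta' [eta'0 h] <-]]; rewrite lte_fin => /ltW ee.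
exact: le_trans (modular_le _ _ _) h.
Qed.

Lemma modular_fin_le1 F (eta : R) : 0 < eta ->
  measurable_fun setT F -> (modular mu q F eta < +oo)%E ->
  exists2 eta' : R, 0 < eta' & (modular mu q F eta' <= 1)%E.
Proof.
move=> eta0 mF; have : (0 <= modular mu q F eta)%E.
  by apply: integral_ge0 => x _; exact: poweR_ge0.
case E : (modular mu q F eta) => [t| |//]; rewrite ?ltxx// lee_fin => t0 _.
exists ((1 + t) * eta); first by rewrite mulr_gt0// ltr_pwDl.
apply: (le_trans (modular_scale _ _ _)) => //; first by rewrite lerDl.
rewrite E -EFinM lee_fin mulrC ler_pdivrMr ?mul1r ?lerDr//.
by rewrite ltr_pwDl.
Qed.

End OneExponent.

Lemma Lvar_norm_bound q r F G (c : R) : 0 < c ->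
  (forall eta : R, 0 < eta -> (modular mu r G eta <= 1)%E ->
     (Lvar_norm mu q F <= (c * eta)%:E)%E) ->
  (Lvar_norm mu q F <= c%:E * Lvar_norm mu r G)%E.
Proof.
move=> c0 h; rewrite -lee_pdivrMl//; apply: le_ereal_inf_tmp => _ [eta [eta0 G1] <-].
by rewrite lee_pdivrMl// -EFinM h.
Qed.

Lemma modular_indic q (E : set X) (eta : R) : (forall x, 0 < q x) ->
  modular mu q (fun y => (\1_E y)%:E) eta =
  (\int[mu]_(x in E) (eta^-1 `^ q x)%:E)%E.
Proof.
move=> q0; rewrite /modular [RHS]integral_mkcond; apply: eq_integral => x _.
rewrite patchE indicE; case: ifPn => _; last by rewrite abse0 mul0e poweR0r// gt_eqF.
by rewrite gee0_abs// mul1e poweR_EFin.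
Qed.

End Modular.

(** * Characteristic functions of balls *)

Lemma ler_dist_itv (R : realDomainType) (m M u v : R) : 0 <= m ->
  m <= u <= M -> m <= v <= M -> `|u - v| <= M.
Proof.
move=> m0 /andP[mu' uM] /andP[mv vM].
by rewrite ler_norml; apply/andP; split; lra.
Qed.

Section CharacteristicFunctions.
Variables (R : realType) (p : nat) (p_pr : prime p) (n : nat).
Local Notation V := 'rV[Qp p_pr]_n.
Local Notation X := (padic_space R p_pr n).
Local Notation norm := (@pnorm R p p_pr n).
Local Notation B := (@pball R p p_pr n).
Local Notation vol := (@vol R p n).
Variable mu : {measure set X -> \bar R}.
Hypothesis mu_haar : is_haar_measure mu.
Hypothesis n_gt0 : (0 < n)%N.
Implicit Types (q r : X -> R) (x y a : X) (F G : X -> \bar R) (g : int).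

Let p0 : 0 < p%:R :> R. Proof. exact: prime_gt0R. Qed.
Let p1 : 1 < p%:R :> R. Proof. exact: prime_gt1R. Qed.

Lemma vol_powR g (t : R) : vol g `^ t = p%:R `^ (n%:R * g%:~R * t).
Proof. by rewrite -powRrM. Qed.

Lemma prime_powRD (s t : R) : p%:R `^ (s + t) = p%:R `^ s * p%:R `^ t.
Proof. by rewrite powRD// pnatr_eq0 -lt0n prime_gt0// implybT. Qed.

Lemma ler_prime_powR (s t : R) : s <= t -> p%:R `^ s <= p%:R `^ t.
Proof. exact: ler_powR (ltW p1) _ _. Qed.

Lemma prime_powR_gt0 (t : R) : 0 < p%:R `^ t :> R.
Proof. exact: powR_gt0. Qed.

Lemma vol_powR_le g (t K : R) : `|g%:~R * t| <= K ->
  p%:R `^ (- (n%:R * K)) <= vol g `^ t <= p%:R `^ (n%:R * K).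
Proof.
rewrite vol_powR -mulrA ler_norml => /andP[h1 h2].
by rewrite !ler_prime_powR// -?mulrN ler_wpM2l.
Qed.

Section Frozen.
Variables (q : X -> R) (m M K : R) (rho : nat -> X -> R) (qoo : R).
Hypothesis mq : measurable_fun setT q.
Hypothesis lq : log_hoelder_data mu q m M K rho qoo.

Let m1 : 1 < m. Proof. exact: lhd_gt1 lq. Qed.
Let qmM x : m <= q x <= M. Proof. exact: lhd_bounds lq x. Qed.
Let K0 : 0 <= K. Proof. exact: lhd_ge0 lq. Qed.

Let q1 x : 1 < q x.
Proof. by have /andP[+ _] := qmM x; exact: lt_le_trans. Qed.
Let q0 x : 0 < q x. Proof. exact: lt_trans (q1 x). Qed.

Definition frozen g a : R := if (g <= 0)%R then rho `|g|%N a else qoo.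

Lemma frozen_bounds g a : m <= frozen g a <= M.
Proof.
by rewrite /frozen; case: ifP => _; [exact: lhd_frozen_bounds lq _ _|exact: lhd_infty_bounds lq].
Qed.

Lemma frozen_gt1 g a : 1 < frozen g a.
Proof. by have /andP[+ _] := frozen_bounds g a; exact: lt_le_trans. Qed.

Lemma frozen_ball g a x : B g a x -> frozen g x = frozen g a.
Proof.
rewrite /frozen; case: ifPn => // g0 ax; apply: (lhd_frozen_ball lq).
by rewrite -[X in B X](_ : g = _)//; lia.
Qed.

(** On large balls the exponent is close to the frozen one only away from the
    origin. The excluded ball has radius p^(g-2), so that half of every ball of
    radius p^(g-1) remains. *)
Definition off_origin g x : Prop := (0 < g)%R -> ~ B (g - 2) (0 : V) x.

Lemma frozen_close : {ae mu, forall x g, off_origin g x ->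
  `|g%:~R * (q x - frozen g x)| <= K + 2 * M}.
Proof.
have M0 : 0 <= M.
  have /andP[h1 h2] := lhd_infty_bounds lq; apply: (le_trans _ h2).
  by apply: (le_trans _ h1); rewrite ltW// (lt_trans ltr01).
apply: filterS (lhd_small lq) => x small g offx; rewrite /frozen.
case: ifPn => g0.
  have [rq kq] := small `|g|%N.
  have -> : g%:~R = - (`|g|%N%:R) :> R by rewrite -[in LHS](opprK g) -(lez0_abs g0) rmorphN.
  rewrite mulNr normrN ger0_norm ?mulr_ge0 ?subr_ge0//.
  by rewrite (le_trans kq)// lerDl mulr_ge0.
rewrite -ltNge in g0; have qM : `|q x - qoo| <= M.
  by apply: ler_dist_itv (qmM x) (lhd_infty_bounds lq); rewrite ltW// (lt_trans ltr01).
have gE : g%:~R = `|g|%N%:R :> R by rewrite -{1}(gtz0_abs g0).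
rewrite gE normrM normr_nat; set k := `|g|%N.
have [k2|k2] := leqP k 2.
  apply: (@le_trans _ _ (2 * M)); last by rewrite lerDr.
  by rewrite ler_pM// ler_nat.
have kx : p%:R ^ (k - 2)%N%:Z <= norm x.
  rewrite leNgt; apply/negP => /ltW nx; apply: (offx g0); apply/pball0P.
  by rewrite (le_trans nx)// ler_exprz_prime//; lia.
have := lhd_large lq kx; rewrite natrB; last exact: ltnW.
by rewrite mulrBl lerBlDr => /le_trans; apply; rewrite lerD2l ler_wpM2l.
Qed.

(** An error of order 1/g in the exponent changes powers of the volume p^(n g)
    by bounded factors. *)
Lemma frozen_close_vol : exists2 L : R, 1 <= L &
  {ae mu, forall x g, off_origin g x ->
    L^-1 * (vol g)^-1 <= vol g `^ (- q x / frozen g x) <= L * (vol g)^-1}.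
Proof.
exists (p%:R `^ (n%:R * (K + 2 * M))).
  rewrite -[leLHS](powRr0 p%:R) ler_prime_powR// mulr_ge0//.
  have /andP[h1 h2] := lhd_infty_bounds lq.
  by rewrite addr_ge0// mulr_ge0// (le_trans _ h2)// (le_trans _ h1)// ltW// (lt_trans ltr01).
apply: filterS frozen_close => x close g /close {}close.
have f1 := frozen_gt1 g x.
have f0 : frozen g x != 0 by rewrite gt_eqF// (lt_trans ltr01).
have -> : - q x / frozen g x = - (q x - frozen g x) / frozen g x - 1.
  by field.
have -> : vol g `^ (- (q x - frozen g x) / frozen g x - 1) =
    vol g `^ (- (q x - frozen g x) / frozen g x) * (vol g)^-1.
  rewrite powRD; last by rewrite (vol_neq0 R p_pr n) implybT.
  by rewrite powR_inv1// vol_ge0.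
have vV : 0 < (vol g)^-1 by rewrite invr_gt0 vol_gt0.
rewrite -powRN !ler_pM2r// vol_powR_le//.
rewrite mulrA normrM normfV mulrN normrN; apply: le_trans close.
by rewrite ler_piMr// invf_le1 ger0_norm ?(ltW f1)// ?(lt_trans ltr01 f1)// ltW// (lt_trans ltr01).
Qed.

Lemma measurable_off_origin g : measurable [set x | off_origin g x].
Proof.
have [g0|g0] := boolP (0 < g)%R.
  have -> : [set x | off_origin g x] = ~` B (g - 2) (0 : V).
    by apply/seteqP; split=> x; [apply|move=> ? ?].
  by apply: measurableC; exact: measurable_pball.
have -> : [set x | off_origin g x] = setT by apply/seteqP; split=> // x _ g1; rewrite g1 in g0.
exact: measurableT.
Qed.

Lemma off_origin_half g (h : int) a : (g - 1 <= h)%R ->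
  ((vol h / 2)%:E <= mu (B h a `&` [set x | off_origin g x]))%E.
Proof.
move=> gh; set E := _ `&` _; have mE : measurable E.
  by apply: measurableI; [exact: measurable_pball|exact: measurable_off_origin].
have sub : B h a `<=` E `|` B (g - 2) (0 : V).
  move=> x ax; have [xo|xo] := pselect (B (g - 2) (0 : V) x); first by right.
  by left; split.
have : (mu (B h a) <= mu E + mu (B (g - 2)%R (0%R : V)))%E.
  apply: le_trans (measureU2 _ mE (measurable_pball _ _)).
  apply: le_measure => //; rewrite inE; first exact: measurable_pball.
  by apply: measurableU => //; exact: measurable_pball.
rewrite !volE// -leeBlDr// -EFinB; apply: le_trans; rewrite lee_fin.
have : 2 * vol (g - 2) <= vol h.
  have vgh : vol (g - 1) <= vol h by exact: ler_vol.
  apply: le_trans vgh.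
  rewrite [vol (g - 1)](_ : _ = p%:R ^+ n * vol (g - 2)).
    rewrite ler_wpM2r ?vol_ge0// -natrX ler_nat.
    by apply: leq_trans (prime_gt1 p_pr) _; rewrite -[X in (X <= _)%N]expn1 leq_exp2l// prime_gt1.
  rewrite /vol -powR_mulrn ?(ltW p0)// -prime_powRD; congr (_ `^ _).
  by rewrite !rmorphB /=; ring.
by lra.
Qed.

(** The norm of the characteristic function of a ball is at most a constant
    times the volume to the power 1 / frozen exponent. For large balls the part
    near the origin, where the exponent is not controlled, is so small that
    boundedness of the exponent suffices there. *)
Lemma indic_modular_le1 : exists2 C : R, 0 < C & forall g a,
  (modular mu q (fun y => (\1_(B g a) y)%:E) (C * vol g `^ (frozen g a)^-1) <= 1)%E.
Proof.
have [L L1 Lvol] := frozen_close_vol.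
pose N := (Num.truncn M).+1; have MN : M <= N%:R by rewrite ltW// truncnS_gt.
pose K2 := K * N%:R + N%:R * M.
pose D := L + p%:R `^ (n%:R * K2).
have M0 : 0 < M.
  by have /andP[h1 h2] := qmM (0 : V); apply: lt_le_trans h2; exact: q0.
have D0 : 0 < D by rewrite addr_gt0 ?prime_powR_gt0// (lt_le_trans ltr01).
exists (D + 1); first by rewrite addr_gt0.
move=> g a; set eta := _ * _.
have C1 : 1 < D + 1 by rewrite ltrDr.
have f1 := frozen_gt1 g a; have f0 : 0 < frozen g a := lt_trans ltr01 f1.
have eta0 : 0 < eta by rewrite mulr_gt0 ?powR_gt0 ?vol_gt0// addr_gt0.
rewrite modular_indic//.
(* The ball of radius p^k0 has volume at most vol(g)^(1/M), so its part of the
   modular is bounded for any exponent between 1 and M; at distance p^k0 from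
   the origin the exponent is still within O(1/g) of its value at infinity. *)
pose k0 := (`|g|%N %/ N)%N.
pose h x := D * (vol g)^-1 + (vol k0)^-1 * \1_(B k0 (0 : V)) x.
have h0 x : 0 <= h x.
  by rewrite addr_ge0// mulr_ge0 ?invr_ge0 ?vol_ge0// ltW.
have mh : measurable_fun setT (EFin \o h).
  apply/measurable_EFinP; apply: measurable_funD => //.
  by apply: measurable_funM => //; apply: measurable_indic; exact: measurable_pball.
have key : {ae mu, forall x, B g a x -> vol g `^ (- q x / frozen g a) <= h x}.
  apply: filterS Lvol => x close ax; rewrite -(frozen_ball ax).
  have vV : 0 <= (vol g)^-1 by rewrite invr_ge0 vol_ge0.
  have vk : 0 <= (vol k0)^-1 by rewrite invr_ge0 vol_ge0.
  have [g0|g0] := boolP (g <= 0)%R.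
    have off : off_origin g x by rewrite /off_origin ltNge g0.
    have /andP[_ /le_trans] := close g off; apply.
    rewrite (@le_trans _ _ (D * (vol g)^-1))//; last by rewrite lerDl mulr_ge0.
    by rewrite ler_wpM2r// lerDl ltW// prime_powR_gt0.
  have fE : frozen g x = qoo by rewrite /frozen (negPf g0).
  have /andP[moo ooM] := lhd_infty_bounds lq.
  have oo1 : 1 < qoo by exact: lt_le_trans moo.
  have oo0 : 0 < qoo by exact: lt_trans oo1.
  rewrite -ltNge in g0; have gE : g%:~R = `|g|%N%:R :> R by rewrite -{1}(gtz0_abs g0).
  rewrite fE; have [xk|xk] := pselect (B k0 (0 : V) x).
    rewrite /h indicE mem_set// mulr1 (@le_trans _ _ (vol k0)^-1)//; last first.
      by rewrite lerDr mulr_ge0// ltW.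
    rewrite vol_powR gE /vol -powRN ler_prime_powR//.
    rewrite -mulrA -mulrN ler_wpM2l// mulNr mulrN lerN2.
    have kN : (k0 * N <= `|g|%N)%N by exact: leq_divM.
    have kN' : k0%:R * N%:R <= `|g|%N%:R :> R by rewrite -natrM ler_nat.
    rewrite mulrA ler_pdivlMr//; apply: (@le_trans _ _ (k0%:R * N%:R)).
      by rewrite -[k0%:~R]/(k0%:R) ler_wpM2l// (le_trans ooM).
    by rewrite (le_trans kN')// ler_peMr// ltW.
  apply: (@le_trans _ _ (D * (vol g)^-1)); last by rewrite lerDl mulr_ge0.
  apply: (@le_trans _ _ (p%:R `^ (n%:R * K2) * (vol g)^-1)); last first.
    by rewrite ler_wpM2r// lerDr (le_trans ler01).
  have kx : p%:R ^ k0%:Z <= norm x.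
    by rewrite leNgt; apply/negP => /ltW nx; apply: xk; apply/pball0P.
  have := lhd_large lq kx => kq.
  have gk : `|g|%N%:R <= N%:R * k0%:R + N%:R :> R.
    by rewrite -natrM -natrD ler_nat -mulnSr mulnC ltnW// ltn_ceil.
  have qM : `|q x - qoo| <= M.
    by apply: ler_dist_itv (qmM x) (lhd_infty_bounds lq); rewrite ltW// (lt_trans ltr01).
  have gq : `|g%:~R * (- (q x - qoo) / qoo)| <= K2.
    rewrite gE normrM normr_nat normrM normrN normfV (gtr0_norm oo0).
    apply: (@le_trans _ _ (`|g|%N%:R * `|q x - qoo|)).
      by rewrite ler_wpM2l// ler_piMr// invf_le1// ltW.
    apply: (@le_trans _ _ ((N%:R * k0%:R + N%:R) * `|q x - qoo|)); first exact: ler_wpM2r.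
    rewrite mulrDl lerD ?ler_wpM2l//.
    by rewrite -mulrA mulrC ler_wpM2r.
  have -> : - q x / qoo = - (q x - qoo) / qoo - 1 by field; rewrite gt_eqF.
  rewrite powRD; last by rewrite (vol_neq0 R p_pr n) implybT.
  rewrite powR_inv1 ?vol_ge0// ler_wpM2r//.
  by have /andP[] := vol_powR_le gq.
apply: (@le_trans _ _ (\int[mu]_(x in B g a) ((D + 1)^-1 * h x)%:E)%E).
  apply: ae_ge0_le_integral.
  - exact: measurable_pball.
  - by move=> x _; rewrite lee_fin powR_ge0.
  - apply: measurable_funTS; apply/measurable_EFinP; apply: measurable_powR_var => // x.
    by rewrite invr_ge0 ltW.
  - by move=> x _; rewrite lee_fin mulr_ge0// invr_ge0 ltW// addr_gt0.
  - apply: measurable_funTS; apply/measurable_EFinP.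
    by apply: measurable_funM => //; apply/measurable_EFinP.
  apply: filterS key => x hx ax; rewrite lee_fin.
  rewrite /eta invfM powRM; [|by rewrite invr_ge0 ltW// addr_gt0|by rewrite invr_ge0 powR_ge0].
  rewrite ler_pM ?powR_ge0//.
    apply: ge1r_powR; last exact: ltW.
    have D1 : 0 < D + 1 by rewrite addr_gt0.
    by rewrite invr_gt0 D1 /= invf_le1// (ltW C1).
  by rewrite -powRN -powRrM mulNr mulrC -mulNr hx.
under eq_integral do rewrite EFinM.
rewrite ge0_integralZl//; first last.
- by rewrite lee_fin invr_ge0 ltW// addr_gt0.
- by move=> x _; rewrite lee_fin.
- exact: measurable_funTS.
- exact: measurable_pball.
rewrite -[leRHS](_ : ((D + 1)^-1%:E * (D + 1)%:E)%E = 1%E); last first.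
  by rewrite -EFinM mulVf// gt_eqF// addr_gt0.
rewrite lee_wpmul2l//; first by rewrite lee_fin invr_ge0 ltW// addr_gt0.
under eq_integral do rewrite EFinD.
have mi : measurable_fun setT (fun x => ((vol k0)^-1 * \1_(B k0 (0 : V)) x)%:E).
  apply/measurable_EFinP; apply: measurable_funM => //; apply: measurable_indic.
  exact: measurable_pball.
rewrite ge0_integralD//; first last.
- exact: measurable_funTS.
- by move=> x _; rewrite lee_fin mulr_ge0 ?invr_ge0 ?vol_ge0.
- by move=> x _; rewrite lee_fin mulr_ge0 ?invr_ge0 ?vol_ge0// ltW.
- exact: measurable_pball.
rewrite EFinD leeD//.
  rewrite integral_cst; last exact: measurable_pball.
  by rewrite volE// -EFinM -mulrA mulVf ?mulr1// (vol_neq0 R p_pr n).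
apply: (@le_trans _ _ (\int[mu]_x ((vol k0)^-1 * \1_(B k0 (0 : V)) x)%:E)%E).
  apply: ge0_subset_integral => //; first exact: measurable_pball.
  by move=> x _; rewrite lee_fin mulr_ge0 ?invr_ge0 ?vol_ge0.
under eq_integral do rewrite EFinM.
rewrite ge0_integralZl//; first last.
- by rewrite lee_fin invr_ge0 vol_ge0.
- apply/measurable_EFinP; apply: measurable_indic; exact: measurable_pball.
rewrite integral_indic//; last exact: measurable_pball.
by rewrite setIT volE// -EFinM mulVf// (vol_neq0 R p_pr n).
Qed.

(** Conversely, half of the ball lies where the exponent is close to the frozen
    one, which bounds the norm from below. *)
Lemma indic_modular_ge : exists2 c : R, 0 < c & forall g a (eta : R), 0 < eta ->
  (modular mu q (fun y => (\1_(B g a) y)%:E) eta <= 1)%E ->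
  c * vol g `^ (frozen g a)^-1 <= eta.
Proof.
have [L L1 Lvol] := frozen_close_vol; have L0 : 0 < L by exact: lt_le_trans L1.
exists (4 * L)^-1; first by rewrite invr_gt0 mulr_gt0.
move=> g a eta eta0; rewrite modular_indic// => le1; rewrite leNgt; apply/negP => lt.
pose E := B g a `&` [set x | off_origin g x].
have mE : measurable E.
  by apply: measurableI; [exact: measurable_pball|exact: measurable_off_origin].
have f0 : 0 < frozen g a := lt_trans ltr01 (frozen_gt1 g a).
have v0 := vol_gt0 R p_pr n g.
have me : measurable_fun setT (fun x => (eta^-1 `^ q x)%:E).
  apply/measurable_EFinP; apply: measurable_powR_var => // x.
  by rewrite invr_ge0 ltW.
have : (\int[mu]_(x in E) (cst (4 * (vol g)^-1)%:E x) <= 1)%E.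
  apply: le_trans le1; apply: (@le_trans _ _ (\int[mu]_(x in E) (eta^-1 `^ q x)%:E)%E).
    apply: ae_ge0_le_integral => //.
    - by move=> x _; rewrite lee_fin mulr_ge0// invr_ge0 ltW.
    - by move=> x _; rewrite lee_fin powR_ge0.
    - exact: measurable_funTS.
    apply: filterS Lvol => x close [ax off]; rewrite lee_fin.
    have := close g off; rewrite (frozen_ball ax) => /andP[h _].
    have e1 : 4 * L * (vol g `^ (frozen g a)^-1)^-1 <= eta^-1.
      rewrite -[X in X * _]invrK -invfM lef_pV2 ?posrE// ?ltW//.
      by rewrite mulr_gt0 ?invr_gt0 ?powR_gt0// mulr_gt0.
    have L4 : 1 <= 4 * L by lra.
    apply: (@le_trans _ _ ((4 * L * (vol g `^ (frozen g a)^-1)^-1) `^ q x)).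
      rewrite powRM ?invr_ge0 ?powR_ge0//; last by rewrite (le_trans ler01).
      apply: (@le_trans _ _ (4 * L * (L^-1 * (vol g)^-1))).
        by rewrite mulrA mulfK ?gt_eqF.
      rewrite ler_pM//.
      - by rewrite (le_trans ler01).
      - by rewrite mulr_ge0// invr_ge0 ltW.
      - by apply: le1r_powR => //; exact/ltW.
      - by rewrite -powRN -powRrM mulNr [X in - X]mulrC -mulNr.
    apply: ge0_ler_powR => //; rewrite ?nnegrE ?invr_ge0 ?(ltW eta0)//; first exact/ltW.
    by rewrite mulr_ge0 ?invr_ge0 ?powR_ge0// (le_trans ler01).
  apply: ge0_subset_integral => //.
  - exact: measurable_pball.
  - exact: measurable_funTS.
  - by move=> x _; rewrite lee_fin powR_ge0.
  - exact: subIsetl.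
rewrite integral_cst//.
have gg : (g - 1 <= g)%R by rewrite gerBl.
have c0 : 0 < 4 * (vol g)^-1 by rewrite mulr_gt0// invr_gt0.
move=> h; have : ((4 * (vol g)^-1)%:E * (vol g / 2)%:E <= 1)%E.
  apply: le_trans h; rewrite lee_pmul2l ?lte_fin//.
  exact: off_origin_half.
rewrite -EFinM lee_fin => h2; have : 4 * (vol g)^-1 * (vol g / 2) = 2.
  by field; rewrite gt_eqF.
by move: h2 => /[swap] ->; rewrite leNgt ltr1n.
Qed.

End Frozen.
End CharacteristicFunctions.

(** * Mean oscillation and Lipschitz functions *)

Section Oscillation.
Variables (R : realType) (p : nat) (p_pr : prime p) (n : nat).
Local Notation V := 'rV[Qp p_pr]_n.
Local Notation X := (padic_space R p_pr n).
Local Notation B := (@pball R p p_pr n).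
Local Notation vol := (@vol R p n).
Variable mu : {measure set X -> \bar R}.
Hypothesis mu_haar : is_haar_measure mu.
Hypothesis n_gt0 : (0 < n)%N.
Implicit Types (q r : X -> R) (x y a : X) (F G : X -> \bar R) (g : int).

Let p0 : 0 < p%:R :> R. Proof. exact: prime_gt0R. Qed.
Let p1 : 1 < p%:R :> R. Proof. exact: prime_gt1R. Qed.

Lemma prime_powRN_lt1 (t : R) : 0 < t -> p%:R `^ (- t) < 1 :> R.
Proof.
move=> t0; rewrite powRN invf_lt1 ?powR_gt0// /powR gt_eqF//.
by rewrite -[ltLHS]expR0 ltr_expR mulr_gt0// ln_gt0.
Qed.

Lemma haar_volumeE g a : haar_volume mu g (a : V) = vol g.
Proof. by rewrite /haar_volume pballE volE. Qed.

Variable b : X -> R.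
Hypothesis b_loc : padic_locally_integrable mu b.

Lemma locally_integrable_ball g a : mu.-integrable (B g a) (EFin \o b).
Proof. by rewrite -pballE; exact: b_loc. Qed.

Lemma locally_integrable_measurable : measurable_fun setT b.
Proof.
rewrite -(bigcup_ball0 R p_pr n); apply/measurable_fun_bigcup => [k|k].
  exact: measurable_pball.
by have /measurable_int/measurable_EFinP := locally_integrable_ball k (0 : V).
Qed.

Let mb := locally_integrable_measurable.

Local Notation mean := (ball_mean mu b).

Lemma ball_mean_eq g a x : B g a x -> mean g (x : V) = mean g (a : V).
Proof. by move=> ax; rewrite /ball_mean !haar_volumeE !pballE (pball_eq ax). Qed.

Lemma measurable_dist (c : R) : measurable_fun setT (fun x => (`|b x - c|)%:E).
Proof.
apply/measurable_EFinP; apply: measurableT_comp => //.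
exact: measurable_funB.
Qed.

(** The triangle inequality for the mean of c - b. *)
Lemma ball_mean_dist g a (c : R) :
  ((`|c - mean g (a : V)|)%:E <=
   (vol g)^-1%:E * \int[mu]_(y in B g a) (`|c - b y|)%:E)%E.
Proof.
have v0 := vol_gt0 R p_pr n g; have mB := @measurable_pball R p p_pr n g a.
have ib := locally_integrable_ball g a.
have ic : mu.-integrable (B g a) (EFin \o cst c).
  apply/integrableP; split; first exact/measurable_EFinP.
  by rewrite (integral_cst mu mB `|c|%:E) volE// -EFinM ltry.
have E : (\int[mu]_(y in B g a) (c - b y)%:E)%E = (vol g * (c - mean g (a : V)))%:E.
  under eq_integral do rewrite EFinB.
  rewrite (integralB mB ic ib) [X in (X - _)%E](integral_cst mu mB c%:E) volE//.
  rewrite /ball_mean haar_volumeE pballE /Rintegral -(fineK (integrable_fin_num mB ib)).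
  rewrite -EFinM -EFinB; congr (_%:E).
  by rewrite mulrBr mulrA divff ?gt_eqF// mul1r mulrC.
rewrite lee_pdivlMl// -[vol g]gtr0_norm// -EFinM -normrM -abse_EFin -E.
apply: le_abse_integral => //; apply/measurable_EFinP/measurable_funTS.
exact: measurable_funB.
Qed.

Definition osc_fun g a : X -> R := fun y => (b y - mean g (a : V)) * \1_(B g a) y.

Lemma measurable_osc_fun g a : measurable_fun setT (osc_fun g a).
Proof.
apply: measurable_funM; first exact: measurable_funB.
by apply: measurable_indic; exact: measurable_pball.
Qed.

Local Notation chi g a := (fun y => (\1_(B g a) y)%:E).

Lemma measurable_chi g a : measurable_fun setT (chi g a : X -> \bar R).
Proof. by apply/measurable_EFinP; apply: measurable_indic; exact: measurable_pball. Qed.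

Lemma chi_norm_bounds q m M K rho qoo : measurable_fun setT q ->
  log_hoelder_data mu q m M K rho qoo ->
  exists c C : R, [/\ 0 < c, 0 < C & forall g a, exists2 t : R,
    Lvar_norm mu q (chi g a) = t%:E &
    c * vol g `^ (frozen rho qoo g a)^-1 <= t <= C * vol g `^ (frozen rho qoo g a)^-1].
Proof.
move=> mq lq; have [C C0 upper] := indic_modular_le1 mu_haar n_gt0 mq lq.
have [c c0 lower] := indic_modular_ge mu_haar n_gt0 mq lq.
exists c, C; split=> // g a; set w := vol g `^ _.
have w0 : 0 < w by rewrite powR_gt0// vol_gt0.
have up : (Lvar_norm mu q (chi g a) <= (C * w)%:E)%E.
  by apply: Lvar_norm_le; [exact: mulr_gt0|exact: upper].
have low : ((c * w)%:E <= Lvar_norm mu q (chi g a))%E.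
  apply: le_ereal_inf_tmp => _ [eta [eta0 h] <-]; rewrite lee_fin.
  exact: lower.
move: up low; case: (Lvar_norm mu q _) => [t| |].
- by rewrite !lee_fin => tC ct; exists t => //; rewrite ct.
- by rewrite leye_eq.
- by rewrite leeNy_eq.
Qed.

(** Clearing denominators is legitimate because the norms of characteristic
    functions of balls are finite and positive. *)
Lemma oscillation_supP (beta : R) q m M K rho qoo : measurable_fun setT q ->
  log_hoelder_data mu q m M K rho qoo ->
  (oscillation_sup mu beta b q < +oo)%E <->
  exists2 D : R, 0 < D & forall g a,
    (Lvar_norm mu q (EFin \o osc_fun g a) <=
      (D * p%:R `^ (g%:~R * beta))%:E * Lvar_norm mu q (chi g a))%E.
Proof.
move=> mq lq; have [c [C [c0 C0 chiE]]] := chi_norm_bounds mq lq.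
have rE g : vol g `^ (beta / n%:R) = p%:R `^ (g%:~R * beta).
  rewrite vol_powR; congr (_ `^ _); field.
  by rewrite pnatr_eq0 -lt0n.
have r0 g : 0 < p%:R `^ (g%:~R * beta) :> R by exact: powR_gt0.
have termE g a (D : R) : ((haar_volume mu g (a : V) `^ (beta / n%:R))^-1%:E *
     (Lvar_norm mu q (fun y => ((b y - mean g (a : V)) *
                             \1_(padic_ball R g (a : V)) y)%:E) /
      Lvar_norm mu q (fun y => (\1_(padic_ball R g (a : V)) y)%:E)) <= D%:E)%E =
   (Lvar_norm mu q (EFin \o osc_fun g a) <=
      (D * p%:R `^ (g%:~R * beta))%:E * Lvar_norm mu q (chi g a))%E.
  rewrite haar_volumeE pballE rE; have [t -> /andP[ct _]] := chiE g a.
  have t0 : 0 < t.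
    by apply: lt_le_trans ct; rewrite mulr_gt0 ?powR_gt0// vol_gt0.
  rewrite inver gt_eqF// muleA muleAC -muleA.
  rewrite !lee_pdivrMl//; congr (_ <= _)%E.
  by rewrite -!EFinM; congr (_%:E); ring.
split=> [soo|[D D0 h]].
  have s0 : (0 <= oscillation_sup mu beta b q)%E.
    apply: le_ereal_sup_tmp; exists ((haar_volume mu 0 (0 : V) `^ (beta / n%:R))^-1%:E *
     (Lvar_norm mu q (fun y => ((b y - mean 0 (0 : V)) *
                             \1_(padic_ball R 0 (0 : V)) y)%:E) /
      Lvar_norm mu q (fun y => (\1_(padic_ball R 0 (0 : V)) y)%:E)))%E.
      by exists (0, (0 : V)).
    rewrite mule_ge0 ?lee_fin ?invr_ge0 ?powR_ge0//.
    by rewrite mule_ge0 ?inve_ge0 ?Lvar_norm_ge0.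
  pose D := fine (oscillation_sup mu beta b q).
  have DE : oscillation_sup mu beta b q = D%:E by rewrite fineK// ge0_fin_numE.
  have D0 : 0 <= D by rewrite -lee_fin -DE.
  exists (D + 1) => [|g a]; first by rewrite ltr_pwDr.
  rewrite -termE (@le_trans _ _ D%:E)//; last by rewrite lee_fin lerDl.
  by rewrite -DE; apply: ereal_sup_ubound; exists (g, a).
apply: (@le_lt_trans _ _ D%:E); last exact: ltry.
by apply: ge_ereal_sup => _ [[g a] _ <-] /=; rewrite termE.
Qed.

(** ** From Lipschitz functions to oscillation bounds *)

Lemma padic_dist_le g a x y : B g a x -> B g a y ->
  padic_norm R ((x : V) - (y : V)) <= p%:R `^ g%:~R.
Proof.
move=> ax ay; have := pball_trans (pballC ay) ax.
by rewrite -pballE /padic_ball /= powR_intmul// ltW.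
Qed.

Lemma lipschitz_space_ball (beta : R) (f : X -> R) : 0 < beta ->
  lipschitz_space beta f ->
  exists2 L : R, 0 <= L & forall g a x y, B g a x -> B g a y ->
     `|f x - f y| <= L * p%:R `^ (g%:~R * beta).
Proof.
move=> beta0 [_]; set S := ereal_sup _ => Sy.
exists (Num.max 0 (fine S)); first by rewrite le_max lexx.
move=> g a x y ax ay; have [->|/eqP xy] := eqVneq x y.
  by rewrite subrr normr0 mulr_ge0 ?powR_ge0// le_max lexx.
set d := padic_norm R ((x : V) - (y : V)).
have d0 : 0 < d.
  rewrite lt_def padic_norm_ge0 andbT; apply/eqP => /padic_norm_eq0/eqP.
  by rewrite subr_eq0 => /eqP.
have db0 : 0 < d `^ beta by exact: powR_gt0.
have tS : ((`|f x - f y| / d `^ beta)%:E <= S)%E.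
  by apply: ereal_sup_ubound; exists (x, y).
have SE : S = (fine S)%:E.
  rewrite fineK// fin_numE -ltey Sy andbT -ltNye.
  by apply: lt_le_trans tS; exact: ltNyr.
move: tS; rewrite SE lee_fin ler_pdivrMr// => /le_trans; apply.
apply: (@le_trans _ _ (Num.max 0 (fine S) * d `^ beta)).
  by rewrite ler_wpM2r ?powR_ge0// le_max lexx orbT.
rewrite ler_wpM2l ?le_max ?lexx// powRrM.
apply: ge0_ler_powR; first exact: ltW.
- by rewrite nnegrE ltW.
- by rewrite nnegrE powR_ge0.
- exact: padic_dist_le ax ay.
Qed.

(** Distances are powers of p, so each pair of points lies in a ball whose
    radius is their distance. *)
Lemma ball_lipschitz_space (beta L : R) (f : X -> R) :
  measurable_fun setT f ->
  (forall g a x y, B g a x -> B g a y -> `|f x - f y| <= L * p%:R `^ (g%:~R * beta)) ->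
  lipschitz_space beta f.
Proof.
move=> mf h; split=> //; apply: (@le_lt_trans _ _ L%:E); last exact: ltry.
apply: ge_ereal_sup => _ [[x y] /= xy <-]; rewrite lee_fin.
have xy0 : (x : V) - (y : V) != 0 by rewrite subr_eq0; exact/eqP.
have [k xyk] := padic_norm_exprz R xy0.
have xyB : B k y x by apply: pball_dist.
have := h _ _ _ _ xyB (pball_center k y); rewrite xyk -powR_intmul ?(ltW p0)//.
by rewrite -powRrM ler_pdivrMr// powR_gt0.
Qed.

Lemma lipschitz_osc_fun (beta L : R) (f : X -> R) : 0 <= L ->
  {ae mu, forall x, b x = f x} ->
  (forall g a x y, B g a x -> B g a y -> `|f x - f y| <= L * p%:R `^ (g%:~R * beta)) ->
  forall g a, {ae mu, forall x,
    `|osc_fun g a x| <= (L + 1) * p%:R `^ (g%:~R * beta) * \1_(B g a) x}.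
Proof.
(* L + 1 rather than L, so that the constant is positive. *)
move=> L0 bf h g a; apply: filterS (bf) => x bx; rewrite /osc_fun indicE.
have r0 : 0 <= p%:R `^ (g%:~R * beta) :> R by exact: powR_ge0.
case: (boolP (x \in B g a)) => [/set_mem ax|_]; last by rewrite !mulr0 normr0.
rewrite !mulr1; apply: (@le_trans _ _ (L * p%:R `^ (g%:~R * beta))); last first.
  by rewrite ler_wpM2r// lerDl.
rewrite -lee_fin; apply: (le_trans (ball_mean_dist g a (b x))).
have v0 := vol_gt0 R p_pr n g; rewrite lee_pdivrMl//.
rewrite muleC -[X in (_ <= _ * X)%E](volE mu_haar g a) -integral_cst; last exact: measurable_pball.
apply: ae_ge0_le_integral.
- exact: measurable_pball.
- by move=> y _; rewrite lee_fin.
- apply: measurable_funTS; apply/measurable_EFinP; apply: measurableT_comp => //.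
  exact: measurable_funB.
- by move=> y _; rewrite lee_fin mulr_ge0.
- exact: measurable_cst.
by apply: filterS (bf) => y by_ ay; rewrite lee_fin bx by_; exact: h ax ay.
Qed.

Lemma lipschitz_oscillation (beta L : R) (f : X -> R) q : 0 <= L ->
  measurable_fun setT q -> (forall x, 1 <= q x) ->
  {ae mu, forall x, b x = f x} ->
  (forall g a x y, B g a x -> B g a y -> `|f x - f y| <= L * p%:R `^ (g%:~R * beta)) ->
  forall g a, (Lvar_norm mu q (EFin \o osc_fun g a) <=
      ((L + 1) * p%:R `^ (g%:~R * beta))%:E * Lvar_norm mu q (chi g a))%E.
Proof.
move=> L0 mq q1 bf h g a.
have D0 : 0 < (L + 1) * p%:R `^ (g%:~R * beta).
  by rewrite mulr_gt0 ?powR_gt0// ltr_pwDr.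
apply: Lvar_norm_bound => // eta eta0 chi1.
apply: Lvar_norm_le; first exact: mulr_gt0.
apply: le_trans chi1; apply: modular_dom => //.
- by apply/measurable_EFinP; exact: measurable_osc_fun.
- exact: measurable_chi.
apply: filterS (lipschitz_osc_fun L0 bf h g a) => x; rewrite -EFinM lee_fin.
by move=> /le_trans; apply; rewrite ger0_norm.
Qed.

(** ** From the commutator to oscillation bounds *)

Lemma max_commutator_ge0 (alpha : R) (f : X -> R) x :
  (0 <= max_commutator mu alpha b f x)%E.
Proof.
apply: le_ereal_sup_tmp; eexists; first by exists 0.
rewrite mule_ge0 ?lee_fin ?powR_ge0//; apply: integral_ge0 => y _.
by rewrite lee_fin mulr_ge0.
Qed.

(** Testing the commutator on the characteristic function of a ball recovers
    the oscillation on that ball. *)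
Lemma max_commutator_indic (alpha : R) g a x :
  ((vol g `^ (alpha / n%:R) * `|osc_fun g a x|)%:E <=
   max_commutator mu alpha b (\1_(B g a)) x)%E.
Proof.
rewrite /osc_fun indicE; case: (boolP (x \in B g a)) => [/set_mem ax|_]; last first.
  by rewrite mulr0 normr0 mulr0; exact: max_commutator_ge0.
rewrite mulr1; apply: (@le_trans _ _ ((vol g `^ (-1 + alpha / n%:R))%:E *
   \int[mu]_(y in B g x) (`|b x - b y| * `|\1_(B g a) y|)%:E)%E); last first.
  by apply: ereal_sup_ubound; exists g => //; rewrite haar_volumeE pballE.
have -> : (\int[mu]_(y in B g x) (`|b x - b y| * `|\1_(B g a) y|)%:E =
    \int[mu]_(y in B g a) (`|b x - b y|)%:E)%E.
  rewrite (pball_eq ax); apply: eq_integral => y ay.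
  by rewrite indicE ay normr1 mulr1.
have v0 := vol_gt0 R p_pr n g.
rewrite powRD ?(gt_eqF v0) ?implybT// powR_inv1 ?(ltW v0)//.
rewrite (mulrC (vol g)^-1) !EFinM -muleA lee_pmul2l ?lte_fin ?powR_gt0//.
exact: ball_mean_dist.
Qed.

(** ** From oscillation bounds to Lipschitz functions *)

Section Campanato.
Variables (beta : R) (beta_gt0 : 0 < beta).
Variables (q : X -> R) (m M K : R) (rho : nat -> X -> R) (qoo : R).
Hypothesis mq : measurable_fun setT q.
Hypothesis lq : log_hoelder_data mu q m M K rho qoo.
Hypothesis osc : exists2 D : R, 0 < D & forall g a,
  (Lvar_norm mu q (EFin \o osc_fun g a) <=
    (D * p%:R `^ (g%:~R * beta))%:E * Lvar_norm mu q (chi g a))%E.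

Local Notation rad g := (p%:R `^ (g%:~R * beta)).

Let rad_gt0 g : 0 < rad g :> R. Proof. exact: powR_gt0. Qed.

Let q1 x : 1 <= q x.
Proof.
have /andP[+ _] := lhd_bounds lq x; apply: le_trans; exact/ltW/(lhd_gt1 lq).
Qed.

(** Where the exponent is close to the frozen one, the modular controls the
    mean: there vol^(-q / frozen) is comparable to 1 / vol, and u <= 1 + u^q. *)
Lemma osc_L1 : exists2 D : R, 0 < D & forall g a,
  (\int[mu]_(y in B g a `&` [set x | off_origin g x]) (`|b y - mean g (a : V)|)%:E <=
    (D * rad g * vol g)%:E)%E.
Proof.
have [D D0 oscD] := osc.
have [c [C [c0 C0 chiE]]] := chi_norm_bounds mq lq.
have [L L1 Lvol] := frozen_close_vol n_gt0 lq.
have L0 : 0 < L by exact: lt_le_trans L1.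
exists (2 * D * C * (1 + L)); first by rewrite !mulr_gt0// addr_gt0.
move=> g a; set E := _ `&` _; set h := (fun y => (`|b y - mean g (a : V)|)%:E).
have mE : measurable E.
  by apply: measurableI; [exact: measurable_pball|exact: measurable_off_origin].
have v0 := vol_gt0 R p_pr n g.
pose w := vol g `^ (frozen rho qoo g a)^-1; have w0 : 0 < w by rewrite powR_gt0.
pose A := 2 * D * C * rad g; have A0 : 0 < A by rewrite !mulr_gt0.
have f1 := frozen_gt1 lq g a.
have eta0 : 0 < A * w by exact: mulr_gt0.
have mod1 : (modular mu q (EFin \o osc_fun g a) (A * w) <= 1)%E.
  apply: Lvar_norm_lt_modular => //.
    by apply/measurable_EFinP; exact: measurable_osc_fun.
  apply: (le_lt_trans (oscD g a)); have [t -> /andP[_ tC]] := chiE g a.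
  rewrite -EFinM lte_fin; apply: (@le_lt_trans _ _ (D * rad g * (C * w))).
    by rewrite ler_wpM2l// mulr_ge0// ltW.
  rewrite (_ : A * w = 2 * (D * rad g * (C * w))); last by rewrite /A; ring.
  by rewrite ltr_pMl ?ltr1n// !mulr_gt0.
pose u y := A^-1 * `|b y - mean g (a : V)|.
have u0 y : 0 <= u y by rewrite mulr_ge0// invr_ge0 ltW.
have mu' : measurable_fun setT u.
  apply: measurable_funM => //; apply: measurableT_comp => //; exact: measurable_funB.
pose k (y : X) : \bar R := ((`|(EFin \o osc_fun g a) y| * ((A * w)^-1)%:E) `^ q y)%E.
have mk : measurable_fun setT k.
  apply: measurable_modular => //; last by move=> x; exact: lt_le_trans (q1 x).
  by apply/measurable_EFinP; exact: measurable_osc_fun.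
have key : {ae mu, forall y, E y -> ((u y)%:E <= 1%:E + (L * vol g)%:E * k y)%E}.
  apply: filterS Lvol => y close [ay off].
  have := close g off; rewrite (frozen_ball n_gt0 lq ay) => /andP[lo _].
  have -> : k y = ((u y * w^-1) `^ q y)%:E.
    rewrite /k (_ : `|_|%E = (`|b y - mean g (a : V)|)%:E); last first.
      by rewrite /= /osc_fun indicE mem_set// mulr1.
    rewrite -EFinM poweR_EFin /u.
    by congr ((_ `^ _)%:E); rewrite invfM; ring.
  rewrite -EFinM -EFinD lee_fin powRM//; last by rewrite invr_ge0 ltW.
  have lo' : (vol g)^-1 <= L * (w^-1) `^ q y.
    rewrite -ler_pdivrMl// /w -powRN -powRrM mulNr [X in - X]mulrC -mulNr.
    exact: lo.
  have uq : u y <= 1 + u y `^ q y.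
    have [u1|/ltW u1] := leP (u y) 1.
      by rewrite (le_trans u1)// lerDl powR_ge0.
    by rewrite (le_trans (le1r_powR u1 (q1 y)))// lerDr.
  apply: (le_trans uq); rewrite lerD2l.
  have -> : L * vol g * (u y `^ q y * w^-1 `^ q y) =
     u y `^ q y * (vol g * (L * w^-1 `^ q y)) by ring.
  by rewrite ler_peMr ?powR_ge0// -ler_pdivrMl// mulr1.
have intu : (\int[mu]_(y in E) (u y)%:E <= (vol g + L * vol g)%:E)%E.
  apply: (@le_trans _ _ (\int[mu]_(y in E) (1%:E + (L * vol g)%:E * k y))%E).
    apply: ae_ge0_le_integral => //.
    - by move=> y _; rewrite lee_fin.
    - by apply: measurable_funTS; apply/measurable_EFinP.
    - by move=> y _; rewrite adde_ge0// mule_ge0 ?poweR_ge0// lee_fin mulr_ge0// ltW.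
    - apply: measurable_funTS; apply: emeasurable_funD => //.
      exact: measurable_funeM.
  rewrite ge0_integralD//; first last.
  - by apply: measurable_funTS; exact: measurable_funeM.
  - by move=> y _; rewrite mule_ge0 ?poweR_ge0// lee_fin mulr_ge0// ltW.
  rewrite EFinD leeD//.
    rewrite (integral_cst mu mE 1%:E) mul1e -(volE mu_haar g a).
    by apply: le_measure; rewrite ?inE//; [exact: measurable_pball|exact: subIsetl].
  rewrite ge0_integralZl//; first last.
  - by rewrite lee_fin mulr_ge0// ltW.
  - by move=> y _; exact: poweR_ge0.
  - exact: measurable_funTS.
  rewrite -[leRHS]mule1 lee_wpmul2l//; first by rewrite lee_fin mulr_ge0// ltW.
  apply: le_trans mod1; apply: ge0_subset_integral => //.
  by move=> y _; exact: poweR_ge0.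
have -> : (\int[mu]_(y in E) h y = A%:E * \int[mu]_(y in E) (u y)%:E)%E.
  rewrite -ge0_integralZl; first last.
  - by rewrite lee_fin ltW.
  - by move=> y _; rewrite lee_fin.
  - by apply: measurable_funTS; apply/measurable_EFinP.
  - exact: mE.
  apply: eq_integral => y _; rewrite /h /u -EFinM mulrA divff ?gt_eqF// mul1r//.
apply: (le_trans (lee_wpmul2l _ intu)); first by rewrite lee_fin ltW.
by rewrite -EFinM lee_fin /A le_eqVlt; apply/orP; left; apply/eqP; ring.
Qed.

Lemma off_originS g x : off_origin g x -> off_origin (g - 1) x.
Proof.
move=> off g1 xg; apply: off; first by lia.
by apply: pball_sub xg; lia.
Qed.

(** Consecutive means are compared on the part of the smaller ball that is off
    the origin, half of the ball in measure. *)
Lemma ball_mean_step : exists2 D : R, 0 < D & forall g x,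
  `|mean (g - 1) (x : V) - mean g (x : V)| <= D * rad g.
Proof.
have [D D0 h] := osc_L1; exists (4 * D * p%:R `^ n%:R).
  by rewrite !mulr_gt0// powR_gt0.
move=> g x; pose E := B (g - 1) x `&` [set x | off_origin g x].
have mE : measurable E.
  by apply: measurableI; [exact: measurable_pball|exact: measurable_off_origin].
have gg : (g - 1 <= g)%R by rewrite gerBl.
have half : ((vol (g - 1) / 2)%:E <= mu E)%E by exact: off_origin_half.
have v0 := vol_gt0 R p_pr n g; have v1 := vol_gt0 R p_pr n (g - 1).
have vv : vol (g - 1) <= vol g by exact: ler_vol.
have rr : rad (g - 1) <= rad g :> R.
  by apply: ler_powR; [exact: ltW|rewrite ler_wpM2r ?ler_int// ltW].
set d : R := `|_ - _|; have d0 : 0 <= d by rewrite normr_ge0.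
have h1 : (\int[mu]_(y in E) (`|b y - mean (g - 1) (x : V)|)%:E <=
    (D * rad g * vol g)%:E)%E.
  apply: (@le_trans _ _ (D * rad (g - 1) * vol (g - 1))%:E); last first.
    rewrite lee_fin ler_pM ?mulr_ge0 ?(ltW D0) ?(ltW v1) ?(ltW (rad_gt0 _))//.
    by rewrite ler_wpM2l// ltW.
  apply: le_trans (h (g - 1) x); apply: ge0_subset_integral => //.
  - by apply: measurableI; [exact: measurable_pball|exact: measurable_off_origin].
  - by apply: measurable_funTS; exact: measurable_dist.
  by move=> y [xy off]; split=> //; exact: off_originS.
have h2 : (\int[mu]_(y in E) (`|b y - mean g (x : V)|)%:E <=
    (D * rad g * vol g)%:E)%E.
  apply: le_trans (h g x); apply: ge0_subset_integral => //.
  - by apply: measurableI; [exact: measurable_pball|exact: measurable_off_origin].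
  - by apply: measurable_funTS; exact: measurable_dist.
  by move=> y [xy off]; split=> //; exact: pball_sub xy.
have : (d%:E * (vol (g - 1) / 2)%:E <= (2 * (D * rad g * vol g))%:E)%E.
  apply: (@le_trans _ _ (\int[mu]_(y in E) cst d%:E y)%E).
    by rewrite integral_cst// lee_wpmul2l// lee_fin.
  apply: (@le_trans _ _ (\int[mu]_(y in E) ((`|b y - mean (g - 1) (x : V)|)%:E +
      (`|b y - mean g (x : V)|)%:E))%E).
    apply: ge0_le_integral => //.
    - by apply: measurable_funTS; apply: emeasurable_funD; exact: measurable_dist.
    - move=> y _; rewrite -EFinD lee_fin /d distrC.
      rewrite -(subrKA (b y)) (le_trans (ler_normD _ _))//.
      by rewrite addrC [X in _ <= _ + X]distrC.
  rewrite ge0_integralD//; [|by apply: measurable_funTS; exact: measurable_dist|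
    by apply: measurable_funTS; exact: measurable_dist].
  by rewrite mulr_natl mulr2n EFinD; exact: leeD h1 h2.
rewrite -EFinM lee_fin.
have vE : vol g = p%:R `^ n%:R * vol (g - 1).
  by rewrite /vol -prime_powRD//; congr (_ `^ _); rewrite rmorphB /=; ring.
rewrite vE -ler_pdivlMr ?divr_gt0// => /le_trans; apply.
rewrite le_eqVlt; apply/orP; left; apply/eqP; field.
by rewrite gt_eqF.
Qed.

(** The radii grow geometrically, so the differences of consecutive means sum
    up to a multiple of the last one. *)
Lemma ball_mean_telescope : exists2 D : R, 0 < D & forall g h x, (g <= h)%R ->
  `|mean g (x : V) - mean h (x : V)| <= D * rad h.
Proof.
have [D D0 step] := ball_mean_step.
pose z : R := p%:R `^ (- beta); have z0 : 0 < z by exact: powR_gt0.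
have z1 : z < 1 by exact: prime_powRN_lt1.
exists (D / (1 - z)); first by rewrite divr_gt0// subr_gt0.
move=> g h x gh; have [k ->] : exists k : nat, g = h - k%:Z.
  by exists `|h - g|%N; lia.
have -> : D / (1 - z) * rad h = D * (rad h / (1 - z)) by ring.
apply: (@le_trans _ _ (D * ((1 - z ^+ k) * (rad h / (1 - z))))); last first.
  rewrite ler_wpM2l ?(ltW D0)// ler_piMl ?divr_ge0 ?(ltW (rad_gt0 h)) ?subr_ge0 ?(ltW z1)//.
  by rewrite lerBlDr lerDl exprn_ge0// ltW.
elim: k => [|k IH]; first by rewrite subr0 subrr normr0 expr0 subrr mul0r mulr0.
have st := step (h - k%:Z) x.
have -> : h - k.+1%:Z = h - k%:Z - 1 by rewrite intS opprD addrA addrAC.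
rewrite -(subrKA (mean (h - k%:Z) (x : V))) (le_trans (ler_normD _ _))//.
apply: (le_trans (lerD st IH)).
have -> : rad (h - k%:Z) = rad h * z ^+ k :> R.
  rewrite -powR_mulrn ?(ltW z0)// /z -powRrM -prime_powRD//; congr (_ `^ _).
  by rewrite rmorphB /=; ring.
rewrite -mulrDr ler_wpM2l ?(ltW D0)// le_eqVlt; apply/orP; left; apply/eqP.
by rewrite exprS; field; rewrite subr_eq0 eq_sym lt_eqF.
Qed.

(** The means over shrinking balls converge at a geometric rate; their limit is
    the Lipschitz representative of b. *)
Lemma lipschitz_representative : exists f : X -> R,
  lipschitz_space beta f /\ {ae mu, forall x, b x = f x}.
Proof.
have [D D0 tele] := ball_mean_telescope.
have /choice[f fD] x : exists l, forall g, `|mean g (x : V) - l| <= D * rad g.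
  apply: (common_limit 0) => g h.
  have r0 k : 0 <= D * rad k :> R by rewrite mulr_ge0// ltW.
  have [gh|/ltW hg] := leP g h.
    by rewrite (le_trans (tele _ _ _ gh))// lerDr.
  by rewrite distrC (le_trans (tele _ _ _ hg))// lerDl.
have fB g a x y : B g a x -> B g a y -> `|f x - f y| <= 2 * D * rad g.
  move=> ax ay; have := fD x g; have := fD y g.
  rewrite (ball_mean_eq ax) (ball_mean_eq ay) => fy fx.
  rewrite -(subrKA (mean g (a : V))) (le_trans (ler_normD _ _))// distrC.
  by have := lerD fx fy; lra.
have small (t : R) : 0 < t -> exists k : nat, rad (- k%:Z) < t.
  move=> t0; have rE (k : nat) : rad (- k%:Z) = (p%:R `^ (- beta)) ^+ k :> R.
    rewrite -powR_mulrn ?powR_ge0// -powRrM; congr (_ `^ _).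
    by rewrite rmorphN /=; ring.
  have z1 : `|p%:R `^ (- beta) : R| < 1.
    by rewrite ger0_norm ?powR_ge0// prime_powRN_lt1.
  have := cvg_expr z1 => /cvgr0Pnorm_lt/(_ _ t0)[k _ kt].
  by exists k; rewrite rE; apply: le_lt_trans (kt k _) => //=; exact: ler_norm.
have mf : measurable_fun setT f.
  move=> mT; apply: (measurability _ (RGenOInfty.measurableE R)) => //.
  move=> _ [_ [t ->] <-]; rewrite setTI; apply: padic_open_measurable => x /=.
  rewrite in_itv/= andbT => tx.
  have [|k kt] := small ((f x - t) / (2 * D)).
    by rewrite divr_gt0 ?subr_gt0// mulr_gt0.
  exists (- k%:Z) => y xy /=; rewrite in_itv/= andbT.
  have := fB _ _ _ _ (pball_center _ x) xy.
  move: kt; rewrite ltr_pdivlMr ?mulr_gt0// ler_norml => kt /andP[_ h2].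
  by lra.
exists f; split; first exact: (@ball_lipschitz_space beta (2 * D) f mf fB).
have [D1 D10 L1] := osc_L1.
pose h x := (`|b x - f x|)%:E.
have mh : measurable_fun setT h.
  apply/measurable_EFinP; apply: measurableT_comp => //; exact: measurable_funB.
have h0 x : (0 <= h x)%E by rewrite lee_fin.
have avgh (k : nat) x : (avg mu h (- k%:Z) x <= ((D1 + D) * rad (- k%:Z))%:E)%E.
  have v0 := vol_gt0 R p_pr n (- k%:Z).
  rewrite /avg lee_pdivrMl//.
  have off : B (- k%:Z) x `&` [set x | off_origin (- k%:Z) x] = B (- k%:Z) x.
    by apply: setIidl => y _ /=; rewrite /off_origin; lia.
  have := L1 (- k%:Z) x; rewrite off => L1k.
  apply: (@le_trans _ _ (\int[mu]_(y in B (- k%:Z) x)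
      ((`|b y - mean (- k%:Z) (x : V)|)%:E + cst (D * rad (- k%:Z))%:E y))%E).
    apply: ge0_le_integral => //.
    - exact: measurable_pball.
    - exact: measurable_funTS.
    - by apply: measurable_funTS; apply: emeasurable_funD => //; exact: measurable_dist.
    move=> y xy; rewrite /h /cst -EFinD lee_fin.
    rewrite -(subrKA (mean (- k%:Z) (x : V))) (le_trans (ler_normD _ _))// lerD2l.
    by rewrite -(ball_mean_eq xy).
  have Dr0 : 0 <= D * rad (- k%:Z) :> R by rewrite mulr_ge0// ltW.
  rewrite ge0_integralD//; first last.
  - by apply: measurable_funTS; exact: measurable_dist.
  - exact: measurable_pball.
  rewrite integral_cst; last exact: measurable_pball.
  rewrite volE//; apply: (le_trans (leeD2r _ L1k)).
  by rewrite -EFinM -EFinD lee_fin le_eqVlt; apply/orP; left; apply/eqP; ring.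
(* On a fixed ball, averaging over balls of radius p^(-k) preserves the integral
   of |b - f|, and the averages are uniformly small. *)
have zero (N : nat) : (\int[mu]_(x in B N (0%R : V)) h x = 0)%E.
  apply/eqP; rewrite eq_le; apply/andP; split; last exact: integral_ge0.
  apply/lee_addgt0Pr => e e0; rewrite add0e.
  have vN := vol_gt0 R p_pr n N.
  have [|k kt] := small (e / (vol N * (D1 + D))).
    by rewrite divr_gt0// mulr_gt0// addr_gt0.
  rewrite -(integral_avg mu_haar (g := - k%:Z))//; last first.
    have kN : (- k%:Z <= N%:Z)%R by clear; lia.
    by move=> x Nx; exact: pball_sub_radius kN Nx.
  apply: (@le_trans _ _ (\int[mu]_(x in B N (0%R : V)) cst ((D1 + D) * rad (- k%:Z))%:E x)%E).
    apply: ge0_le_integral => //.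
    - exact: measurable_pball.
    - by move=> x _; exact: avg_ge0.
    - by apply: measurable_funTS; exact: measurable_avg.
  rewrite integral_cst; last exact: measurable_pball.
  rewrite volE// -EFinM lee_fin ltW//.
  move: kt; rewrite ltr_pdivlMr; last by rewrite mulr_gt0// addr_gt0.
  by apply: le_lt_trans; rewrite le_eqVlt; apply/orP; left; apply/eqP; ring.
have aeN (N : nat) : {ae mu, forall x, B N (0 : V) x -> h x = 0%E}.
  apply/(ae_eq_integral_abs mu (measurable_pball N (0 : V)) (measurable_funTS mh)).
  rewrite -(zero N); apply: eq_integral => x _.
  by rewrite gee0_abs.
have := ae_foralln aeN.
apply: filterS => x hx; have : (\bigcup_(k in [set: nat]) B k (0 : V)) x.
  by rewrite bigcup_ball0.
move=> [N _ /hx]; rewrite /h => -[/eqP]; rewrite normr_eq0 subr_eq0.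
by move=> /eqP.
Qed.

End Campanato.
End Oscillation.

(** * The fractional maximal operator *)

Section Powers.
Variable R : realType.

Lemma powR_le1_anti (a e e' : R) : 0 <= a <= 1 -> 0 < e -> e <= e' -> a `^ e' <= a `^ e.
Proof.
move=> /andP[a0 a1] e0 ee; have [->|an] := eqVneq a 0.
  by rewrite !powR0 ?gt_eqF// (lt_le_trans e0).
by apply: ger_powR => //; rewrite lt_def an a0.
Qed.

Lemma le_poweR (e : R) (u v : \bar R) : 0 <= e -> (0 <= u)%E -> (u <= v)%E ->
  (u `^ e <= v `^ e)%E.
Proof.
move=> e0 u0 uv; apply: gt0_ler_poweR => //; rewrite in_itv/= leey andbT//.
exact: le_trans uv.
Qed.

Lemma powRD_le (a c e E : R) : 0 <= a -> 0 <= c -> 0 <= e -> e <= E ->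
  (a + c) `^ e <= 2 `^ E * (a `^ e + c `^ e).
Proof.
move=> a0 c0 e0 eE.
have two z : 0 <= z -> a + c <= 2 * z -> (a + c) `^ e <= 2 `^ E * z `^ e.
  move=> z0 acz; apply: (@le_trans _ _ ((2 * z) `^ e)).
    by apply: ge0_ler_powR => //; rewrite nnegrE ?addr_ge0 ?mulr_ge0.
  have h2 : 0 <= 2 :> R by [].
  rewrite (powRM _ h2 z0) ler_wpM2r ?powR_ge0//.
  by apply: ler_powR => //; rewrite ler1n.
have [ac|/ltW ca] := leP a c.
  apply: (le_trans (two c c0 _)); first by lra.
  by rewrite ler_wpM2l ?powR_ge0// lerDr powR_ge0.
apply: (le_trans (two a a0 _)); first by lra.
by rewrite ler_wpM2l ?powR_ge0// lerDl powR_ge0.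
Qed.

End Powers.

Section Averages.
Variables (R : realType) (p : nat) (p_pr : prime p) (n : nat).
Local Notation V := 'rV[Qp p_pr]_n.
Local Notation X := (padic_space R p_pr n).
Local Notation norm := (@pnorm R p p_pr n).
Local Notation B := (@pball R p p_pr n).
Local Notation vol := (@vol R p n).
Variable mu : {measure set X -> \bar R}.
Hypothesis mu_haar : is_haar_measure mu.
Hypothesis n_gt0 : (0 < n)%N.
Implicit Types (q r : X -> R) (x y a : X) (g : int).

Let p0 : 0 < p%:R :> R. Proof. exact: prime_gt0R. Qed.
Let p1 : 1 < p%:R :> R. Proof. exact: prime_gt1R. Qed.

(** ** Exchanging exponents that agree at infinity *)

(** Exponents e1 and e2 at distance K / k may be exchanged on numbers that are
    at least p^(-2nk), at the cost of a constant; smaller numbers are absorbed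
    by the error term. *)
Lemma exponent_exchange (u e1 e2 K : R) (k : nat) : 0 <= u <= 1 -> 1 <= e1 ->
  k%:R * `|e1 - e2| <= K ->
  u `^ e1 <= p%:R `^ (2 * n%:R * K) * u `^ e2 + p%:R `^ (- (2 * n%:R * k%:R)).
Proof.
move=> /andP[u0 u1] e11 kK; set z := p%:R `^ (- _).
have z0 : 0 <= z by exact: powR_ge0.
have A0 : 0 <= p%:R `^ (2 * n%:R * K) * u `^ e2 by rewrite mulr_ge0 ?powR_ge0.
have [uz|/ltW zu] := leP u z.
  have [->|un0] := eqVneq u 0.
    by rewrite powR0 ?addr_ge0 ?mulr_ge0 ?powR_ge0// gt_eqF// (lt_le_trans ltr01).
  apply: (@le_trans _ _ u); last by rewrite (le_trans uz)// lerDr.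
  by apply: ge1r_powR => //; rewrite lt_def un0 u0.
have zp : 0 < z by exact: powR_gt0.
have up : 0 < u by exact: lt_le_trans zu.
apply: (@le_trans _ _ (p%:R `^ (2 * n%:R * K) * u `^ e2)); last by rewrite lerDl.
have -> : e1 = (e1 - e2) + e2 by rewrite subrK.
rewrite powRD ?(gt_eqF up) ?implybT// ler_wpM2r ?powR_ge0//.
apply: (@le_trans _ _ (u `^ (- `|e1 - e2|))).
  by apply: ger_powR; rewrite ?up// lerNl -normrN ler_norm.
rewrite powRN; apply: (@le_trans _ _ (z `^ `|e1 - e2|)^-1).
  rewrite lef_pV2 ?posrE ?powR_gt0//.
  by apply: ge0_ler_powR; rewrite ?nnegrE.
rewrite -powRN -powRrM; apply: ler_prime_powR => //.
rewrite mulrNN -[X in X <= _]mulrA; exact: ler_wpM2l.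
Qed.

(** A weight comparable to the minimum of 1 and |x|^(-2n), which dominates the
    error terms of the exchange and is integrable. *)
Definition shell_weight x : \bar R :=
  \sum_(0 <= k <oo) (p%:R `^ (- (2 * n%:R * k%:R)) * \1_(B k (0 : V)) x)%:E.

Lemma shell_weight_ge0 x : (0 <= shell_weight x)%E.
Proof. by apply: nneseries_ge0 => k _ _; rewrite lee_fin mulr_ge0 ?powR_ge0. Qed.

Let measurable_shell_term (k : nat) :
  measurable_fun setT (fun x : X =>
    ((p%:R : R) `^ (- (2 * n%:R * k%:R)) * \1_(B k (0 : V)) x)%:E).
Proof.
apply/measurable_EFinP; apply: measurable_funM => //.
by apply: measurable_indic; exact: measurable_pball.
Qed.

Lemma measurable_shell_weight : measurable_fun setT shell_weight.
Proof.
apply: ge0_emeasurable_sum => [k x _ _|k _]; last exact: measurable_shell_term.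
by rewrite lee_fin mulr_ge0 ?powR_ge0.
Qed.

Lemma shell_weight_ge (k : nat) x : B k (0 : V) x ->
  ((p%:R `^ (- (2 * n%:R * k%:R)))%:E <= shell_weight x)%E.
Proof.
move=> kx; apply: (le_trans _ (@le_nneseries_term _ _ k _)) => [|i].
  by rewrite indicE mem_set// mulr1.
by rewrite lee_fin mulr_ge0 ?powR_ge0.
Qed.

(** The k-th term has integral p^(-nk), and p^(-n) is at most 1/2. *)
Lemma integral_shell_weight : (\int[mu]_x shell_weight x <= 2%:E)%E.
Proof.
rewrite /shell_weight integral_nneseries//.
pose z : R := p%:R `^ (- n%:R).
have z0 : 0 <= z by exact: powR_ge0.
have z2 : z <= 2^-1.
  rewrite /z powRN lef_pV2 ?posrE ?powR_gt0// powR_mulrn ?(ltW p0)// -natrX ler_nat.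
  by apply: leq_trans (prime_gt1 p_pr) _; rewrite -[X in (X <= _)%N]expn1 leq_exp2l// prime_gt1.
have termE k : (\int[mu]_x (p%:R `^ (- (2 * n%:R * k%:R)) * \1_(B k (0 : V)) x)%:E =
    (z ^+ k)%:E)%E.
  under eq_integral do rewrite EFinM.
  rewrite ge0_integralZl//; last first.
    by apply/measurable_EFinP; apply: measurable_indic; exact: measurable_pball.
  rewrite integral_indic//; last exact: measurable_pball.
  rewrite setIT volE// -EFinM; congr (_%:E).
  rewrite /vol -prime_powRD// -powR_mulrn// /z -powRrM; congr (_ `^ _).
  by rewrite -[k%:~R]/(k%:R); ring.
apply: lime_le.
  by apply: is_cvg_nneseries => k _ _; rewrite termE lee_fin exprn_ge0.
apply: nearW => N; rewrite big_mkord (eq_bigr (fun k : 'I_N => (z ^+ k)%:E)); last first.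
  by move=> k _; rewrite termE.
rewrite sumEFin lee_fin.
have zz : 0 < 1 - z by lra.
rewrite -(ler_pM2l zz) -[X in X * _]opprB mulNr -subrX1 opprB.
apply: (@le_trans _ _ 1); first by rewrite gerBl exprn_ge0.
by lra.
Qed.

(** With p^k = max(1, |x|) the weight and the exchange of exponents apply to x
    with the same k. *)
Lemma shell_exponent q m M K rho qoo : log_hoelder_data mu q m M K rho qoo ->
  forall x, exists k : nat, B k (0 : V) x /\ k%:R * `|q x - qoo| <= K.
Proof.
move=> lq x; have [x1|x1] := leP (norm x) 1.
  exists 0%N; split; last by rewrite mul0r (lhd_ge0 lq).
  by apply/pball0P; rewrite expr0z.
have x0 : (x : V) != 0.
  by apply/eqP => x0; move: x1; rewrite -pnormE x0 padic_norm0 ltr10.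
have [k xk] := padic_norm_exprz R x0; rewrite pnormE in xk.
have k0 : (0 <= k)%R.
  by move: x1; rewrite xk -(expr0z p%:R) ltr_exprz_prime// => /ltW.
exists `|k|%N; split; first by apply/pball0P; rewrite xk gez0_abs.
by apply: (lhd_large lq); rewrite gez0_abs// xk.
Qed.

(** ** Averages *)

Lemma avg_le_avg (f h : X -> \bar R) g x :
  measurable_fun setT f -> measurable_fun setT h -> (forall y, 0 <= f y)%E ->
  (forall y, 0 <= h y)%E -> {ae mu, forall y, B g x y -> (f y <= h y)%E} ->
  (avg mu f g x <= avg mu h g x)%E.
Proof.
move=> mf mh f0 h0 fh; rewrite /avg lee_wpmul2l ?lee_fin ?invr_ge0 ?vol_ge0//.
apply: ae_ge0_le_integral; [exact: measurable_pball|by []|exact: measurable_funTS|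
  by []|exact: measurable_funTS|exact: fh].
Qed.

Lemma avg_cst (c : R) g x : avg mu (cst c%:E) g x = c%:E.
Proof.
rewrite /avg integral_cst; last exact: measurable_pball.
by rewrite volE// -!EFinM mulrCA mulVf ?mulr1// (vol_neq0 R p_pr n).
Qed.

Lemma avgD (f h : X -> \bar R) g x :
  measurable_fun setT f -> measurable_fun setT h -> (forall y, 0 <= f y)%E ->
  (forall y, 0 <= h y)%E ->
  avg mu (fun y => f y + h y)%E g x = (avg mu f g x + avg mu h g x)%E.
Proof.
move=> mf mh f0 h0; rewrite /avg ge0_integralD//; first last.
- exact: measurable_funTS.
- exact: measurable_funTS.
- exact: measurable_pball.
by rewrite ge0_muleDr//; apply: integral_ge0.
Qed.

Lemma avgZ (c : R) (f : X -> \bar R) g x : 0 <= c ->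
  measurable_fun setT f -> (forall y, 0 <= f y)%E ->
  avg mu (fun y => c%:E * f y)%E g x = (c%:E * avg mu f g x)%E.
Proof.
move=> c0 mf f0; rewrite /avg ge0_integralZl//; first by rewrite muleCA.
- exact: measurable_pball.
- exact: measurable_funTS.
Qed.

Lemma avg_le_integral (f : X -> \bar R) g x (I : R) :
  measurable_fun setT f -> (forall y, 0 <= f y)%E ->
  (\int[mu]_y f y <= I%:E)%E -> (avg mu f g x <= (I / vol g)%:E)%E.
Proof.
move=> mf f0 fI; rewrite /avg lee_pdivrMl ?vol_gt0// -EFinM.
rewrite mulrCA mulfV ?mulr1 ?(vol_neq0 R p_pr n)//.
apply: le_trans fI; apply: ge0_subset_integral => //.
exact: measurable_pball.
Qed.

(** Jensen's inequality up to a factor 2, from h <= l + l^(1-th) h^th with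
    l = a^(1/th). *)
Lemma avg_jensen (th a : R) (h F : X -> R) g x : 1 <= th ->
  measurable_fun setT h -> measurable_fun setT F ->
  (forall y, 0 <= h y) -> (forall y, 0 <= F y) ->
  {ae mu, forall y, B g x y -> h y `^ th <= F y} ->
  0 <= a -> (avg mu (EFin \o F) g x <= a%:E)%E ->
  (avg mu (EFin \o h) g x <= (2 * a `^ th^-1)%:E)%E.
Proof.
move=> th1 mh mF h0 F0 hF a0 Fa.
have th0 : 0 < th by exact: lt_le_trans th1.
have main (l : R) : 0 < l ->
    (avg mu (EFin \o h) g x <= (l + l `^ (1 - th) * a)%:E)%E.
  move=> l0; have L0 : 0 <= l `^ (1 - th) by exact: powR_ge0.
  apply: (@le_trans _ _ (avg mu (fun y => cst l%:E y + (l `^ (1 - th))%:E * (EFin \o F) y)%E g x)).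
    apply: avg_le_avg.
    - exact/measurable_EFinP.
    - apply: emeasurable_funD => //; apply: measurable_funeM.
      exact/measurable_EFinP.
    - by move=> y; rewrite lee_fin.
    - by move=> y; rewrite -EFinM -EFinD lee_fin addr_ge0 ?mulr_ge0// ltW.
    apply: filterS hF => y hFy yB; rewrite -EFinM -EFinD lee_fin.
    have [hl|lh] := leP (h y) l.
      by rewrite (le_trans hl)// lerDl mulr_ge0.
    have hp : 0 < h y by exact: lt_trans lh.
    apply: (@le_trans _ _ (l `^ (1 - th) * F y)); last by rewrite lerDr ltW.
    apply: (@le_trans _ _ (l `^ (1 - th) * h y `^ th)); last by rewrite ler_wpM2l// hFy.
    apply: (@le_trans _ _ (h y `^ (1 - th) * h y `^ th)).
      by rewrite -powRD ?(gt_eqF hp) ?implybT// subrK powRr1.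
    rewrite ler_wpM2r ?powR_ge0// -[1 - th]opprB !powRN lef_pV2 ?posrE ?powR_gt0//.
    by apply: ge0_ler_powR; rewrite ?nnegrE ?subr_ge0// ltW.
  rewrite avgD; first last.
  - by move=> y; rewrite -EFinM lee_fin mulr_ge0.
  - by move=> y; rewrite lee_fin ltW.
  - by apply: measurable_funeM; exact/measurable_EFinP.
  - exact: measurable_cst.
  rewrite avg_cst (avgZ _ _ L0); [|exact/measurable_EFinP|by move=> y; rewrite lee_fin].
  by rewrite EFinD leeD2l// EFinM lee_wpmul2l// lee_fin.
have [a1|a1] := eqVneq a 0.
  rewrite a1 powR0 ?mulr0 ?invr_eq0 ?gt_eqF//.
  by apply/lee_addgt0Pr => e e0; rewrite add0e; have := main e e0; rewrite a1 mulr0 addr0.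
have ap : 0 < a by rewrite lt_def a1.
apply: (le_trans (main (a `^ th^-1) _)); first exact: powR_gt0.
rewrite lee_fin le_eqVlt; apply/orP; left; apply/eqP.
have -> : (a `^ th^-1) `^ (1 - th) * a = a `^ th^-1.
  rewrite -powRrM -[X in _ * X](powRr1 a0) -powRD ?a1 ?implybT//.
  by congr (_ `^ _); field; rewrite gt_eqF.
by ring.
Qed.

(** Hedberg's trick: part of the average a is traded for a power of the volume
    v. With w conjugate to u one has t = 1/u - 1/w, so that the powers of v
    cancel exactly. *)
Lemma hedberg (t u c a v : R) : 0 < u -> 0 < u^-1 - t -> 0 < v -> u <= conj_exp t u ->
  0 <= c -> 0 <= a -> a <= c * v `^ (- u^-1) ->
  (v `^ t * a) `^ conj_exp t u <= c `^ (conj_exp t u - u) * a `^ u.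
Proof.
move=> u0 ut v0 uq c0 a0 ac; set w := conj_exp t u in uq *.
have w0 : 0 < w by rewrite invr_gt0.
rewrite powRM ?powR_ge0//.
have [->|an] := eqVneq a 0.
  by rewrite powR0 ?gt_eqF// mulr0 powR0 ?gt_eqF// mulr0.
have -> : a `^ w = a `^ (w - u) * a `^ u.
  by rewrite -powRD ?an ?implybT// subrK.
rewrite mulrA ler_wpM2r ?powR_ge0//.
apply: (@le_trans _ _ ((v `^ t) `^ w * (c * v `^ (- u^-1)) `^ (w - u))).
  rewrite ler_wpM2l ?powR_ge0//; apply: ge0_ler_powR => //; rewrite ?nnegrE ?subr_ge0//.
  by rewrite mulr_ge0// powR_ge0.
rewrite powRM ?powR_ge0// mulrCA -!powRrM -powRD; last by rewrite (gt_eqF v0) implybT.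
rewrite (_ : t * w + - u^-1 * (w - u) = 0) ?powRr0 ?mulr1//.
have -> : t = u^-1 - w^-1 by rewrite /w invrK; ring.
by field; rewrite !gt_eqF.
Qed.

End Averages.

Section FractionalMaximal.
Variables (R : realType) (p : nat) (p_pr : prime p) (n : nat).
Local Notation X := (padic_space R p_pr n).
Local Notation vol := (@vol R p n).
Variable mu : {measure set X -> \bar R}.
Hypothesis mu_haar : is_haar_measure mu.
Hypothesis n_gt0 : (0 < n)%N.
Implicit Types (q r : X -> R) (x y a : X) (g : int).

Let p0 : 0 < p%:R :> R. Proof. exact: prime_gt0R. Qed.
Let p1 : 1 < p%:R :> R. Proof. exact: prime_gt1R. Qed.

(** The fractional maximal operator of order n t, since vol g is p^(n g). *)
Definition fmax (t : R) (f : X -> \bar R) x : \bar R :=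
  ereal_sup (range (fun g => (vol g `^ t)%:E * avg mu f g x)%E).

Lemma measurable_fmax t f : measurable_fun setT (fmax t f).
Proof.
by apply: measurable_fun_int_sup => g; apply: measurable_funeM; exact: measurable_avg.
Qed.

Lemma fmax_ge0 t f x : (forall y, 0 <= f y)%E -> (0 <= fmax t f x)%E.
Proof.
move=> f0; apply: (@le_trans _ _ ((vol 0 `^ t)%:E * avg mu f 0 x)%E).
  by rewrite mule_ge0 ?lee_fin ?powR_ge0//; exact: avg_ge0.
by apply: ereal_sup_ubound; exists 0.
Qed.

(** ** Boundedness of the fractional maximal operator *)

Section MainEstimate.
Variables (t : R) (r q : X -> R) (m M K : R) (rho : nat -> X -> R) (roo : R).
Hypotheses (mr : measurable_fun setT r) (mq : measurable_fun setT q).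
Hypothesis lr : log_hoelder_data mu r m M K rho roo.
Hypotheses (t_ge0 : 0 <= t) (Mt : M * t < 1).
Hypothesis qE : forall x, q x = conj_exp t (r x).

Let m1 : 1 < m. Proof. exact: lhd_gt1 lr. Qed.
Let m0 : 0 < m. Proof. exact: lt_trans m1. Qed.
Let rmM x : m <= r x <= M. Proof. exact: lhd_bounds lr x. Qed.
Let K0 : 0 <= K. Proof. exact: lhd_ge0 lr. Qed.
Let roomM : m <= roo <= M. Proof. exact: lhd_infty_bounds lr. Qed.
Let mM : m <= M. Proof. by have /andP[] := roomM; exact: le_trans. Qed.
Let gt1 u : m <= u <= M -> 1 < u.
Proof. by move=> /andP[mu' _]; exact: lt_le_trans mu'. Qed.
Let gt0 u : m <= u <= M -> 0 < u.
Proof. by move=> /gt1; exact: lt_trans. Qed.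
Let den u : m <= u <= M -> 0 < u^-1 - t.
Proof. exact: conj_exp_den. Qed.
Let le_conj u : m <= u <= M -> u <= conj_exp t u.
Proof. by move=> hu; apply: le_conj_exp hu. Qed.
Let conj_le u v : m <= u <= M -> m <= v <= M -> u <= v -> conj_exp t u <= conj_exp t v.
Proof. by apply: conj_exp_le. Qed.

Local Notation Q := (conj_exp t M).

Let hM : m <= M <= M. Proof. by rewrite mM lexx. Qed.
Let hm : m <= m <= M. Proof. by rewrite lexx. Qed.
Let Q_ge1 : 1 <= Q. Proof. by rewrite (le_trans _ (le_conj hM))// ltW// gt1. Qed.
Let qQ x : q x <= Q.
Proof. by rewrite qE conj_le//; have /andP[] := rmM x. Qed.
Let q_ge1 x : 1 <= q x.
Proof. by rewrite qE (le_trans _ (le_conj (rmM x)))// ltW// gt1. Qed.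
Let t_lt1 : t < 1.
Proof. by apply: le_lt_trans Mt; rewrite ler_peMl// ltW// (lt_le_trans m1). Qed.

(** On balls of radius at most 1 the conjugate exponents are compared with the
    frozen exponent u; the powers of the volume that remain are bounded by the
    log-Hoelder condition. *)
Lemma hedberg_frozen (u a : R) (k : nat) x : m <= u -> u <= r x ->
  k%:R * (r x - u) <= K -> 0 <= a -> a <= 2 * vol (- k%:Z) `^ (- m^-1) ->
  (vol (- k%:Z) `^ t * (2 * a `^ (u / m)^-1)) `^ q x <=
  2 `^ Q * 2 `^ (m * Q) * p%:R `^ (n%:R * (Q * K)) * a `^ m.
Proof.
move=> mu' ur kK a0 a2; set v := vol _.
have v0 : 0 < v by exact: vol_gt0.
have hu : m <= u <= M by rewrite mu' (le_trans ur)//; have /andP[] := rmM x.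
have u0 := gt0 hu; have r0 := gt0 (rmM x).
have q0 : 0 < q x by exact: lt_le_trans (q_ge1 x).
have Q0 : 0 <= Q by exact: le_trans Q_ge1.
have qu : u <= q x by rewrite (le_trans ur)// qE le_conj.
rewrite powRM ?powR_ge0//; last by rewrite mulr_ge0 ?powR_ge0.
rewrite powRM ?powR_ge0//.
have [->|an] := eqVneq a 0.
  rewrite !powR0 ?gt_eqF ?invr_gt0 ?divr_gt0 ?(gt0 hu)//.
  by rewrite !mulr0.
pose e := m * (q x / u - 1).
have e0 : 0 <= e by rewrite mulr_ge0 ?(ltW m0)// subr_ge0 ler_pdivlMr// mul1r.
have -> : (a `^ (u / m)^-1) `^ q x = a `^ m * a `^ e.
  rewrite -powRrM -powRD ?an ?implybT//; congr (_ `^ _); rewrite /e; field.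
  by rewrite !gt_eqF.
have ae : a `^ e <= 2 `^ (m * Q) * v `^ (- (q x / u - 1)).
  apply: (@le_trans _ _ ((2 * v `^ (- m^-1)) `^ e)).
    by apply: ge0_ler_powR => //; rewrite nnegrE ?mulr_ge0 ?powR_ge0.
  have h2 : 0 <= 2 :> R by [].
  rewrite (powRM _ h2 (powR_ge0 _ _)).
  apply: ler_pM; [exact: powR_ge0|exact: powR_ge0| |].
    apply: ler_powR; first by rewrite ler1n.
    rewrite /e ler_wpM2l ?(ltW m0)// (le_trans _ (qQ x))//.
    by rewrite (@le_trans _ _ (q x / u)) ?gerBl// ler_pdivrMr// ler_peMr ?(ltW q0)// ltW// gt1.
  rewrite -powRrM le_eqVlt; apply/orP; left; apply/eqP; congr (_ `^ _); rewrite /e; field.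
  by rewrite !gt_eqF.
have vb : (v `^ t) `^ q x * v `^ (- (q x / u - 1)) <= p%:R `^ (n%:R * (Q * K)).
  rewrite -powRrM -powRD ?(gt_eqF v0) ?implybT//.
  have -> : t * q x + - (q x / u - 1) = - (q x * ((r x - u) / (r x * u))).
    have tE : t = (r x)^-1 - (q x)^-1 by rewrite qE /conj_exp invrK; ring.
    by rewrite {1}tE; field; rewrite !gt_eqF.
  rewrite /v vol_powR; apply: ler_prime_powR => //.
  rewrite -mulrA ler_wpM2l// rmorphN /= mulrNN -[k%:~R]/(k%:R).
  have -> : k%:R * (q x * ((r x - u) / (r x * u))) =
      q x * (k%:R * (r x - u) / (r x * u)) by ring.
  rewrite ler_pM ?(ltW q0)//; first by rewrite divr_ge0 ?mulr_ge0 ?subr_ge0// ltW.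
  apply: (le_trans _ kK); rewrite ler_pdivrMr ?mulr_gt0// ler_peMr//.
    by rewrite mulr_ge0 ?subr_ge0.
  by rewrite -[leLHS]mulr1 ler_pM// ltW// gt1.
have q2 : 2 `^ q x <= 2 `^ Q :> R by apply: ler_powR; rewrite ?ler1n.
apply: (@le_trans _ _ ((v `^ t) `^ q x *
    (2 `^ Q * (a `^ m * (2 `^ (m * Q) * v `^ (- (q x / u - 1))))))).
  rewrite ler_wpM2l ?powR_ge0// ler_pM ?powR_ge0 ?mulr_ge0 ?powR_ge0//.
  by rewrite ler_wpM2l ?powR_ge0.
have shuffle (c1 c2 c3 c4 c5 : R) : c1 * (c2 * (c3 * (c4 * c5))) = c2 * c4 * c3 * (c1 * c5).
  by ring.
rewrite shuffle -[leRHS]mulrA [X in _ <= _ * X]mulrC [leRHS]mulrA; apply: ler_wpM2l => //.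
by rewrite mulr_ge0 ?powR_ge0// mulr_ge0 ?powR_ge0.
Qed.

Variable f : X -> R.
Hypothesis mf : measurable_fun setT f.
Hypothesis f0 : forall x, 0 <= f x.
Hypothesis f_le1 : (\int[mu]_x (f x `^ r x)%:E <= 1)%E.

Let mfr : measurable_fun setT (fun x => f x `^ r x).
Proof. by apply: measurable_powR_var => // x; exact: gt0. Qed.

Let big : set X := [set x | 1 <= f x].

Let measurable_big : measurable big.
Proof.
rewrite -[X in measurable X]setTI; have := mf measurableT (measurable_itv `[1, +oo[).
by congr measurable; apply/seteqP; split=> x /=; rewrite in_itv/= andbT.
Qed.

(** The part f1 of f where f >= 1 is controlled through F = f1^(r/m), which lies
    in L^m and dominates f1^(u/m) for every u <= r. The part f2 where f < 1 is
    integrable to the power roo up to the weight. *)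
Let f1 x := f x * \1_big x.
Let f2 x := f x * \1_(~` big) x.
Let F x := f1 x `^ (r x / m).

Let f1_ge0 x : 0 <= f1 x. Proof. exact: mulr_ge0. Qed.
Let f2_ge0 x : 0 <= f2 x. Proof. exact: mulr_ge0. Qed.
Let F_ge0 x : 0 <= F x. Proof. exact: powR_ge0. Qed.

Let f1P x : (f1 x = f x /\ 1 <= f x) \/ f1 x = 0.
Proof.
rewrite /f1 indicE; case: (boolP (x \in big)) => [/set_mem xb|_]; last by right; rewrite mulr0.
by left; rewrite mulr1.
Qed.

Let f2P x : f2 x <= 1 /\ f2 x <= f x.
Proof.
rewrite /f2 indicE; case: (boolP (x \in ~` big)) => [/set_mem xb|_]; last by rewrite mulr0.
by rewrite mulr1; split=> //; rewrite leNgt; apply/negP => /ltW.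
Qed.

Let f12 x : f x = f1 x + f2 x.
Proof.
rewrite /f1 /f2 -mulrDr !indicE in_setC.
by case: (x \in big); rewrite ?addr0 ?add0r mulr1.
Qed.

Let mf1 : measurable_fun setT f1.
Proof. by apply: measurable_funM => //; exact: measurable_indic. Qed.
Let mf2 : measurable_fun setT f2.
Proof.
by apply: measurable_funM => //; apply: measurable_indic; exact: measurableC.
Qed.
Let mF : measurable_fun setT F.
Proof.
apply: measurable_powR_var => //; first exact: measurable_funM.
by move=> x; rewrite divr_gt0// gt0.
Qed.

Let F_powm x : F x `^ m = f1 x `^ r x.
Proof. by rewrite /F -powRrM divfK// gt_eqF. Qed.

Let F_le_powm x : F x <= F x `^ m.
Proof.
case: (f1P x) => [[fE fx1]|fE]; last first.
  by rewrite /F fE !powR0 ?gt_eqF ?divr_gt0 ?gt0.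
apply: le1r_powR; last exact: ltW.
have <- : 1 `^ (r x / m) = 1 :> R by rewrite powR1.
rewrite /F fE; apply: ge0_ler_powR; rewrite ?nnegrE//.
by rewrite ltW// divr_gt0// gt0.
Qed.

Let f1_frozen (u : R) x : m <= u -> u <= r x -> f1 x `^ (u / m) <= F x.
Proof.
move=> mu' ur; have u0 : 0 < u by exact: lt_le_trans mu'.
have um : u / m != 0 by rewrite gt_eqF// divr_gt0.
have rm : r x / m != 0 by rewrite gt_eqF// divr_gt0// gt0.
rewrite /F; case: (f1P x) => [[fE fx1]|fE].
  by rewrite fE; apply: ler_powR => //; rewrite ler_wpM2r// invr_ge0 ltW.
by rewrite fE (powR0 um) (powR0 rm).
Qed.

Let int_F : (\int[mu]_x (F x `^ m)%:E <= 1)%E.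
Proof.
apply: le_trans f_le1; apply: ge0_le_integral => //.
- by move=> x _; rewrite lee_fin powR_ge0.
- by apply/measurable_EFinP; apply: measurable_powR_var.
- exact/measurable_EFinP.
move=> x _; rewrite lee_fin F_powm; apply: ge0_ler_powR; rewrite ?nnegrE//.
  by rewrite ltW// gt0.
by case: (f1P x) => [[-> _]|->].
Qed.

(** F^m has integral at most 1; the bounds follow from F <= F^m and from
    Jensen's inequality. *)
Let avg_F g x : exists2 a : R, avg mu (EFin \o F) g x = a%:E &
  [/\ 0 <= a, a <= (vol g)^-1 & a <= 2 * vol g `^ (- m^-1)].
Proof.
have F0 : (0 <= avg mu (EFin \o F) g x)%E by apply: avg_ge0 => y; rewrite lee_fin.
have mFm : measurable_fun setT (fun y => F y `^ m) by exact: measurable_powR_var.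
have avgFm : (avg mu (EFin \o (fun y => (F y `^ m)%R)) g x <= ((vol g)^-1)%:E)%E.
  rewrite -[X in X%:E]mul1r; apply: avg_le_integral => //.
    exact/measurable_EFinP.
  by move=> y; rewrite lee_fin powR_ge0.
have F1 : (avg mu (EFin \o F) g x <= ((vol g)^-1)%:E)%E.
  apply: le_trans avgFm; apply: avg_le_avg.
  - exact/measurable_EFinP.
  - exact/measurable_EFinP.
  - by move=> y; rewrite lee_fin.
  - by move=> y; rewrite lee_fin powR_ge0.
  - by apply: aeW => y _; rewrite /= lee_fin; exact: F_le_powm.
have F2 : (avg mu (EFin \o F) g x <= (2 * vol g `^ (- m^-1))%:E)%E.
  have vV : 0 <= (vol g)^-1 by rewrite invr_ge0 vol_ge0.
  apply: (le_trans (avg_jensen mu_haar (ltW m1) mF mFm F_ge0 _ _ vV avgFm)).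
  - by move=> y; exact: powR_ge0.
  - by apply: aeW => y _.
  by rewrite -[X in X^-1](powRr1 (vol_ge0 R p_pr n g)) -powRN -powRrM mulN1r.
pose a := fine (avg mu (EFin \o F) g x).
have aE : avg mu (EFin \o F) g x = a%:E.
  by rewrite fineK// ge0_fin_numE// (le_lt_trans F1)// ltry.
exists a; first exact: aE.
by split; rewrite -lee_fin -aE.
Qed.

Let CA : R := 2 `^ Q * 2 `^ (m * Q) * p%:R `^ (n%:R * (Q * K)).

Let CA_ge : 2 `^ Q <= CA.
Proof.
have Q0 : 0 <= Q by exact: le_trans Q_ge1.
rewrite /CA -mulrA ler_peMr ?powR_ge0//.
have h1 : 1 <= 2 `^ (m * Q) :> R.
  by rewrite -[leLHS](powRr0 2); apply: ler_powR; rewrite ?ler1n// mulr_ge0// ltW.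
have h2 : 1 <= p%:R `^ (n%:R * (Q * K)) :> R.
  by rewrite -[leLHS](powRr0 p%:R); apply: ler_powR; rewrite ?(ltW p1)// !mulr_ge0.
by rewrite -[leLHS]mulr1 ler_pM.
Qed.

(** On balls of radius at most 1, Jensen's inequality bounds the average of f1 by
    a power of that of F, with the frozen exponent of the ball; the estimate
    before applies. On larger balls vol^t avg f1 is at most 1, so the exponent q
    may be lowered to the conjugate of m. *)
Let large_part_bound : {ae mu, forall x, forall g, exists b : R,
  [/\ 0 <= b, (avg mu (EFin \o f1) g x <= b%:E)%E &
  (((vol g `^ t * b) `^ q x)%R%:E <= CA%:E * maxf mu (EFin \o F) x `^ m)%E]}.
Proof.
have small := lhd_small lr; apply: filterS (small) => x Nx g.
have [a aE [a0 a1 a2]] := avg_F g x.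
suff [b [b0 fb bq]] : exists b : R, [/\ 0 <= b,
    (avg mu (EFin \o f1) g x <= b%:E)%E & (vol g `^ t * b) `^ q x <= CA * a `^ m].
  exists b; split=> //; apply: (@le_trans _ _ (CA * a `^ m)%:E); first by rewrite lee_fin.
  rewrite EFinM lee_wpmul2l ?lee_fin// ?(le_trans _ CA_ge)// -poweR_EFin.
  apply: le_poweR; [exact: ltW|by rewrite lee_fin|].
  by rewrite -aE; exact: avg_le_maxf.
have [g0|g0] := lerP g 0.
  have [k gk] : exists k : nat, g = - k%:Z.
    by exists `|g|%N; rewrite abszE ler0_norm// opprK.
  rewrite gk in aE a1 a2 *.
  have [ru rK] := Nx k; have /andP[mu' uM] := lhd_frozen_bounds lr k x.
  exists (2 * a `^ (rho k x / m)^-1); split.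
  - by rewrite mulr_ge0 ?powR_ge0.
  - apply: (avg_jensen mu_haar _ mf1 mF f1_ge0 F_ge0 _ a0) => //; last by rewrite aE.
      by rewrite ler_pdivlMr// mul1r.
    apply: filterS (small) => y Ny xy; rewrite -(lhd_frozen_ball lr xy).
    have [ruy _] := Ny k; apply: f1_frozen => //.
    by have /andP[] := lhd_frozen_bounds lr k y.
  - exact: hedberg_frozen.
exists a; split=> //.
  rewrite -aE; apply: avg_le_avg => //.
  - exact/measurable_EFinP.
  - exact/measurable_EFinP.
  apply: aeW => y _; rewrite lee_fin /F; case: (f1P y) => [[fE fy1]|fE].
    rewrite fE; apply: le1r_powR => //.
    by rewrite ler_pdivlMr// mul1r; have /andP[] := rmM y.
  by rewrite fE powR_ge0.
have v1 : 1 <= vol g.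
  have <- : vol 0 = 1 by rewrite /vol mulr0 powRr0.
  by apply: ler_vol => //; exact: ltW.
have v0 : 0 < vol g by exact: lt_le_trans v1.
have ta0 : 0 <= vol g `^ t * a by rewrite mulr_ge0// powR_ge0.
have ta1 : vol g `^ t * a <= 1.
  apply: (@le_trans _ _ (vol g `^ 1 * (vol g)^-1)).
    rewrite ler_pM ?powR_ge0//; apply: ler_powR => //; exact: ltW.
  by rewrite powRr1 ?(ltW v0)// divff// vol_neq0.
apply: (@le_trans _ _ ((vol g `^ t * a) `^ conj_exp t m)).
  apply: powR_le1_anti; first by rewrite ta0 ta1.
    by apply: lt_le_trans (le_conj hm); exact: m0.
  by rewrite qE conj_le//; have /andP[] := rmM x.
have h2 : 0 <= 2 :> R by [].
apply: (le_trans (hedberg m0 (den hm) v0 (le_conj hm) h2 a0 a2)).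
rewrite ler_wpM2r ?powR_ge0// (le_trans _ CA_ge)//.
apply: ler_powR; first by rewrite ler1n.
by rewrite (@le_trans _ _ (conj_exp t m)) ?gerBl ?(ltW m0)// conj_le.
Qed.

Let K2 : R := p%:R `^ (2 * n%:R * K) + 2.

Let int_f2 : (\int[mu]_x (f2 x `^ roo)%:E <= K2%:E)%E.
Proof.
set P := p%:R `^ (2 * n%:R * K); have P0 : 0 <= P by exact: powR_ge0.
apply: (@le_trans _ _ (\int[mu]_x (P%:E * (f x `^ r x)%:E + shell_weight x))%E).
  apply: ge0_le_integral => //.
  - by move=> x _; rewrite lee_fin powR_ge0.
  - by apply/measurable_EFinP; apply: measurable_powR_var => // x; exact: gt0.
  - apply: emeasurable_funD; last exact: measurable_shell_weight.
    by apply: measurable_funeM; exact/measurable_EFinP.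
  move=> x _; have [k [xk kK]] := shell_exponent lr x.
  have [f21 f2f] := f2P x.
  apply: (@le_trans _ _ (P * f2 x `^ r x + p%:R `^ (- (2 * n%:R * k%:R)))%:E).
    rewrite lee_fin; apply: exponent_exchange => //; first by rewrite f21 f2_ge0.
      exact/ltW/gt1.
    by rewrite distrC.
  rewrite EFinD EFinM; apply: leeD; last exact: shell_weight_ge.
  rewrite lee_wpmul2l ?lee_fin//; apply: ge0_ler_powR; rewrite ?nnegrE//.
  by rewrite ltW// gt0.
rewrite ge0_integralD//; first last.
- exact: measurable_shell_weight.
- by move=> x _; exact: shell_weight_ge0.
- by apply: measurable_funeM; exact/measurable_EFinP.
- by move=> x _; rewrite mule_ge0 ?lee_fin ?powR_ge0.
rewrite ge0_integralZl//; first last.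
- by move=> x _; rewrite lee_fin powR_ge0.
- exact/measurable_EFinP.
rewrite /K2 EFinD; apply: leeD; last exact: integral_shell_weight.
by rewrite -[leRHS]mule1; apply: lee_wpmul2l; [rewrite lee_fin|exact: f_le1].
Qed.

Let c2 : R := 2 * K2 `^ roo^-1.
Let Kq : R := Q ^+ 2 * K.
Let CB : R := c2 `^ Q * p%:R `^ (2 * n%:R * Kq) * c2 `^ Q + c2 `^ Q.

Let K2_ge1 : 1 <= K2.
Proof. by rewrite /K2 -[leLHS]add0r lerD ?powR_ge0 ?ler1n. Qed.

Let c2_ge1 : 1 <= c2.
Proof.
have h : 1 <= K2 `^ roo^-1.
  have e1 : 1 `^ roo^-1 = 1 :> R by rewrite powR1.
  rewrite -[leLHS]e1; apply: ge0_ler_powR; rewrite ?nnegrE//.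
    by rewrite invr_ge0 ltW// gt0.
  exact: le_trans K2_ge1.
by rewrite /c2 (le_trans h)// ler_peMl ?ler1n// (le_trans _ h).
Qed.

Let CB_ge0 : 0 <= CB.
Proof. by rewrite /CB addr_ge0 ?mulr_ge0 ?powR_ge0. Qed.

(** Hedberg's trick with exponent roo bounds a power of vol^t avg f2 with
    exponent conjugate to roo; as vol^t avg f2 is at most c2, this exponent may
    be exchanged for q at the cost of the weight. *)
Let small_part_bound x g : exists b : R,
  [/\ 0 <= b, (avg mu (EFin \o f2) g x <= b%:E)%E &
  (((vol g `^ t * b) `^ q x)%R%:E <=
     CB%:E * (maxf mu (EFin \o f2) x `^ roo + shell_weight x))%E].
Proof.
have v0 : 0 < vol g by exact: vol_gt0.
have roo0 : 0 < roo by exact: gt0.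
have mf2r : measurable_fun setT (fun y => f2 y `^ roo) by exact: measurable_powR_var.
have A0 : (0 <= avg mu (EFin \o f2) g x)%E by apply: avg_ge0 => y; rewrite lee_fin.
have A1 : (avg mu (EFin \o f2) g x <= 1%:E)%E.
  rewrite -[leRHS](avg_cst mu_haar 1 g x); apply: avg_le_avg => //.
  - exact/measurable_EFinP.
  - by apply: aeW => y _; rewrite /= lee_fin; have [] := f2P y.
pose a := fine (avg mu (EFin \o f2) g x).
have aE : avg mu (EFin \o f2) g x = a%:E.
  by rewrite fineK// ge0_fin_numE// (le_lt_trans A1)// ltry.
have a0 : 0 <= a by rewrite -lee_fin -aE.
have a1 : a <= 1 by rewrite -lee_fin -aE.
have K20 : 0 <= K2 by exact: le_trans K2_ge1.
have iv0 : 0 <= (vol g)^-1 by rewrite invr_ge0 ltW.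
have a2 : a <= c2 * vol g `^ (- roo^-1).
  rewrite -lee_fin -aE.
  have E : c2 * vol g `^ (- roo^-1) = 2 * (K2 / vol g) `^ roo^-1.
    rewrite powRM// /c2 -mulrA; congr (_ * (_ * _)).
    by rewrite -[X in _ = X^-1 `^ _](powRr1 (ltW v0)) -powRN -powRrM mulN1r.
  rewrite E; apply: (avg_jensen mu_haar _ mf2 mf2r f2_ge0) => //.
  - by apply/ltW/gt1.
  - by move=> y; exact: powR_ge0.
  - by apply: aeW.
  - by rewrite mulr_ge0.
  apply: avg_le_integral => //; first exact/measurable_EFinP.
  by move=> y; rewrite lee_fin powR_ge0.
exists a; split=> //; first by rewrite aE.
set T := vol g `^ t * a.
have T0 : 0 <= T by rewrite mulr_ge0// powR_ge0.
have c20 : 0 < c2 by exact: lt_le_trans c2_ge1.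
have Tc : T <= c2.
  have [v1|/ltW v1] := leP (vol g) 1.
    apply: (le_trans _ c2_ge1); rewrite -[leRHS]mulr1 ler_pM ?powR_ge0//.
    by rewrite -[leRHS](powRr0 (vol g)); apply: ger_powR; rewrite ?v0.
  apply: (@le_trans _ _ (vol g `^ t * (c2 * vol g `^ (- roo^-1)))).
    by rewrite ler_wpM2l ?powR_ge0.
  rewrite mulrCA -powRD ?(gt_eqF v0) ?implybT// ger_pMr//.
  rewrite -[leRHS](powRr0 (vol g)); apply: ler_powR => //.
  by rewrite subr_le0 -subr_ge0 ltW// den.
have q0 : 0 < q x by exact: lt_le_trans (q_ge1 x).
have lq := log_hoelder_data_conj lr t_ge0 Mt qE.
set qoo := conj_exp t roo in lq.
have qooQ : qoo <= Q by rewrite conj_le//; have /andP[] := roomM.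
have qoo0 : 0 < qoo by apply: lt_le_trans (le_conj roomM).
have [k [xk kK]] := shell_exponent lq x.
have Tc1 : 0 <= T / c2 <= 1.
  by rewrite divr_ge0 ?(ltW c20)//= ler_pdivrMr// mul1r.
have hT := hedberg roo0 (den roomM) v0 (le_conj roomM) (ltW c20) a0 a2.
have ex := exponent_exchange p_pr n Tc1 (q_ge1 x) kK.
have TqE : T `^ q x = c2 `^ q x * (T / c2) `^ q x.
  have Tc0 : 0 <= T / c2 by have /andP[] := Tc1.
  by rewrite -(powRM _ (ltW c20) Tc0) mulrCA divff ?mulr1// gt_eqF.
have cQ e : e <= Q -> c2 `^ e <= c2 `^ Q by exact: ler_powR.
pose P : R := p%:R `^ (2 * n%:R * Kq); pose w : R := p%:R `^ (- (2 * n%:R * k%:R)).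
have P0 : 0 <= P by exact: powR_ge0.
have w0 : 0 <= w by exact: powR_ge0.
have TQ : (T / c2) `^ qoo <= c2 `^ Q * a `^ roo.
  apply: (@le_trans _ _ (T `^ qoo)).
    apply: ge0_ler_powR; rewrite ?nnegrE ?(ltW qoo0)//; first by have /andP[] := Tc1.
    by rewrite ler_pdivrMr// ler_peMr.
  apply: (le_trans hT); rewrite ler_wpM2r ?powR_ge0// cQ//.
  by rewrite (le_trans _ qooQ)// gerBl ltW.
have key : T `^ q x <= CB * (a `^ roo + w).
  rewrite TqE; apply: (@le_trans _ _ (c2 `^ Q * (P * (c2 `^ Q * a `^ roo) + w))).
    apply: ler_pM; [exact: powR_ge0|exact: powR_ge0|exact: cQ|].
    by apply: (le_trans ex); rewrite lerD2r ler_wpM2l.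
  have expand (c1 c3 y z : R) : 0 <= c1 -> 0 <= c3 -> 0 <= y -> 0 <= z ->
      c1 * (c3 * (c1 * y) + z) <= (c1 * c3 * c1 + c1) * (y + z).
    move=> c10 c30 y0 z0; have -> : (c1 * c3 * c1 + c1) * (y + z) =
        c1 * (c3 * (c1 * y) + z) + (c1 * y + c1 * c3 * c1 * z) by ring.
    by rewrite lerDl addr_ge0 ?mulr_ge0.
  by apply: expand => //; exact: powR_ge0.
apply: (@le_trans _ _ (CB * (a `^ roo + w))%:E); first by rewrite lee_fin.
rewrite EFinM lee_wpmul2l ?lee_fin// EFinD; apply: leeD; last exact: shell_weight_ge.
rewrite -poweR_EFin; apply: le_poweR; [exact: ltW|by rewrite lee_fin|].
by rewrite -aE; exact: avg_le_maxf.
Qed.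

Let CA_ge0 : 0 <= CA.
Proof. by apply: le_trans CA_ge; exact: powR_ge0. Qed.

Let Ctot : R := 2 `^ Q * (CA + CB).

Let Ctot_ge0 : 0 <= Ctot.
Proof. by apply: mulr_ge0; [exact: powR_ge0|exact: addr_ge0]. Qed.

Let fmax_bound : {ae mu, forall x, (fmax t (EFin \o f) x `^ q x <=
  Ctot%:E * (maxf mu (EFin \o F) x `^ m +
             (maxf mu (EFin \o f2) x `^ roo + shell_weight x)))%E}.
Proof.
apply: filterS large_part_bound => x Ax; set H := (X in (_ <= X)%E).
have H0 : (0 <= H)%E.
  rewrite mule_ge0 ?lee_fin//.
  by rewrite adde_ge0 ?poweR_ge0// adde_ge0 ?poweR_ge0// shell_weight_ge0.
have q0 : 0 < q x by exact: lt_le_trans (q_ge1 x).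
have fg g : ((vol g `^ t)%:E * avg mu (EFin \o f) g x <= H `^ (q x)^-1)%E.
  have [b1 [b10 fb1 h1]] := Ax g; have [b2 [b20 fb2 h2]] := small_part_bound x g.
  set v := vol g `^ t in h1 h2 *; have v0 : 0 <= v by exact: powR_ge0.
  have fE : (avg mu (EFin \o f) g x <= (b1 + b2)%:E)%E.
    have -> : EFin \o f = (fun y => (EFin \o f1) y + (EFin \o f2) y)%E.
      by apply/funext => y /=; rewrite f12 EFinD.
    rewrite avgD; first by rewrite EFinD leeD.
    - exact/measurable_EFinP.
    - exact/measurable_EFinP.
    - by move=> y; rewrite lee_fin.
    - by move=> y; rewrite lee_fin.
  apply: (@le_trans _ _ (v * b1 + v * b2)%:E).
    by rewrite -mulrDr EFinM lee_wpmul2l ?lee_fin.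
  set s := v * b1 + v * b2; have s0 : 0 <= s by rewrite addr_ge0 ?mulr_ge0.
  have -> : s%:E = (s%:E `^ q x `^ (q x)^-1)%E.
    by rewrite -poweRrM divff ?gt_eqF// poweRe1.
  have iq : 0 <= (q x)^-1 by rewrite invr_ge0 ltW.
  apply: le_poweR => //; first exact: poweR_ge0.
  rewrite poweR_EFin; apply: (@le_trans _ _ (2 `^ Q * ((v * b1) `^ q x + (v * b2) `^ q x))%:E).
    by rewrite lee_fin; apply: powRD_le; rewrite ?mulr_ge0// ltW.
  rewrite /H /Ctot (EFinM (2 `^ Q) (CA + CB)) -muleA EFinM lee_wpmul2l ?lee_fin ?powR_ge0//.
  set MA := (maxf mu (EFin \o F) x `^ m)%E in h1 *.
  set MB := (maxf mu (EFin \o f2) x `^ roo + shell_weight x)%E in h2 *.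
  have MA0 : (0 <= MA)%E by exact: poweR_ge0.
  have MB0 : (0 <= MB)%E by rewrite adde_ge0 ?poweR_ge0// shell_weight_ge0.
  rewrite EFinD [leRHS]ge0_muleDr//; apply: leeD.
    by apply: (le_trans h1); rewrite lee_wpmul2r// lee_fin lerDl.
  by apply: (le_trans h2); rewrite lee_wpmul2r// lee_fin lerDr.
have -> : H = (H `^ (q x)^-1 `^ q x)%E.
  by rewrite -poweRrM mulVf ?gt_eqF// poweRe1.
apply: le_poweR; [exact: ltW|by apply: fmax_ge0 => y; rewrite lee_fin|].
by apply: ge_ereal_sup => _ [g _ <-].
Qed.

Lemma modular_fmax (Cm Coo : R) : 0 <= Cm -> 0 <= Coo ->
  (forall h : X -> R, measurable_fun setT h -> (forall x, 0 <= h x) ->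
    (\int[mu]_x (maxf mu (EFin \o h) x `^ m) <= Cm%:E * \int[mu]_x (h x `^ m)%:E)%E) ->
  (forall h : X -> R, measurable_fun setT h -> (forall x, 0 <= h x) ->
    (\int[mu]_x (maxf mu (EFin \o h) x `^ roo) <= Coo%:E * \int[mu]_x (h x `^ roo)%:E)%E) ->
  (modular mu q (fmax t (EFin \o f)) 1 <= (Ctot * (Cm + (Coo * K2 + 2)))%:E)%E.
Proof.
move=> Cm0 Coo0 hm' hoo.
have q0 x : 0 < q x by exact: lt_le_trans (q_ge1 x).
pose W1 x := (maxf mu (EFin \o F) x `^ m)%E.
pose W2 x := (maxf mu (EFin \o f2) x `^ roo)%E.
have mW1 : measurable_fun setT W1.
  apply: (@measurable_poweR_var _ _ _ _ (cst m)) => //; first exact: measurable_maxf.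
  by move=> x; apply: maxf_ge0 => y; rewrite lee_fin.
have mW2 : measurable_fun setT W2.
  apply: (@measurable_poweR_var _ _ _ _ (cst roo)) => //; first exact: measurable_maxf.
    by move=> x; apply: maxf_ge0 => y; rewrite lee_fin.
  by move=> x; exact: gt0.
have W10 x : (0 <= W1 x)%E by exact: poweR_ge0.
have W20 x : (0 <= W2 x)%E by exact: poweR_ge0.
have mW23 : measurable_fun setT (fun x => W2 x + shell_weight x)%E.
  by apply: emeasurable_funD => //; exact: measurable_shell_weight.
have W230 x : (0 <= W2 x + shell_weight x)%E by rewrite adde_ge0// shell_weight_ge0.
apply: (@le_trans _ _ (\int[mu]_x (Ctot%:E * (W1 x + (W2 x + shell_weight x))))%E).
  apply: ae_ge0_le_integral => //.
  - by move=> x _; exact: poweR_ge0.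
  - by apply: measurable_modular => //; exact: measurable_fmax.
  - by move=> x _; rewrite mule_ge0 ?lee_fin// adde_ge0.
  - by apply: measurable_funeM; exact: emeasurable_funD.
  apply: filterS fmax_bound => x hx _; rewrite invr1 mule1 gee0_abs//.
  by apply: fmax_ge0 => y; rewrite lee_fin.
rewrite ge0_integralZl//; first last.
- by move=> x _; rewrite adde_ge0.
- exact: emeasurable_funD.
rewrite [leRHS]EFinM; apply: lee_wpmul2l; first by rewrite lee_fin.
rewrite ge0_integralD// ge0_integralD//; first last.
- exact: measurable_shell_weight.
- by move=> x _; exact: shell_weight_ge0.
rewrite !EFinD; apply: leeD; last apply: leeD.
- apply: (le_trans (hm' _ mF F_ge0)); rewrite -[leRHS]mule1.
  by rewrite lee_wpmul2l ?lee_fin.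
- by apply: (le_trans (hoo _ mf2 f2_ge0)); rewrite EFinM lee_wpmul2l ?lee_fin.
- exact: integral_shell_weight.
Qed.

End MainEstimate.

(** The Sobolev-type inequality for variable exponents: the constant depends on
    the exponents only. *)
Lemma fmax_modular (t : R) (r q : X -> R) : 0 <= t ->
  measurable_fun setT r -> measurable_fun setT q ->
  log_exponent_class mu r -> (forall M : R, ess_sup_on mu setT r = M%:E -> M * t < 1) ->
  (forall x, q x = conj_exp t (r x)) ->
  exists2 D : R, 0 < D & forall f : X -> R, measurable_fun setT f ->
    (forall x, 0 <= f x) -> (\int[mu]_x (f x `^ r x)%:E <= 1)%E ->
    (modular mu q (fmax t (EFin \o f)) D <= 1)%E.
Proof.
move=> t0 mr mq lr hM qE.
have [m [M [K [rho [roo [lrd Msup]]]]]] := log_hoelder_dataP mu_haar lr.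
have Mt := hM _ Msup; have m1 := lhd_gt1 lrd.
have /andP[mroo rooM] := lhd_infty_bounds lrd.
have [Cm Cm0 hm] := maxf_bounded mu_haar n_gt0 m1.
have [Coo Coo0 hoo] := maxf_bounded mu_haar n_gt0 (lt_le_trans m1 mroo).
have q1 x : 1 <= q x.
  have mxM := lhd_bounds lrd x; have /andP[mx _] := mxM.
  by rewrite qE (le_trans _ (le_conj_exp t0 m1 Mt mxM))// (le_trans (ltW m1)).
have [D main] : exists D : R, forall f : X -> R, measurable_fun setT f ->
    (forall x, 0 <= f x) -> (\int[mu]_x (f x `^ r x)%:E <= 1)%E ->
    (modular mu q (fmax t (EFin \o f)) 1 <= D%:E)%E.
  eexists => f mf f0 f1.
  exact: (@modular_fmax t r q m M K rho roo mr mq lrd t0 Mt qE f mf f0 f1 _ _ Cm0 Coo0 hm hoo).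
exists (Num.max 1 D); first by rewrite lt_max ltr01.
move=> f mf f0 f1; have k1 : 1 <= Num.max 1 D by rewrite le_max lexx.
have k0 : 0 < Num.max 1 D by exact: lt_le_trans k1.
have sc := modular_scale mu mq q1 k1 ltr01 (@measurable_fmax t (EFin \o f)).
rewrite mulr1 in sc; apply: (le_trans sc).
rewrite lee_pdivrMl// mule1 (le_trans (main f mf f0 f1))// lee_fin.
by rewrite le_max lexx orbT.
Qed.
End FractionalMaximal.

(** * The equivalence *)

Section Equivalence.
Variables (R : realType) (p : nat) (p_pr : prime p) (n : nat).
Local Notation V := 'rV[Qp p_pr]_n.
Local Notation X := (padic_space R p_pr n).
Local Notation B := (@pball R p p_pr n).
Local Notation vol := (@vol R p n).
Variable mu : {measure set X -> \bar R}.
Hypothesis mu_haar : is_haar_measure mu.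
Hypothesis n_gt0 : (0 < n)%N.
Implicit Types (q r : X -> R) (x y a : X) (g : int).

Let p0 : 0 < p%:R :> R. Proof. exact: prime_gt0R. Qed.
Let p1 : 1 < p%:R :> R. Proof. exact: prime_gt1R. Qed.
Let nR0 : 0 < n%:R :> R. Proof. by rewrite ltr0n. Qed.

(** ** Admissible exponents *)

Lemma admissible_conj_exp (s : R) r q : 0 < s -> admissible_exponents mu s r q ->
  [/\ measurable_fun setT r, measurable_fun setT q, log_exponent_class mu r,
      forall M : R, ess_sup_on mu setT r = M%:E -> M * (s / n%:R) < 1 &
      forall x, q x = conj_exp (s / n%:R) (r x)].
Proof.
move=> s0 [lr lq [mr _ _ _ _] rs qr]; split=> //.
- by have [[]] := lq.
- move=> M ME; move: rs; rewrite ME lte_fin => Ms.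
  by rewrite mulrA ltr_pdivrMr// mul1r -ltr_pdivlMr.
- by move=> x; have := qr x; rewrite !div1r /conj_exp => <-; rewrite invrK.
Qed.

Lemma ess_inf_on_cst (c : R) g a (D : set X) : B g a `<=` D ->
  ess_inf_on mu D (cst c) = c%:E.
Proof.
move=> BD; apply/le_anti/andP; split; last first.
  by apply: ereal_sup_ubound => /=; apply: aeW => x _.
apply: ge_ereal_sup => e /= he.
have hB : {ae mu, forall x, B g a x -> (e <= c%:E)%E} by apply: filterS he => x + /BD.
by have [] := ball_ae_nonempty mu_haar hB.
Qed.

Lemma ess_sup_on_cst (c : R) g a (D : set X) : B g a `<=` D ->
  ess_sup_on mu D (cst c) = c%:E.
Proof.
move=> BD; apply/le_anti/andP; split.
  by apply: ereal_inf_lbound => /=; apply: aeW => x _.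
apply: le_ereal_inf_tmp => e /= he.
have hB : {ae mu, forall x, B g a x -> (c%:E <= e)%E} by apply: filterS he => x + /BD.
by have [] := ball_ae_nonempty mu_haar hB.
Qed.

Lemma log_exponent_class_cst (c : R) : 1 < c -> log_exponent_class mu (cst c).
Proof.
move=> c1; have BT : B 0 (0 : V) `<=` setT by [].
split; first split=> //.
- by rewrite (ess_inf_on_cst c BT) lte_fin.
- by move=> x; rewrite (ess_inf_on_cst c BT) (ess_sup_on_cst c BT) lexx.
- by rewrite (ess_sup_on_cst c BT) ltry.
exists 1; split=> // [g x|x y].
  rewrite pballE (ess_inf_on_cst c (@subset_refl _ (B g x))).
  by rewrite (ess_sup_on_cst c (@subset_refl _ (B g x))) -EFinB subrr mule0 lee_fin.
rewrite subrr normr0 mul1r invr_ge0 divr_ge0 ?ln_ge0 ?(ltW p1)//.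
by rewrite (le_trans (ltW p1))// lerDl le_min !padic_norm_ge0.
Qed.

(** Any constant r between 1 and n / s will do. *)
Lemma admissible_exponents_exist (s : R) : 0 < s -> s < n%:R ->
  exists r q, admissible_exponents mu s r q.
Proof.
move=> s0 sn; have ns : 1 < n%:R / s by rewrite ltr_pdivlMr// mul1r.
pose c := (1 + n%:R / s) / 2.
have c1 : 1 < c by rewrite /c; lra.
have cs : c < n%:R / s by rewrite /c; lra.
have ct : c * (s / n%:R) < 1 by rewrite mulrA ltr_pdivrMr// mul1r -ltr_pdivlMr.
have t0 : 0 <= s / n%:R by rewrite divr_ge0// ltW.
have cc : c <= c <= c by rewrite lexx.
have q1 : 1 < conj_exp (s / n%:R) c by rewrite (lt_le_trans c1)// (le_conj_exp t0 c1 ct cc).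
exists (cst c), (cst (conj_exp (s / n%:R) c)); split.
- exact: log_exponent_class_cst.
- exact: log_exponent_class_cst.
- by have [] := log_exponent_class_cst c1.
- by rewrite (@ess_sup_on_cst c 0 (0 : V)) ?lte_fin.
- by move=> x; rewrite /= !div1r /conj_exp invrK.
Qed.

(** ** From the Lipschitz condition to the commutator *)

Variable b : X -> R.
Hypothesis b_loc : padic_locally_integrable mu b.

Let mb : measurable_fun setT b := locally_integrable_measurable b_loc.

Let haar_sigma_finite : sigma_finite setT mu.
Proof.
exists (fun k : nat => B k (0 : V)); first by rewrite bigcup_ball0.
by move=> k; split; [exact: measurable_pball|rewrite volE// ltry].
Qed.

(** As x varies in a ball, the integral over that ball depends on x only through
    b x, and it is a measurable function of this value by Tonelli's theorem. *)
Lemma measurable_max_commutator (alpha : R) (f : X -> R) : measurable_fun setT f ->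
  measurable_fun setT (max_commutator mu alpha b f).
Proof.
move=> mf; apply: measurable_fun_int_sup => g.
have -> : (fun x : X => ((haar_volume mu g (x : V) `^ (-1 + alpha / n%:R))%:E *
     \int[mu]_(y in padic_ball R g (x : V)) (`|b x - b y| * `|f y|)%:E)%E) =
  (fun x : X => ((vol g `^ (-1 + alpha / n%:R))%:E *
     \int[mu]_(y in B g x) (`|b x - b y| * `|f y|)%:E)%E).
  by apply/funext => x; rewrite haar_volumeE// pballE.
apply: measurable_funeM.
have sfin := sfinite_measure_sigma_finite haar_sigma_finite.
pose H1 := isSFinite.Build _ _ _ (mu : set X -> \bar R) sfin.
pose H2 := isSigmaFinite.Build _ _ _ (mu : set X -> \bar R) haar_sigma_finite.
pose nu : {sigma_finite_measure set X -> \bar R} := HB.pack (Measure.sort mu) H1 H2.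
have mh (E : set X) : measurable E ->
    measurable_fun setT (fun t : R => \int[mu]_(y in E) (`|t - b y| * `|f y|)%:E)%E.
  move=> mE.
  have -> : (fun t : R => \int[mu]_(y in E) (`|t - b y| * `|f y|)%:E)%E =
      (fun t : R => \int[nu]_y (`|t - b y| * `|f y| * \1_E y)%:E)%E.
    apply/funext => t; rewrite integral_mkcond; apply: eq_integral => y _.
    by rewrite patchE indicE; case: ifP => _; rewrite ?mulr1 ?mulr0.
  apply: (@measurable_fun_fubini_tonelli_F _ _ _ _ _ nu
    (fun z : R * X => (`|z.1 - b z.2| * `|f z.2| * \1_E z.2)%:E)).
    apply/measurable_EFinP; apply: measurable_funM; first apply: measurable_funM.
    - apply: measurableT_comp => //; apply: measurable_funB => //.
      exact: measurableT_comp.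
    - by apply: measurableT_comp => //; exact: measurableT_comp.
    - by apply: measurableT_comp => //; exact: measurable_indic.
  by move=> z; rewrite lee_fin !mulr_ge0.
have -> : [set: X] = \bigcup_i B g (rat_center p_pr n i).
  by apply/seteqP; split=> // x _; have [i ix] := rat_center_dense g x; exists i.
apply/measurable_fun_bigcup => [i|i]; first exact: measurable_pball.
set E := B g _.
apply: (@eq_measurable_fun _ _ _ _ _
    (fun x => \int[mu]_(y in E) (`|b x - b y| * `|f y|)%:E)%E).
  by move=> x /set_mem xE; rewrite /E (pball_eq xE).
apply: measurable_funTS.
by apply: (measurableT_comp (mh E _)) => //; exact: measurable_pball.
Qed.

Section Lipschitz.
Variables (alpha beta L : R) (f0 : X -> R).
Hypotheses (L_gt0 : 0 < L) (bf : {ae mu, forall x, b x = f0 x}).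
Hypothesis f0L : forall g a x y, B g a x -> B g a y ->
  `|f0 x - f0 y| <= L * p%:R `^ (g%:~R * beta).

(** On a ball of radius p^g the oscillation of b is at most L p^(g beta), and
    p^(g beta) is the volume to the power beta / n: the commutator of order alpha
    is dominated by the fractional maximal operator of order alpha + beta. *)
Lemma max_commutator_le_fmax (f h : X -> R) (eta : R) : 0 < eta ->
  measurable_fun setT f -> measurable_fun setT h -> (forall x, 0 <= h x) ->
  (forall x, `|f x| = eta * h x) ->
  {ae mu, forall x, (max_commutator mu alpha b f x <=
    (L * eta)%:E * fmax mu ((alpha + beta) / n%:R) (EFin \o h) x)%E}.
Proof.
move=> eta0 mf mh h0 fh; apply: filterS (bf) => x bx.
apply: ge_ereal_sup => _ [g _ <-]; rewrite haar_volumeE// pballE.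
have Leta : 0 <= L * eta by rewrite mulr_ge0// ltW.
set rg : R := p%:R `^ (g%:~R * beta).
have rg0 : 0 <= rg by exact: powR_ge0.
have mh' : measurable_fun setT (EFin \o h) by exact/measurable_EFinP.
have int_le : (\int[mu]_(y in B g x) (`|b x - b y| * `|f y|)%:E <=
    (L * rg * eta)%:E * \int[mu]_(y in B g x) (h y)%:E)%E.
  rewrite -ge0_integralZl; last by rewrite lee_fin !mulr_ge0// ltW.
  - apply: ae_ge0_le_integral.
    + exact: measurable_pball.
    + by move=> y _; rewrite lee_fin mulr_ge0.
    + apply: measurable_funTS; apply/measurable_EFinP; apply: measurable_funM.
        by apply: measurableT_comp => //; exact: measurable_funB.
      exact: measurableT_comp.
    + by move=> y _; rewrite -EFinM lee_fin !mulr_ge0// ltW.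
    + by apply: measurable_funTS; exact: measurable_funeM.
    apply: filterS (bf) => y by' xy; rewrite -EFinM lee_fin fh mulrA ler_wpM2r//.
    by rewrite ler_wpM2r ?(ltW eta0)// bx by'; apply: f0L xy; exact: pball_center.
  - exact: measurable_pball.
  - exact: measurable_funTS.
  - by move=> y _; rewrite lee_fin.
have v0 : 0 < vol g by exact: vol_gt0.
apply: (@le_trans _ _ ((L * eta)%:E *
    ((vol g `^ ((alpha + beta) / n%:R))%:E * avg mu (EFin \o h) g x))%E); last first.
  by rewrite lee_wpmul2l ?lee_fin//; apply: ereal_sup_ubound; exists g.
apply: (@le_trans _ _ ((vol g `^ (-1 + alpha / n%:R))%:E *
    ((L * rg * eta)%:E * \int[mu]_(y in B g x) (h y)%:E))%E).
  by rewrite lee_wpmul2l ?lee_fin ?powR_ge0.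
rewrite /avg !muleA -!EFinM le_eqVlt; apply/orP; left; apply/eqP; congr (_%:E * _)%E.
have -> : rg = vol g `^ (beta / n%:R).
  by rewrite vol_powR /rg; congr (_ `^ _); field; rewrite gt_eqF.
have -> : vol g `^ ((alpha + beta) / n%:R) =
    vol g * (vol g `^ (-1 + alpha / n%:R) * vol g `^ (beta / n%:R)).
  rewrite -[X in _ = X * _](powRr1 (ltW v0)) -!powRD ?(gt_eqF v0) ?implybT//.
  by congr (_ `^ _); field; rewrite gt_eqF.
by field; rewrite gt_eqF.
Qed.

Lemma lipschitz_bounded_commutator r q :
  0 <= (alpha + beta) / n%:R ->
  measurable_fun setT r -> measurable_fun setT q ->
  log_exponent_class mu r ->
  (forall M : R, ess_sup_on mu setT r = M%:E -> M * ((alpha + beta) / n%:R) < 1) ->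
  (forall x, q x = conj_exp ((alpha + beta) / n%:R) (r x)) ->
  (forall x, 1 <= r x) -> (forall x, 1 <= q x) ->
  bounded_Lvar mu r q (max_commutator mu alpha b).
Proof.
move=> t0 mr mq lr hM qE r1 q1.
have [D D0 hD] := fmax_modular mu_haar n_gt0 t0 mr mq lr hM qE.
have key f (eta : R) : measurable_fun setT f -> 0 < eta ->
    (modular mu r (EFin \o f) eta <= 1)%E ->
    (modular mu q (max_commutator mu alpha b f) (L * D * eta) <= 1)%E.
  move=> mf eta0 f1; pose h x := `|f x| / eta.
  have h0 x : 0 <= h x by rewrite divr_ge0// ltW.
  have mh : measurable_fun setT h by apply: measurable_funM => //; exact: measurableT_comp.
  have fh x : `|f x| = eta * h x by rewrite /h mulrC divfK// gt_eqF.
  have h1 : (\int[mu]_x (h x `^ r x)%:E <= 1)%E.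
    by apply: le_trans f1; rewrite /modular; under eq_integral do rewrite -poweR_EFin EFinM.
  rewrite [L * D * eta]mulrAC.
  have LE : 0 < L * eta by exact: mulr_gt0.
  have mM := measurable_max_commutator alpha mf.
  have mF := @measurable_fmax R p p_pr n mu ((alpha + beta) / n%:R) (EFin \o h).
  apply: le_trans (hD h mh h0 h1); apply: modular_dom => //.
  apply: filterS (max_commutator_le_fmax eta0 mf mh h0 fh) => x hx.
  by rewrite !gee0_abs//; [apply: fmax_ge0 => y; rewrite lee_fin|exact: max_commutator_ge0].
have c0 : 0 < L * D by exact: mulr_gt0.
exists (L * D) => f [/measurable_EFinP mf [eta [eta0 feta]]]; split.
  have mEf : measurable_fun setT (EFin \o f) by exact/measurable_EFinP.
  have [eta' eta'0 f1] := modular_fin_le1 mr r1 eta0 mEf feta.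
  split; first exact: measurable_max_commutator.
  exists (L * D * eta'); split; first exact: mulr_gt0.
  by rewrite (le_lt_trans (key f eta' mf eta'0 f1))// ltry.
apply: Lvar_norm_bound => // e e0 f1; apply: Lvar_norm_le; first exact: mulr_gt0.
exact: key.
Qed.

End Lipschitz.

(** ** From the commutator to the oscillation *)

(** The commutator is tested on characteristic functions of balls, whose norms
    are comparable to powers of the volume. The frozen exponents satisfy
    1/u - 1/conj_exp t u = (alpha + beta) / n, so that the volumes combine to the
    power beta / n. *)
Lemma bounded_commutator_oscillation (alpha beta : R) r q :
  0 <= (alpha + beta) / n%:R ->
  measurable_fun setT r -> measurable_fun setT q ->
  log_exponent_class mu r ->
  (forall M : R, ess_sup_on mu setT r = M%:E -> M * ((alpha + beta) / n%:R) < 1) ->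
  (forall x, q x = conj_exp ((alpha + beta) / n%:R) (r x)) ->
  (forall x, 1 <= r x) -> (forall x, 1 <= q x) ->
  bounded_Lvar mu r q (max_commutator mu alpha b) ->
  (oscillation_sup mu beta b q < +oo)%E.
Proof.
set t := (alpha + beta) / n%:R => t0 mr mq lr hM qE r1 q1 [C hC].
have [m [M [K [rho [roo [lrd Msup]]]]]] := log_hoelder_dataP mu_haar lr.
have Mt := hM _ Msup.
have lq := log_hoelder_data_conj lrd t0 Mt qE.
have [Cr Cr0 upper] := indic_modular_le1 mu_haar n_gt0 mr lrd.
have [c [C' [c0 _ chiq]]] := chi_norm_bounds mu_haar n_gt0 mq lq.
apply: (oscillation_supP mu_haar n_gt0 b beta mq lq).2.
pose C1 := Num.max 1 C; have C10 : 0 < C1 by rewrite lt_max ltr01.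
exists (C1 * Cr / c); first by rewrite !mulr_gt0// invr_gt0.
move=> g a; have v0 : 0 < vol g by exact: vol_gt0.
set u := frozen rho roo g a.
have uE : frozen (fun k x => conj_exp t (rho k x)) (conj_exp t roo) g a = conj_exp t u.
  by rewrite /u /frozen; case: ifP.
have [tq chiE] := chiq g a; rewrite uE => /andP[tqc _].
have chi1 := upper g a; rewrite -/u in chi1.
have eta0 : 0 < Cr * vol g `^ u^-1 by rewrite mulr_gt0// powR_gt0.
have chi_in : in_Lvar mu r (EFin \o (\1_(B g a) : X -> R)).
  split; first exact: measurable_chi.
  by exists (Cr * vol g `^ u^-1); split=> //; rewrite (le_lt_trans chi1)// ltry.
have [[mM _] hMC] := hC _ chi_in.
have normM : (Lvar_norm mu q (max_commutator mu alpha b (\1_(B g a))) <=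
    (C1 * (Cr * vol g `^ u^-1))%:E)%E.
  apply: (le_trans hMC); apply: (@le_trans _ _ (C1%:E *
      Lvar_norm mu r (EFin \o (\1_(B g a) : X -> R)))%E).
    by rewrite lee_wpmul2r ?Lvar_norm_ge0// lee_fin le_max lexx orbT.
  rewrite EFinM lee_wpmul2l ?lee_fin ?(ltW C10)//.
  exact: Lvar_norm_le chi1.
have w0 : 0 < (vol g `^ (alpha / n%:R))^-1 by rewrite invr_gt0 powR_gt0.
apply: (@le_trans _ _ (((vol g `^ (alpha / n%:R))^-1)%:E *
    Lvar_norm mu q (max_commutator mu alpha b (\1_(B g a))))%E).
  apply: Lvar_norm_bound => // e e0 e1; apply: Lvar_norm_le; first exact: mulr_gt0.
  apply: (le_trans _ e1); apply: modular_dom => //.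
    by apply/measurable_EFinP; exact: measurable_osc_fun.
  apply: aeW => x; rewrite (gee0_abs (max_commutator_ge0 _ _ _ _ _)).
  rewrite lee_pdivlMl ?powR_gt0//= -EFinM.
  exact: max_commutator_indic.
apply: (@le_trans _ _ (((vol g `^ (alpha / n%:R))^-1)%:E * (C1 * (Cr * vol g `^ u^-1))%:E)%E).
  by rewrite lee_wpmul2l ?lee_fin ?(ltW w0).
rewrite chiE -!EFinM lee_fin.
apply: (@le_trans _ _ (C1 * Cr / c * p%:R `^ (g%:~R * beta) * (c * vol g `^ (conj_exp t u)^-1))).
  rewrite le_eqVlt; apply/orP; left; apply/eqP.
  have -> : p%:R `^ (g%:~R * beta) = vol g `^ (beta / n%:R).
    by rewrite vol_powR; congr (_ `^ _); field; rewrite gt_eqF.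
  have -> : vol g `^ u^-1 =
      vol g `^ (alpha / n%:R) * (vol g `^ (beta / n%:R) * vol g `^ (conj_exp t u)^-1).
    rewrite -!powRD ?(gt_eqF v0) ?implybT// /conj_exp invrK /t.
    by congr (_ `^ _); ring.
  have va : vol g `^ (alpha / n%:R) != 0 by rewrite gt_eqF ?powR_gt0.
  by field; rewrite va gt_eqF.
by rewrite ler_wpM2l// !mulr_ge0 ?powR_ge0// ?(ltW C10) ?(ltW Cr0)// invr_ge0 ltW.
Qed.

End Equivalence.

Theorem theorem1p2 (R : realType) (p : nat) (p_pr : prime p) (n : nat)
    (n_ge1 : (1 <= n)%N)
    (mu : {measure set (padic_space R p_pr n) -> \bar R})
    (mu_haar : is_haar_measure mu)
    (alpha beta : R) (beta_gt0 : 0 < beta) (beta_lt1 : beta < 1)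
    (alpha_gt0 : 0 < alpha) (alpha_lt : alpha < alpha + beta)
    (alphabeta_lt : alpha + beta < n%:R)
    (b : padic_space R p_pr n -> R)
    (b_loc : padic_locally_integrable mu b) :
  let B1 :=
    exists g : padic_space R p_pr n -> R,
      lipschitz_space beta g /\ {ae mu, forall x, b x = g x} in
  let B2 :=
    forall r q : padic_space R p_pr n -> R,
      admissible_exponents mu (alpha + beta) r q ->
      bounded_Lvar mu r q (max_commutator mu alpha b) in
  let B3 :=
    exists r q : padic_space R p_pr n -> R,
      admissible_exponents mu (alpha + beta) r q /\
      bounded_Lvar mu r q (max_commutator mu alpha b) in
  let B4 :=
    exists r q : padic_space R p_pr n -> R,
      admissible_exponents mu (alpha + beta) r q /\
      (oscillation_sup mu beta b q < +oo)%E in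
  let B5 :=
    forall r q : padic_space R p_pr n -> R,
      admissible_exponents mu (alpha + beta) r q ->
      (oscillation_sup mu beta b q < +oo)%E in
  [<-> B1; B2; B3; B4; B5].
Proof.
move=> B1 B2 B3 B4 B5.
have s0 : 0 < alpha + beta by exact: addr_gt0.
have t0 : 0 <= (alpha + beta) / n%:R by rewrite divr_ge0// ltW.
have [r0 [q0 adm0]] := admissible_exponents_exist mu_haar n_ge1 s0 alphabeta_lt.
have class_ge1 e : log_exponent_class mu e -> forall x, 1 <= e x.
  by move=> [[_ e1 _ _ _] _] x; exact/ltW/e1.
have B4_1 : B4 -> B1.
  move=> [r [q [[_ lq _ _ _] osc]]].
  have [[mq _ _ _ _] _] := lq.
  have [m [M [K [rho [qoo [lqd _]]]]]] := log_hoelder_dataP mu_haar lq.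
  apply: (lipschitz_representative mu_haar n_ge1 b_loc beta_gt0 mq lqd).
  exact: (oscillation_supP mu_haar n_ge1 b beta mq lqd).1.
tfae.
- move=> [f [fL bf]] r q adm.
  have [mr mq lr hM qE] := admissible_conj_exp n_ge1 s0 adm.
  have [_ lq _ _ _] := adm.
  have [L L0 hL] := lipschitz_space_ball beta_gt0 fL.
  have L1 : 0 < L + 1 by exact: ltr_wpDl.
  apply: (lipschitz_bounded_commutator mu_haar n_ge1 b_loc L1 bf _ t0 mr mq lr hM qE
    (class_ge1 r lr) (class_ge1 q lq)).
  move=> g a x y ax ay; apply: (le_trans (hL g a x y ax ay)).
  by rewrite ler_wpM2r ?powR_ge0// lerDl.
- by move=> h; exists r0, q0; split=> //; exact: h.
- move=> [r [q [adm h]]]; exists r, q; split=> //.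
  have [mr mq lr hM qE] := admissible_conj_exp n_ge1 s0 adm.
  have [_ lq _ _ _] := adm.
  exact: (bounded_commutator_oscillation mu_haar n_ge1 b_loc t0 mr mq lr hM qE
    (class_ge1 r lr) (class_ge1 q lq) h).
- move=> /B4_1[f [fL bf]] r q [_ lq _ _ _].
  have [[mq _ _ _ _] _] := lq.
  have [L L0 hL] := lipschitz_space_ball beta_gt0 fL.
  have [m [M [K [rho [qoo [lqd _]]]]]] := log_hoelder_dataP mu_haar lq.
  apply: (oscillation_supP mu_haar n_ge1 b beta mq lqd).2.
  exists (L + 1); first exact: ltr_wpDl.
  exact: (lipschitz_oscillation mu_haar b_loc L0 mq (class_ge1 q lq) bf hL).
- by move=> h; apply: B4_1; exists r0, q0; split=> //; exact: h adm0.
Qed.
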